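(* Let $V$ be a complex $n$-dimensional vector space and let $K\subseteq\bigwedge^2V$ be a subspace such that $\mathcal R(V,K)=\{0\}$. Then $W_q(V,K)=0$ for all $q\geq n-3$.
   Context: Let $S=\mathrm{Sym}(V)$ and let $K^\perp=(\bigwedge^2V/K)^\vee\subseteq\bigwedge^2V^\vee$ be the annihilator of $K$. The Koszul module $W(V,K)$ is the graded $S$-module $$W(V,K)=\mathrm{Coker}\Bigl\{\bigwedge^3V\otimes S\to\bigl(\bigwedge^2V/K\bigr)\otimes S\Bigr\},$$ where the map is the Koszul differential $\delta_3:\bigwedge^3V\otimes S\to\bigwedge^2V\otimes S$, $\delta_3(v_1\wedge v_2\wedge v_3\otimes f)=\sum_{j=1}^3(-1)^{j-1}v_1\wedge\cdots\wedge\widehat{v_j}\wedge\cdots\wedge v_3\otimes v_jf$, followed by the projection. Its degree $q$ component is $W_q(V,K)=\mathrm{Coker}\{\bigwedge^3V\otimes\mathrm{Sym}^{q-1}V\to(\bigwedge^2V/K)\otimes\mathrm{Sym}^qV\}$, which is $0$ for $q<0$. The resonance variety is $$\mathcal R(V,K)=\{a\in V^\vee:\text{ there exists } b\in V^\vee\text{ with } a\wedge b\in K^\perp\setminus\{0\}\}\cup\{0\}.$$ *)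

(* Defs.v *)
(* MathComp, with mathcomp-reals and multinomials *)
From HB Require Import structures.
From mathcomp Require Import all_boot all_order all_algebra all_fingroup.
From mathcomp Require Import ring_quotient generic_quotient.
From mathcomp Require Import boolp classical_sets reals.
From mathcomp Require Import complex mpoly ring.

Set Implicit Arguments.
Unset Strict Implicit.
Unset Printing Implicit Defensive.

Import GRing.Theory.
Local Open Scope ring_scope.
Local Open Scope quotient_scope.
Local Open Scope classical_set_scope.

(* Cokernel N / f(M) of a linear map, as a module over the base ring. *)
Section Cokernel.
Variables (R : comNzRingType) (M N : lmodType R) (f : {linear M -> N}).

Definition lin_image : {pred N} := [pred y | `[< exists x, f x = y >]].

Fact lin_imageP y : reflect (exists x, f x = y) (y \in lin_image).
Proof. exact: asboolP. Qed.

Fact lin_image_zmod_closed : zmod_closed lin_image.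
Proof.
split; first by apply/lin_imageP; exists 0; rewrite linear0.
move=> _ _ /lin_imageP[x <-] /lin_imageP[y <-].
by apply/lin_imageP; exists (x - y); rewrite linearB.
Qed.

HB.instance Definition _ :=
  GRing.isZmodClosed.Build N lin_image lin_image_zmod_closed.

Definition coker : Type := Quotient.quot lin_image.
HB.instance Definition _ := GRing.Zmodule.on coker.
HB.instance Definition _ := EqQuotient.on coker.

Definition coker_pi (y : N) : coker := \pi_(Quotient.quot lin_image) y.

Lemma coker_pi_eq y z : (coker_pi y = coker_pi z) <-> exists x, f x = y - z.
Proof.
split=> [/eqP | [x fx]].
  by rewrite /coker_pi -Quotient.idealrBE => /lin_imageP.
apply/eqP; rewrite /coker_pi -Quotient.idealrBE; apply/lin_imageP.
by exists x.
Qed.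

Lemma coker_pi_surj (w : coker) : exists y, coker_pi y = w.
Proof. by exists (repr w); rewrite /coker_pi reprK. Qed.

Definition coker_scale (a : R) (w : coker) : coker :=
  coker_pi (a *: repr (w : Quotient.quot lin_image)).

Fact coker_piD y z : coker_pi (y + z) = coker_pi y + coker_pi z.
Proof. exact: (raddfD \pi_(Quotient.quot lin_image)). Qed.

Fact coker_scale_pi a y : coker_scale a (coker_pi y) = coker_pi (a *: y).
Proof.
apply/coker_pi_eq.
have /coker_pi_eq[x fx] : coker_pi (repr (coker_pi y : Quotient.quot lin_image))
    = coker_pi y by rewrite /coker_pi reprK.
by exists (a *: x); rewrite linearZ /= fx scalerBr.
Qed.

Fact coker_scaleA a b w :
  coker_scale a (coker_scale b w) = coker_scale (a * b) w.
Proof. by have [y <-] := coker_pi_surj w; rewrite !coker_scale_pi scalerA. Qed.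

Fact coker_scale1 : left_id 1 coker_scale.
Proof.
by move=> w; have [y <-] := coker_pi_surj w; rewrite coker_scale_pi scale1r.
Qed.

Fact coker_scaleDr : right_distributive coker_scale +%R.
Proof.
move=> a w w'; have [y <-] := coker_pi_surj w; have [z <-] := coker_pi_surj w'.
by rewrite -coker_piD !coker_scale_pi -coker_piD scalerDr.
Qed.

Fact coker_scaleDl w : {morph coker_scale^~ w : a b / a + b}.
Proof.
move=> a b; have [y <-] := coker_pi_surj w.
by rewrite !coker_scale_pi -coker_piD scalerDl.
Qed.

HB.instance Definition _ := GRing.Zmodule_isLmodule.Build R coker
  coker_scaleA coker_scale1 coker_scaleDr coker_scaleDl.

Fact coker_pi_is_linear : linear coker_pi.
Proof. by move=> a y z; rewrite coker_piD -coker_scale_pi. Qed.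

HB.instance Definition _ := GRing.isLinear.Build R N coker _ coker_pi
  coker_pi_is_linear.

End Cokernel.

(* The quotient space E / U, realized on a complement of U; [vquot_pi_surj]
   and [vquot_pi_eq0] characterize it. *)
Section VectorQuotient.
Variables (F : fieldType) (E : vectType F) (U : {vspace E}).

Definition vquot : vectType F := subvs_of (U^C)%VS.

Definition vquot_pi (x : E) : vquot := vsproj (U^C)%VS (daddv_pi (U^C) U x).

Fact vquot_pi_is_linear : linear vquot_pi.
Proof. by move=> a x y; rewrite /vquot_pi !linearP. Qed.

HB.instance Definition _ := GRing.isLinear.Build F E vquot _ vquot_pi
  vquot_pi_is_linear.

Let cap0 : (U^C :&: U = 0)%VS. Proof. by rewrite capvC capv_compl. Qed.

Lemma vquot_pi_surj (w : vquot) : exists x, vquot_pi x = w.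
Proof.
exists (vsval w); rewrite /vquot_pi daddv_pi_id ?vsvalK //; exact: subvsP.
Qed.

Lemma vquot_pi_eq0 x : (vquot_pi x == 0) = (x \in U).
Proof.
have xE : daddv_pi U^C U x + daddv_pi U U^C x = x.
  by apply: daddv_pi_add; rewrite // addvC addv_complf memvf.
apply/eqP/idP => [/(congr1 (@vsval _ _ _))| xU].
  rewrite vsprojK ?memv_pi // linear0 => e0.
  by rewrite -xE e0 add0r memv_pi.
suff e0 : daddv_pi (U^C) U x = 0 by rewrite /vquot_pi e0 linear0.
have : daddv_pi U^C U x \in (U^C :&: U)%VS.
  rewrite memv_cap memv_pi /=.
  have -> : daddv_pi U^C U x = x - daddv_pi U U^C x by rewrite -{2}xE addrK.
  by rewrite rpredB ?memv_pi.
by rewrite cap0 memv0 => /eqP.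
Qed.

End VectorQuotient.

Section Koszul.
Variables (F : fieldType) (V : vectType F).

Local Notation n := (\dim {:V}).
Local Notation vbas := (vbasis {:V}).

Definition dual : vectType F := 'Hom(V, F^o).

(* Strictly increasing k-tuples i_1 < ... < i_k of indices of the basis
   [vbasis {:V}] = (e_1, ..., e_n). *)
Definition increasing k := {t : k.-tuple 'I_n | sorted ltn (map val t)}.

(* The exterior power of V, in coordinates with respect to the basis of the
   e_(i_1) /\ ... /\ e_(i_k). *)
Definition ext k : vectType F := {ffun increasing k -> F^o}.

(* v_1 /\ ... /\ v_k: its coordinates are the k x k minors. *)
Definition wedge k (v : 'I_k -> V) : ext k :=
  [ffun t => \det (\matrix_(i < k, j < k) coord vbas (tnth (val t) j) (v i))].

(* The form a /\ b on the second exterior power; whose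
   value on u /\ v is a(u) b(v) - a(v) b(u) by [wedge_formE]. *)
Definition wedge_form_fun (a b : dual) (x : ext 2) : F^o :=
  \sum_(t : increasing 2)
     let i := tnth (val t) ord0 in let j := tnth (val t) ord_max in
     x t * (a vbas`_i * b vbas`_j - a vbas`_j * b vbas`_i).

Definition wedge_form (a b : dual) : 'Hom(ext 2, F^o) :=
  linfun (wedge_form_fun a b).

(* The second exterior power of the dual of V is identified with the dual of
   the second exterior power of V. *)
Definition annihilator (K : {vspace ext 2}) : set 'Hom(ext 2, F^o) :=
  [set phi | forall x, x \in K -> phi x = 0].

Definition resonance (K : {vspace ext 2}) : set dual :=
  [set a | exists b, (annihilator K `\ 0) (wedge_form a b)] `|` [set 0].

(* S = Sym V, the polynomial ring on the basis of V. *)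
Definition sym : comNzRingType := {mpoly F[n]}.

Definition sym_inj (v : V) : sym := \sum_(i < n) coord vbas i v *: 'X_i.

(* Sym^q V inside S, zero for q < 0. *)
Definition sym_deg (q : int) : set sym :=
  if q is Posz d then [set p | p \is d.-homog] else [set 0].

Section Tensor.
Variable A : vectType F.

(* The free S-module A (x) S, in coordinates with respect to [vbasis {:A}]. *)
Definition tensS : lmodType sym := {ffun 'I_(\dim {:A}) -> sym^o}.

Definition tens (a : A) (p : sym) : tensS :=
  [ffun i => (coord (vbasis {:A}) i a)%:MP * p].

Definition tensS_deg (q : int) : set tensS :=
  [set x | forall i, sym_deg q (x i)].

End Tensor.

(* The S-linear extension of an F-linear map g : A -> M. *)
Definition extend (A : vectType F) (M : lmodType sym) (g : A -> M)
    (x : tensS A) : M :=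
  \sum_i x i *: g (vbasis {:A})`_i.

Fact extend_is_linear A (M : lmodType sym) g : linear (@extend A M g).
Proof.
move=> p x y; rewrite /extend scaler_sumr -big_split /=.
by apply: eq_bigr => i _; rewrite !ffunE scalerDl scalerA.
Qed.

HB.instance Definition _ A (M : lmodType sym) g :=
  GRing.isLinear.Build sym (tensS A) M _ (@extend A M g) (extend_is_linear g).

(* sum_j (-1)^j v_0 /\ ... omit v_j ... /\ v_k (x) v_j, with j starting
   at 0. *)
Definition koszul_pure k (v : 'I_k.+1 -> V) : tensS (ext k) :=
  \sum_(j < k.+1)
     (-1) ^+ j *: tens (wedge (fun i => v (lift j i))) (sym_inj (v j)).

Definition koszul_wedge k (x : ext k.+1) : tensS (ext k) :=
  \sum_(t : increasing k.+1)
     (x t)%:MP *: koszul_pure (fun i => vbas`_(tnth (val t) i)).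

(* The Koszul differential; [koszul_diff3E] is its formula on
   v_1 /\ v_2 /\ v_3 (x) p. *)
Definition koszul_diff k : {linear tensS (ext k.+1) -> tensS (ext k)} :=
  @extend (ext k.+1) (tensS (ext k)) (@koszul_wedge k).

Definition proj_tensS (K : {vspace ext 2}) :
    {linear tensS (ext 2) -> tensS (vquot K)} :=
  @extend (ext 2) (tensS (vquot K)) (fun w => tens (vquot_pi K w) 1).

Definition koszul_map (K : {vspace ext 2}) :
    {linear tensS (ext 3) -> tensS (vquot K)} :=
  proj_tensS K \o koszul_diff 2.

Definition koszul_module (K : {vspace ext 2}) : lmodType sym :=
  coker (koszul_map K).

(* Degree q component: the image of the degree q elements of
   (ext 2 / K) (x) S. By [coker_koszul_eq0] it is the cokernel of the degree q
   part of [koszul_map]. *)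
Definition koszul_component (K : {vspace ext 2}) (q : int) :
    set (koszul_module K) :=
  [set coker_pi (koszul_map K) x | x in @tensS_deg (vquot K) q].

End Koszul.

Arguments koszul_component {F V} K q.

(* A sum over all maps 'I_k -> 'I_n against an alternating g, rewritten as a sum
   over increasing k-tuples. *)
Section AlternatingSum.
Variables (R : comNzRingType) (U : lmodType R) (n k : nat).
Variables (c : 'I_k -> 'I_n -> R) (g : ('I_k -> 'I_n) -> U).
Hypothesis g_tperm : forall (phi : 'I_k -> 'I_n) i j, i != j ->
  g (phi \o tperm i j) = - g phi.
Hypothesis g_eq0 : forall (phi : 'I_k -> 'I_n) i j, i != j ->
  phi i = phi j -> g phi = 0.

Let inc := {t : k.-tuple 'I_n | sorted ltn (map val t)}.

Fact g_perm phi (s : 'S_k) : g (phi \o s) = (-1) ^+ s *: g phi.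
Proof.
have [ts -> dts] := prod_tpermP s.
elim: ts dts phi => [|ij ts IH] /= => [_ phi|/andP[dij dts] phi].
  rewrite big_nil odd_perm1 scale1r; congr g; apply: funext => i /=.
  by rewrite perm1.
have -> : phi \o (\prod_(t <- ij :: ts) tperm t.1 t.2)%g
    = (phi \o (\prod_(t <- ts) tperm t.1 t.2)%g) \o tperm ij.1 ij.2.
  by apply: funext => i /=; rewrite big_cons permM.
rewrite g_tperm // IH // big_cons odd_mul_tperm.
move: dij; rewrite /dpair /= => ->.
by rewrite signr_addb expr1 mulN1r scaleNr.
Qed.

Fact alternating_sum :
  \sum_(phi : {ffun 'I_k -> 'I_n}) (\prod_i c i (phi i)) *: g phi =
  \sum_(t : inc) \det (\matrix_(i, j) c i (tnth (val t) j)) *: g (tnth (val t)).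
Proof.
pose h (p : inc * 'S_k) : {ffun 'I_k -> 'I_n} :=
  [ffun i => tnth (val p.1) (p.2 i)].
have inc_inj (t : inc) : injective (tnth (val t)).
  move=> i j; have x0 := tnth (val t) i; rewrite !(tnth_nth x0) => /eqP.
  rewrite nth_uniq ?size_tuple // => [/eqP/val_inj //|].
  rewrite -(map_inj_uniq val_inj).
  by apply: sorted_uniq (valP t); [exact: ltn_trans | exact: ltnn].
have h_inj : injective h.
  move=> [t s] [t' s'] /= /ffunP e.
  have et : t = t'.
    apply/val_inj/val_inj; apply: (inj_map val_inj).
    apply: (irr_sorted_eq ltn_trans ltnn (valP t) (valP t')) => m.
    suff sub (r r' : inc) (z z' : 'S_k) :
        (forall i, tnth (val r) (z i) = tnth (val r') (z' i)) ->
        m \in map val (val r) -> m \in map val (val r').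
      apply/idP/idP.
        by apply: (sub t t' s s') => i; have := e i; rewrite !ffunE.
      by apply: (sub t' t s' s) => i; have := e i; rewrite !ffunE.
    move=> {}e /mapP[x /tnthP[i ->] ->]; apply: map_f.
    by rewrite -[i in tnth _ i](permKV z) e mem_tnth.
  rewrite et in e *; congr pair; apply/permP => i; apply: (@inc_inj t').
  by have := e i; rewrite !ffunE.
have detE (t : inc) :
    \det (\matrix_(i, j) c i (tnth (val t) j)) *: g (tnth (val t))
    = \sum_(s : 'S_k) (\prod_i c i (h (t, s) i)) *: g (h (t, s)).
  rewrite /determinant scaler_suml; apply: eq_bigr => s _.
  have -> : h (t, s) = tnth (val t) \o s :> (_ -> _).
    by apply: funext => i; exact: ffunE.
  rewrite g_perm scalerA mulrC; congr (_ *: _); congr (_ * _).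
  by apply: eq_bigr => i _; rewrite mxE.
rewrite (eq_bigr _ (fun t _ => detE t)) pair_big /=.
rewrite (bigID (mem (h @: [set: inc * 'S_k]%SET))) /= [X in _ + X]big1 ?addr0.
  rewrite big_imset /=; last by move=> ? ? _ _; apply: h_inj.
  by apply: eq_big => [p|[t s] _] //; rewrite finset.in_setT.
move=> phi phiN.
suff [i [j [ij e]]] : exists i j, i != j /\ phi i = phi j.
  by rewrite (g_eq0 ij e) scaler0.
apply: contrapT => inj; move/negP: phiN; apply.
have phi_inj : injective phi.
  by move=> i j e; apply: contrapT => /eqP ij; apply: inj; exists i, j.
pose t0 := [tuple phi i | i < k].
have t0_uniq : uniq t0 by rewrite map_inj_uniq ?enum_uniq.
pose ltI := fun x y : 'I_n => (x <= y)%N.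
have ltI_tot : total ltI by move=> x y; exact: leq_total.
pose t1 := [tuple of sort ltI t0].
have t1P : sorted ltn (map val t1).
  rewrite ltn_sorted_uniq_leq map_inj_uniq; last exact: val_inj.
  by rewrite sort_uniq t0_uniq sorted_map; apply: sort_sorted.
have /tuple_permP[s es] : perm_eq t0 t1 by rewrite perm_sym perm_sort.
apply/imsetP; exists (exist _ t1 t1P, s); first by rewrite finset.in_setT.
apply/ffunP => i; rewrite /h ffunE /=.
have -> : phi i = tnth t0 i by rewrite tnth_mktuple.
have -> : t0 = [tuple tnth t1 (s i) | i < k] by apply: val_inj.
by rewrite tnth_mktuple.
Qed.

End AlternatingSum.

Section KoszulTheory.
Variables (F : fieldType) (V : vectType F).

Local Notation n := (\dim {:V}).
Local Notation vbas := (vbasis {:V}).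

Definition vec2 (T : Type) (u v : T) : 'I_2 -> T :=
  fun i => tnth [tuple u; v] i.
Definition vec3 (T : Type) (u v w : T) : 'I_3 -> T :=
  fun i => tnth [tuple u; v; w] i.

Fact vec2E (T : Type) (v : 'I_2 -> T) : v = vec2 (v ord0) (v ord_max).
Proof.
by apply: funext => i; case: (unliftP ord0 i) => [j ->|->] //;
  rewrite (ord1 j); congr v; apply: val_inj.
Qed.

Fact vec3E (T : Type) (v : 'I_3 -> T) :
  v = vec3 (v ord0) (v (inord 1)) (v ord_max).
Proof.
by apply: funext => -[[|[|[|//]]] i3]; congr v; apply: val_inj => //=;
  rewrite inordK.
Qed.

Fact vbas_sum (v : V) : v = \sum_i coord vbas i v *: vbas`_i.
Proof. by rewrite -coord_vbasis ?memvf. Qed.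

Fact coord_vbas (i j : 'I_n) : coord vbas j vbas`_i = (i == j)%:R.
Proof. by rewrite coord_free ?(basis_free (vbasisP _)) // eq_sym. Qed.

Section Expand.
Variables (R : comNzRingType) (rho : {rmorphism F -> R}) (U : lmodType R).

Fact expand1 (f : V -> U) :
  (forall a x y, f (a *: x + y) = rho a *: f x + f y) ->
  forall v, f v = \sum_i rho (coord vbas i v) *: f vbas`_i.
Proof.
move=> fl v; have f0 : f 0 = 0.
  apply: (addrI (f 0)); rewrite addr0 -{3}[0 : V](scale1r 0).
  by rewrite -[in RHS](addr0 (1 *: 0)) fl rmorph1 scale1r.
rewrite {1}[v]vbas_sum; elim/big_rec2: _ => // i x y _ <-.
by rewrite fl.
Qed.

Fact expand2 (f : V -> V -> U) :
  (forall a x y v, f (a *: x + y) v = rho a *: f x v + f y v) ->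
  (forall a x y v, f v (a *: x + y) = rho a *: f v x + f v y) ->
  forall u v, f u v =
    \sum_(phi : {ffun 'I_2 -> 'I_n})
      (\prod_i rho (coord vbas (phi i) (vec2 u v i)))
      *: f vbas`_(phi ord0) vbas`_(phi ord_max).
Proof.
move=> fl fr u v; rewrite (expand1 (f := f^~ v)) //.
under eq_bigr => i _ do rewrite (expand1 (f := f _)) // scaler_sumr.
rewrite pair_big /=.
pose h (p : 'I_n * 'I_n) : {ffun 'I_2 -> 'I_n} := finfun (vec2 p.1 p.2).
rewrite [RHS](reindex h) /=.
  apply: eq_bigr => p _.
  by rewrite big_ord_recl big_ord1 !ffunE scalerA.
exists (fun phi => (phi ord0, phi ord_max)) => [[i j] _|phi _].
  by rewrite !ffunE.
by apply/ffunP => i; rewrite ffunE /= -vec2E.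
Qed.

Fact expand3 (f : V -> V -> V -> U) :
  (forall a x y v w, f (a *: x + y) v w = rho a *: f x v w + f y v w) ->
  (forall a x y v w, f v (a *: x + y) w = rho a *: f v x w + f v y w) ->
  (forall a x y v w, f v w (a *: x + y) = rho a *: f v w x + f v w y) ->
  forall u v w, f u v w =
    \sum_(phi : {ffun 'I_3 -> 'I_n})
      (\prod_i rho (coord vbas (phi i) (vec3 u v w i)))
      *: f vbas`_(phi ord0) vbas`_(phi (inord 1)) vbas`_(phi ord_max).
Proof.
move=> f1 f2 f3 u v w; rewrite (expand1 (f := fun x => f x v w)) //.
under eq_bigr => i _.
  rewrite (expand1 (f := fun x => f _ x w)) // scaler_sumr.
  under eq_bigr => j _ do
    rewrite (expand1 (f := f _ _)) // scaler_sumr scaler_sumr.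
  over.
under eq_bigr => i _ do rewrite pair_big /=.
rewrite pair_big /=.
pose h (p : 'I_n * ('I_n * 'I_n)) : {ffun 'I_3 -> 'I_n} :=
  finfun (vec3 p.1 p.2.1 p.2.2).
have i1 : inord 1 = lift ord0 ord0 :> 'I_3 by apply: val_inj; rewrite /= inordK.
rewrite [RHS](reindex h) /=.
  apply: eq_bigr => p _.
  by rewrite i1 !big_ord_recl big_ord0 mulr1 !ffunE !scalerA !mulrA.
exists (fun phi => (phi ord0, (phi (inord 1), phi ord_max)))
  => [[i [j k]] _|phi _].
  by rewrite i1 !ffunE.
by apply/ffunP => i; rewrite ffunE /= -vec3E.
Qed.

End Expand.

Fact wedge2E (u v : V) (t : increasing V 2) : wedge (vec2 u v) t =
  coord vbas (tnth (val t) ord0) u * coord vbas (tnth (val t) ord_max) v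
  - coord vbas (tnth (val t) ord_max) u * coord vbas (tnth (val t) ord0) v.
Proof.
rewrite ffunE (expand_det_row _ ord0) big_ord_recl big_ord1 /cofactor !det_mx11.
rewrite !mxE /= expr0 expr1 mul1r mulN1r mulrN.
have -> : ord_max = lift ord0 ord0 :> 'I_2 by apply: val_inj.
by have -> : lift (lift ord0 ord0) ord0 = ord0 :> 'I_2 by apply: val_inj.
Qed.

Fact ffun_linE (I : finType) (a : F) (x y : {ffun I -> F^o}) t :
  (a *: x + y) t = a * x t + y t.
Proof. by rewrite !ffunE. Qed.

Fact wedge2Dl a (x y v : V) :
  wedge (vec2 (a *: x + y) v) = a *: wedge (vec2 x v) + wedge (vec2 y v).
Proof. by apply/ffunP => t; rewrite ffun_linE !wedge2E !linearP /=; ring. Qed.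

Fact wedge2N (u v : V) : wedge (vec2 v u) = - wedge (vec2 u v).
Proof.
apply/ffunP => t; rewrite -scaleN1r -[_ *: _]addr0 ffun_linE.
by rewrite [X in _ + X]ffunE !wedge2E; ring.
Qed.

Fact wedge2_diag (u : V) : wedge (vec2 u u) = 0.
Proof. by apply/ffunP => t; rewrite wedge2E ffunE mulrC subrr. Qed.

Fact wedge2Dr a (x y v : V) :
  wedge (vec2 v (a *: x + y)) = a *: wedge (vec2 v x) + wedge (vec2 v y).
Proof. by rewrite wedge2N wedge2Dl opprD -scalerN -!wedge2N. Qed.

Fact wedge_form_is_linear (a b : dual V) : linear (wedge_form_fun a b).
Proof.
move=> c x y; rewrite /wedge_form_fun scaler_sumr -big_split /=.
by apply: eq_bigr => t _; rewrite ffun_linE mulrDl -mulrA.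
Qed.

HB.instance Definition _ a b :=
  GRing.isLinear.Build F (ext V 2) F^o _ (wedge_form_fun a b)
    (wedge_form_is_linear a b).

Lemma wedge_formE (a b : dual V) (v : 'I_2 -> V) :
  wedge_form a b (wedge v) =
    a (v ord0) * b (v ord_max) - a (v ord_max) * b (v ord0).
Proof.
rewrite lfunE /= [v]vec2E; set u := v ord0; set w := v ord_max.
pose f x y : F^o := a x * b y - a y * b x.
have fl c x y z : f (c *: x + y) z = c *: f x z + f y z.
  by rewrite /f !linearP /= /GRing.scale /=; ring.
have fr c x y z : f z (c *: x + y) = c *: f z x + f z y.
  by rewrite /f !linearP /= /GRing.scale /=; ring.
rewrite [RHS](_ : _ = f u w); last by [].
rewrite (expand2 (rho := idfun) fl fr).
pose g (phi : 'I_2 -> 'I_n) := f vbas`_(phi ord0) vbas`_(phi ord_max).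
have ord2P (i j : 'I_2) : i != j ->
    (i = ord0 /\ j = ord_max) \/ (i = ord_max /\ j = ord0).
  by move: i j => [[|[|//]] ?] [[|[|//]] ?] //= _; [left | right];
    split; apply: val_inj.
have gT (phi : 'I_2 -> 'I_n) i j : i != j -> g (phi \o tperm i j) = - g phi.
  by rewrite /g /f /= => /ord2P[][-> ->]; rewrite tpermL tpermR; ring.
have g0 (phi : 'I_2 -> 'I_n) i j : i != j -> phi i = phi j -> g phi = 0.
  by rewrite /g /f => /ord2P[][-> ->] ->; rewrite subrr.
rewrite [RHS](alternating_sum (fun i j => coord vbas j (vec2 u w i)) gT g0).
by apply: eq_bigr => t _; rewrite ffunE.
Qed.

Section Tensor.
Variable A : vectType F.

Fact tens_linE (a : F) (x y : A) (p : sym V) :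
  tens (a *: x + y) p = a%:MP *: tens x p + tens y p.
Proof.
by apply/ffunP => i; rewrite !ffunE linearP /= rmorphD rmorphM /= mulrDl -mulrA.
Qed.

Fact tensZ (x : A) (p q : sym V) : tens x (p * q) = q *: tens x p.
Proof. by apply/ffunP => i; rewrite !ffunE mulrA mulrC. Qed.

Fact tensN (x : A) (p : sym V) : tens (- x) p = - tens x p.
Proof. by apply/ffunP => i; rewrite !ffunE linearN /= rmorphN mulNr. Qed.

Fact tensDr (x : A) (p q : sym V) : tens x (p + q) = tens x p + tens x q.
Proof. by apply/ffunP => i; rewrite !ffunE mulrDr. Qed.

Lemma extend_tens (M : lmodType (sym V)) (g : A -> M) :
  (forall a x y, g (a *: x + y) = a%:MP *: g x + g y) ->
  forall a p, extend g (tens a p) = p *: g a.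
Proof.
move=> gl a p; have g0 : g 0 = 0.
  apply: (addrI (g 0)); rewrite addr0 -{3}[0 : A](scale1r 0).
  by rewrite -[in RHS](addr0 (1 *: 0)) gl mpolyC1 scale1r.
have -> : g a = \sum_i (coord (vbasis {:A}) i a)%:MP *: g (vbasis {:A})`_i.
  rewrite {1}(coord_vbasis (memvf a)); elim/big_rec2: _ => // i x y _ <-.
  by rewrite gl.
rewrite /extend scaler_sumr; apply: eq_bigr => i _.
by rewrite ffunE scalerA mulrC.
Qed.

End Tensor.

Fact sym_inj_linear : linear (@sym_inj F V).
Proof.
move=> a u v; rewrite /sym_inj scaler_sumr -big_split /=.
by apply: eq_bigr => i _; rewrite linearP scalerDl scalerA.
Qed.

Section Alternating3.
Variables (R : comNzRingType) (rho : {rmorphism F -> R}) (U : lmodType R).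
Variable f : V -> V -> V -> U.
Hypothesis fl : forall a x y z w,
  f (a *: x + y) z w = rho a *: f x z w + f y z w.
Hypothesis f10 : forall x z w, f x z w = - f z x w.
Hypothesis f21 : forall x z w, f x z w = - f x w z.
Hypothesis f0 : forall x w, f x x w = 0.

Fact expand_alt3 (u v w : V) : f u v w =
  \sum_(t : increasing V 3) rho (wedge (vec3 u v w) t) *:
     f vbas`_(tnth (val t) ord0) vbas`_(tnth (val t) (inord 1))
       vbas`_(tnth (val t) ord_max).
Proof.
have fm a x y z t : f z (a *: x + y) t = rho a *: f z x t + f z y t.
  by rewrite f10 fl opprD -scalerN -(f10 z x) -(f10 z y).
have fr a x y z t : f z t (a *: x + y) = rho a *: f z t x + f z t y.
  by rewrite f21 fm opprD -scalerN -(f21 z t x) -(f21 z t y).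
rewrite (expand3 fl fm fr).
pose g (phi : 'I_3 -> 'I_n) :=
  f vbas`_(phi ord0) vbas`_(phi (inord 1)) vbas`_(phi ord_max).
have ord3 (i : 'I_3) : [\/ i = ord0, i = inord 1 | i = ord_max].
  by move: i => [[|[|[|//]]] ?]; [apply: Or31 | apply: Or32 | apply: Or33];
    apply: val_inj; rewrite /= ?inordK.
have d01 : ord0 != inord 1 :> 'I_3 by rewrite -val_eqE /= inordK.
have d02 : ord0 != ord_max :> 'I_3 by [].
have d12 : inord 1 != ord_max :> 'I_3 by rewrite -val_eqE /= inordK.
have d10 : inord 1 != ord0 :> 'I_3 by rewrite eq_sym.
have d20 : ord_max != ord0 :> 'I_3 by [].
have d21 : ord_max != inord 1 :> 'I_3 by rewrite eq_sym.
have f20 x y z : f x y z = - f z y x by rewrite f10 f21 (f10 y z) opprK.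
have gT (phi : 'I_3 -> 'I_n) i j : i != j -> g (phi \o tperm i j) = - g phi.
  rewrite /g /=.
  by case: (ord3 i) (ord3 j) => -> [] ->; rewrite ?eqxx // => _;
    rewrite ?tpermL ?tpermR ?tpermD //;
    first [exact: f10 | exact: f21 | exact: f20].
have f0' x y : f y x x = 0 by rewrite f10 f21 f0 !oppr0.
have f0'' x y : f x y x = 0 by rewrite f21 f0 oppr0.
have g0 (phi : 'I_3 -> 'I_n) i j : i != j -> phi i = phi j -> g phi = 0.
  rewrite /g /=.
  by case: (ord3 i) (ord3 j) => -> [] ->; rewrite ?eqxx // => _ ->.
rewrite [LHS](alternating_sum
  (fun i j => rho (coord vbas j (vec3 u v w i))) gT g0).
apply: eq_bigr => t _; rewrite ffunE -det_map_mx; congr (\det _ *: _).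
by apply/matrixP => i j; rewrite !mxE.
Qed.

End Alternating3.

Fact tens_sym_inj_linE (A : vectType F) (w : A) a (u v : V) :
  tens w (sym_inj (a *: u + v)) =
    a%:MP *: tens w (sym_inj u) + tens w (sym_inj v).
Proof. by rewrite sym_inj_linear tensDr -mul_mpolyC mulrC tensZ. Qed.

Fact koszul_pure3E (u v w : V) : koszul_pure (vec3 u v w) =
  tens (wedge (vec2 v w)) (sym_inj u) - tens (wedge (vec2 u w)) (sym_inj v)
  + tens (wedge (vec2 u v)) (sym_inj w).
Proof.
rewrite /koszul_pure 3!big_ord_recl.
rewrite big_ord0.
rewrite [X in _ + (_ + X)]addr0.
rewrite expr0.
rewrite scale1r.
rewrite expr1 scaleN1r /bump /= sqrrN expr1n scale1r addrA.
have E (x y z : V) (j : 'I_3) : wedge (fun i : 'I_2 => vec3 x y z (lift j i)) =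
  wedge (vec2 (vec3 x y z (lift j ord0)) (vec3 x y z (lift j ord_max))).
  by congr wedge; rewrite [LHS]vec2E.
by rewrite !E.
Qed.

Fact koszul_wedge_linE k a (x y : ext V k.+1) :
  koszul_wedge (a *: x + y) = a%:MP *: koszul_wedge x + koszul_wedge y.
Proof.
rewrite /koszul_wedge scaler_sumr -big_split /=; apply: eq_bigr => t _.
by rewrite ffun_linE rmorphD rmorphM scalerDl scalerA.
Qed.

Fact koszul_wedge3E (v : 'I_3 -> V) : koszul_wedge (wedge v) = koszul_pure v.
Proof.
rewrite [v in RHS]vec3E.
rewrite (expand_alt3 (rho := @mpolyC n F)
  (f := fun x y z => koszul_pure (vec3 x y z))) -?vec3E.
- by apply: eq_bigr => t _; rewrite -(vec3E (fun i => vbas`_(tnth (val t) i))).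
- move=> a x y z w; rewrite !koszul_pure3E !wedge2Dl !tens_linE.
  rewrite tens_sym_inj_linE !scalerDr !scalerN opprD.
  by rewrite [_ + _ + (- _ - _)]addrACA; exact: addrACA.
- move=> x z w; rewrite !koszul_pure3E (wedge2N z x) tensN !opprD opprK.
  by congr (_ + _); exact: addrC.
- move=> x z w; rewrite !koszul_pure3E (wedge2N z w) tensN !opprD !opprK.
  by rewrite addrAC.
- move=> x w; rewrite koszul_pure3E wedge2_diag subrr add0r.
  by apply/ffunP => i; rewrite !ffunE linear0 mpolyC0 mul0r.
Qed.

Lemma koszul_diff3E (v : 'I_3 -> V) (p : sym V) :
  koszul_diff V 2 (tens (wedge v) p) =
  \sum_(j < 3) (-1) ^+ j *:
     tens (wedge (fun i => v (lift j i))) (sym_inj (v j) * p).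
Proof.
rewrite /= extend_tens; last exact: koszul_wedge_linE.
rewrite koszul_wedge3E /koszul_pure scaler_sumr; apply: eq_bigr => j _.
by rewrite tensZ !scalerA mulrC.
Qed.

Lemma proj_tensSE (K : {vspace ext V 2}) (w : ext V 2) (p : sym V) :
  proj_tensS K (tens w p) = tens (vquot_pi K w) p.
Proof.
rewrite /= extend_tens => [|a x y]; first by rewrite -tensZ mul1r.
by rewrite linearP tens_linE.
Qed.

End KoszulTheory.

Section KoszulGrading.
Variables (F : fieldType) (V : vectType F).
Implicit Types (p : sym V) (q : int) (K : {vspace ext V 2}).

Definition sym_part q p : sym V :=
  if q is Posz d then pihomog mdeg d p else 0.

Fact sym_part_deg q p : sym_deg q (sym_part q p).
Proof. by case: q => d //=; exact: pihomogP. Qed.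

Fact sym_part_id q p : sym_deg q p -> sym_part q p = p.
Proof. by case: q => d /= => [/pihomog_dE|->]. Qed.

Fact sym_part_is_zmod_morphism q : zmod_morphism (sym_part q).
Proof. by case: q => d p p' /=; rewrite ?raddfB ?subr0. Qed.

HB.instance Definition _ q :=
  GRing.isZmodMorphism.Build (sym V) (sym V) (sym_part q)
    (sym_part_is_zmod_morphism q).

Fact sym_part_homog q d p :
  p \is d.-homog -> sym_part q p = if q == d%:Z then p else 0.
Proof.
move=> dp; case: q => e //=; rewrite eqz_nat; case: eqVneq => [->|ne].
  exact: pihomog_dE.
by apply: pihomog_ne0 dp; rewrite eq_sym.
Qed.

Fact sym_partM q p z :
  z \is 1.-homog -> sym_part q (p * z) = sym_part (q - 1) p * z.
Proof.
move=> z1; rewrite [p](pihomog_partitionE (mf := mdeg) (leqnn _)) mulr_suml.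
rewrite !raddf_sum mulr_suml; apply: eq_bigr => d _.
have pd := pihomogP mdeg d p.
have /= -> := sym_part_homog q (dhomogM pd z1 : (_ : sym V) \is _).
rewrite (sym_part_homog _ pd).
have -> : (q == (d + 1)%N) = (q - 1 == d%:Z) by rewrite PoszD subr_eq.
by case: ifP => _; rewrite ?mul0r.
Qed.

Fact sym_inj_homog (v : V) : sym_inj v \is 1.-homog.
Proof.
by apply: rpred_sum => i _; apply: rpredZ; rewrite dhomogX /= mdeg1.
Qed.

Fact koszul_wedge_homog k (x : ext V k.+1) i : koszul_wedge x i \is 1.-homog.
Proof.
rewrite /koszul_wedge sum_ffunE; apply: rpred_sum => t _.
rewrite ffunE /= [_ *: _]mul_mpolyC; apply: rpredZ.
rewrite /koszul_pure sum_ffunE; apply: rpred_sum => j _.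
rewrite !ffunE mul_mpolyC /GRing.scale /= rpredMsign; apply: rpredZ.
exact: sym_inj_homog.
Qed.

Lemma coker_koszul_eq0 K q (x : tensS V (vquot K)) : tensS_deg q x ->
  coker_pi (koszul_map K) x = 0 <->
  exists2 y, tensS_deg (q - 1) y & koszul_map K y = x.
Proof.
move=> xq; rewrite -(linear0 (coker_pi (koszul_map K))) coker_pi_eq subr0.
split=> [[y yx]|[y _ yx]]; last by exists y.
exists [ffun i => sym_part (q - 1) (y i)].
  by move=> i; rewrite ffunE; exact: sym_part_deg.
have kE y' : koszul_map K y' = \sum_i y' i *:
    proj_tensS K (koszul_wedge (vbasis {: ext V 3})`_i).
  rewrite -[LHS]/(proj_tensS K (\sum_i y' i *: koszul_wedge _`_i)) linear_sum.
  by apply: eq_bigr => i _; rewrite linearZ.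
pose z i : tensS V (vquot K) :=
  proj_tensS K (koszul_wedge (vbasis {: ext V 3})`_i).
have zE y' j : koszul_map K y' j = \sum_i (y' i : sym V) * (z i j : sym V).
  by rewrite kE sum_ffunE; apply: eq_bigr => i _; rewrite ffunE.
have z1 i j : (z i j : sym V) \is 1.-homog.
  rewrite /z /= /extend sum_ffunE; apply: rpred_sum => l _.
  rewrite !ffunE mulr1.
  by rewrite /GRing.scale /= mulrC mul_mpolyC; apply/rpredZ/koszul_wedge_homog.
apply/ffunP => j; rewrite zE.
have xj : x j = \sum_i (y i : sym V) * (z i j : sym V).
  by rewrite -yx; exact: zE.
rewrite -(sym_part_id (xq j)) xj [RHS](raddf_sum (sym_part q)).
apply: eq_bigr => i _.
by rewrite [RHS](sym_partM _ _ (z1 i j)) ffunE.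
Qed.

End KoszulGrading.

(* Main.v *)
Require Import Defs.
From HB Require Import structures.
From mathcomp Require Import all_boot all_order all_algebra.
From mathcomp Require Import boolp classical_sets functions reals.
From mathcomp Require Import complex mpoly ring zify.

Set Implicit Arguments.
Unset Strict Implicit.
Unset Printing Implicit Defensive.

Import Order.TTheory GRing.Theory Num.Theory.
Local Open Scope ring_scope.

(** Let [k_j] span [K] and let [R_l(j)] be the coordinates of the Koszul
    differential of [k_j]. By exactness of the Koszul complex, the vanishing
    of [W_q] says that every syzygy [\sum_l x_l c_l = 0] with [c] of degree
    [q + 1] is an [S]-combination of the columns [R(j)].

    The module [W] has finite length. Otherwise the eigenvalues of the
    multiplications [x_k / x_i] on [W] in large degree, given by
    Cayley-Hamilton, yield a point of its support, and a nonzero form on the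
    fibre of [W] there is divisible by that point, which is then a resonant
    vector. So [x_t^M e_t /\ e_i] is a combination, with coefficients
    [e_ti(j)], of the [k_j] modulo the Koszul boundaries.

    On the exterior algebra of [S^p] tensored with divided powers in [n]
    variables, the contractions by the [R_l] give a differential [D] and the
    products with the [e_ti] give homotopies [h_t]. The operator [D h_t + h_t
    D] is the level times [x_t^(M+1)] plus commuting operators [P_i] with
    [P_i^2 = x_t^(M+1) P_i], hence its eigenvalues on positive levels are
    positive multiples of [x_t^(M+1)], and a power of [x_t] annihilates the
    homology there. Starting from an element [T_2] made of [c], this gives
    elements with [D T_(k+1) = x_k^(N_k) T_k] modulo the powers [x_i^(N_i)],
    [i < k]. When [c] has degree at least [n - 2], the degree of [T_n] puts it
    in the ideal of all the [x_i^(N_i)]; since these form a regular sequence,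
    one descends to [T_2] in the image of [D] modulo [x_0^(N_0)] and
    [x_1^(N_1)], and contracting with the [R_l] recovers [c]. *)

(** * Monomial ideals *)

Section MonomialIdeals.
Variables (F : fieldType) (n : nat).
Local Notation S := {mpoly F[n]}.
Implicit Types (p q r : S) (m : 'X_{1..n}) (A B : pred 'X_{1..n}).

(** For upward closed [A] this is membership in the ideal spanned by the monomials in [A]. It serves
    both for ideals generated by powers of variables and for lower bounds on the order. *)
Definition supported A p := {in msupp p, forall m, A m}.

Definition upward A := forall m m', A m -> A (m + m')%MM.

Lemma supported0 A : supported A 0.
Proof. by move=> m; rewrite msupp0. Qed.

Lemma supportedD A p q : supported A p -> supported A q -> supported A (p + q).
Proof.
move=> Ap Aq m /msuppD_le; rewrite mem_cat => /orP[]; [exact: Ap | exact: Aq].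
Qed.

Lemma supportedN A p : supported A p -> supported A (- p).
Proof. by move=> Ap m; rewrite (perm_mem (msuppN _)); apply: Ap. Qed.

Lemma supportedB A p q : supported A p -> supported A q -> supported A (p - q).
Proof. by move=> Ap Aq; apply: supportedD => //; apply: supportedN. Qed.

Lemma supported_sum A (I : Type) (r : seq I) (P : pred I) (f : I -> S) :
  (forall i, P i -> supported A (f i)) -> supported A (\sum_(i <- r | P i) f i).
Proof.
by move=> Af; elim/big_ind: _ => //; [apply: supported0 | apply: supportedD].
Qed.

Lemma supported_sub A B p : subpred A B -> supported A p -> supported B p.
Proof. by move=> AB Ap m /Ap /AB. Qed.

Lemma supportedM A p q : upward A -> supported A p -> supported A (q * p).
Proof.
move=> upA Ap m /msuppM_le /allpairsP[[m1 m2] /= [_ /Ap Am ->]].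
by rewrite addmC; apply: upA.
Qed.

Lemma mem_msuppMX p m m' :
  (m' \in msupp ('X_[m] * p)) = (m <= m')%MM && ((m' - m)%MM \in msupp p).
Proof.
case: (boolP (m <= m')%MM) => [le|nle] /=.
  rewrite -{1}(submK le) !mcoeff_msupp addmC.
  by rewrite -commr_mpolyX mcoeffMX.
apply/negP => /msuppM_le /allpairsP[[m1 m2] /= []].
by rewrite msuppX inE => /eqP -> _ e; rewrite e lem_addr in nle.
Qed.

Lemma supportedX A m : supported A 'X_[m] <-> A m.
Proof.
split=> [/(_ m)|Am m']; rewrite msuppX inE ?eqxx; first by apply.
by move=> /eqP ->.
Qed.

(** The quotient collects the terms of [p] divisible by ['X_[m]]; only the other terms survive in
    the difference. *)
Lemma supported_divX A p m :
  supported (fun m' => (m <= m')%MM || A m') p ->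
  exists q, supported A (p - 'X_[m] * q).
Proof.
move=> sp; exists (\sum_(m' <- msupp p | (m <= m')%MM) p@_m' *: 'X_[m' - m]).
rewrite {1}[p]mpolyE (bigID (fun m' => (m <= m')%MM)) /= mulr_sumr.
set s1 := \sum_(_ <- _ | _) _; set s2 := \sum_(_ <- _ | _) _.
set s3 := \sum_(_ <- _ | _) _.
have -> : s1 = s3.
  by apply: eq_bigr => m' le; rewrite -scalerAr -mpolyXD addmC submK.
rewrite addrAC subrr add0r /s2 big_seq_cond;
  apply: supported_sum => m' /andP[ms nle].
have := sp _ ms; rewrite (negPf nle) /= => Am.
by move=> m1 /msuppZ_le; rewrite msuppX inE => /eqP ->.
Qed.

Lemma divXP p m : supported (fun m' => (m <= m')%MM) p ->
  exists q, p = 'X_[m] * q.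
Proof.
move=> sp; have [|q sq] := @supported_divX pred0 p m.
  by move=> m' /sp ->.
exists q; apply/eqP; rewrite -subr_eq0 -msupp_eq0.
by rewrite /supported in sq;
  case: msupp sq => [|m' s] // /(_ m' (mem_head _ _)).
Qed.

Lemma dvdX_coprime (i j : 'I_n) k p q : i != j ->
  'X_i * p = 'X_j ^+ k * q -> exists r, q = 'X_i * r.
Proof.
move=> ij e; apply: divXP => m ms; rewrite lep1mP.
have : (m + U_(j) *+ k)%MM \in msupp ('X_i * p).
  by rewrite e mpolyXn mem_msuppMX addmK ms lem_addl.
rewrite mem_msuppMX lep1mP mnmDE mulmnE mnm1E [j == i]eq_sym (negPf ij) mul0n
  addn0.
by case/andP.
Qed.

Definition order_ge e := supported (fun m => e <= mdeg m)%N.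

Lemma upward_mdeg e : upward (fun m => e <= mdeg m)%N.
Proof. by move=> m m' le; rewrite mdegD (leq_trans le) ?leq_addr. Qed.

Lemma order_ge_le e e' p : (e' <= e)%N -> order_ge e p -> order_ge e' p.
Proof. by move=> le; apply: supported_sub => m; apply: leq_trans. Qed.

Lemma order_geM e e' p q :
  order_ge e p -> order_ge e' q -> order_ge (e + e') (p * q).
Proof.
move=> dp dq m /msuppM_le /allpairsP[[m1 m2] /= [/dp d1 /dq d2 ->]].
by rewrite mdegD leq_add.
Qed.

Lemma order_geXn (i : 'I_n) k : order_ge k ('X_i ^+ k).
Proof. by rewrite mpolyXn; apply/supportedX; rewrite mdegMn mdeg1 mul1n. Qed.

(** * Ideals generated by powers of the variables *)

Section PowerIdeals.
Variable N : 'I_n -> nat.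

Definition power_ideal k :=
  supported (fun m => [exists i : 'I_n, (i < k)%N && (N i <= m i)%N]).

Lemma power_ideal_upward k :
  upward (fun m => [exists i : 'I_n, (i < k)%N && (N i <= m i)%N]).
Proof.
move=> m m' /existsP[i /andP[ik le]]; apply/existsP; exists i.
by rewrite ik mnmDE (leq_trans le) ?leq_addr.
Qed.

Lemma power_ideal_le k k' p :
  (k <= k')%N -> power_ideal k p -> power_ideal k' p.
Proof.
move=> le; apply: supported_sub => m /existsP[i /andP[ik ?]].
by apply/existsP; exists i; rewrite (leq_trans ik).
Qed.

Lemma power_ideal0 p : power_ideal 0 p -> p = 0.
Proof.
move=> ip; apply/eqP; rewrite -msupp_eq0.
rewrite /power_ideal /supported in ip.
case: msupp ip => [|m s] // /(_ m (mem_head _ _)).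
by case/existsP.
Qed.

Lemma power_idealX k (i : 'I_n) : (i < k)%N -> power_ideal k ('X_i ^+ N i).
Proof.
move=> ik; rewrite mpolyXn; apply/supportedX/existsP; exists i.
by rewrite ik mulmnE mnm1E eqxx mul1n /=.
Qed.

(** The regular sequence property: since [j < k <= i], a power of ['X_j] that divides a monomial
    times a power of ['X_i] divides the monomial itself. *)
Lemma power_ideal_nzd k (i : 'I_n) e p :
  (k <= i)%N -> power_ideal k ('X_i ^+ e * p) -> power_ideal k p.
Proof.
move=> ki ip m mp.
have : (m + U_(i) *+ e)%MM \in msupp ('X_i ^+ e * p).
  by rewrite mpolyXn mem_msuppMX addmK mp lem_addl.
move=> /ip /existsP[j /andP[jk]]; rewrite mnmDE mulmnE mnm1E.
have /negPf -> : i != j by apply: contraTneq jk => <-; rewrite -leqNgt.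
by rewrite mul0n addn0 => ?; apply/existsP; exists j; rewrite jk.
Qed.

Lemma power_ideal_split (k : 'I_n) p : power_ideal k.+1 p ->
  exists q, power_ideal k (p - 'X_k ^+ N k * q).
Proof.
move=> ip; rewrite mpolyXn; apply: supported_divX => m /ip/existsP[i /andP[]].
rewrite ltnS leq_eqVlt => /orP[/eqP /val_inj -> le|ik le]; apply/orP.
  left; apply/mnm_lepP => j; rewrite mulmnE mnm1E.
  by case: eqVneq => [<-|]; rewrite ?mul1n.
by right; apply/existsP; exists i; rewrite ik.
Qed.

(** Pigeonhole: a monomial whose exponents [m i] are all below [N i] has degree at most the sum of
    the [(N i).-1]. *)
Lemma power_ideal_order e p : order_ge e p -> (\sum_i (N i).-1 < e)%N ->
  power_ideal n p.
Proof.
move=> dp lt m /dp le; apply/existsP; apply: contraPP (leq_trans lt le) => H.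
apply/negP; rewrite -leqNgt mdegE; apply: leq_sum => i _.
have := ltn_ord i; case: (leqP (N i) (m i)) => [h ?|h _]; last by lia.
by case: H; exists i; rewrite ltn_ord.
Qed.

End PowerIdeals.

End MonomialIdeals.

(** * Exterior algebra with divided powers *)

Section Fock.
Variables (S : comNzRingType) (p n : nat).

(** [f I a] is the coefficient of the exterior monomial on [I] times the divided power of exponent
    [a]. No finiteness of support is imposed; [level_in] bounds the degrees later. *)
Definition fock : lmodType S := ({set 'I_p} -> 'X_{1..n} -> S^o).
Implicit Types (f g : fock) (I J : {set 'I_p}) (a : 'X_{1..n}).
Implicit Types (i j k : 'I_p) (r e : 'I_p -> S).

Lemma fockP f g : (forall I a, f I a = g I a :> S) -> f = g.
Proof. by move=> e; apply/funext => I; apply/funext => a; apply: e. Qed.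

Lemma fockD f g I a : (f + g) I a = f I a + g I a :> S. Proof. by []. Qed.
Lemma fockN f I a : (- f) I a = - f I a :> S. Proof. by []. Qed.
Lemma fockZ (c : S) f I a : (c *: f) I a = c * f I a :> S. Proof. by []. Qed.
Lemma fock0 I a : (0 : fock) I a = 0 :> S. Proof. by []. Qed.
Lemma fock_sum (K : Type) (s : seq K) (P : pred K) (F : K -> fock) I a :
  (\sum_(i <- s | P i) F i) I a = \sum_(i <- s | P i) F i I a :> S.
Proof. by elim/big_rec2: _ => // i x y _ <-. Qed.

Definition sgn i I : S := (-1) ^+ #|[set k in I | (k < i)%N]|.

Lemma sgnU i k I : k \notin I ->
  sgn i (k |: I) = (if (k < i)%N then -1 else 1) * sgn i I.
Proof.
move=> kI; rewrite /sgn; case: ifP => ki.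
  have -> : [set x in k |: I | (x < i)%N] = k |: [set x in I | (x < i)%N].
    by apply/setP => x; rewrite !inE; case: eqVneq => [->|].
  by rewrite cardsU1 inE (negPf kI) /= exprS.
rewrite mul1r; congr (_ ^+ #|pred_of_set _|); apply/setP => x; rewrite !inE.
by case: eqVneq => [->|] //; rewrite ki (negPf kI).
Qed.

(** Exactly one of [i < k] and [k < i] holds, so inserting the other index changes the sign on
    exactly one side. *)
Lemma sgn_swap i k I : i != k -> i \notin I -> k \notin I ->
  sgn i I * sgn k (i |: I) = - (sgn k I * sgn i (k |: I)).
Proof.
move=> ik iI kI; rewrite !sgnU //; case: (ltngtP i k) => [||/val_inj e].
- by move=> _; ring.
- by move=> _; ring.
by rewrite e eqxx in ik.
Qed.

Lemma sgn_sqr i I : sgn i I * sgn i I = 1.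
Proof. by rewrite -expr2 sqrr_sign. Qed.

Definition contr1 i f : fock := fun I a =>
  if i \in I then 0 else sgn i I * f (i |: I) a.
Definition ewedge1 i f : fock := fun I a =>
  if i \in I then sgn i (I :\ i) * f (I :\ i) a else 0.

Lemma contr1E i f I a :
  contr1 i f I a = if i \in I then 0 else sgn i I * f (i |: I) a :> S.
Proof. by []. Qed.

Lemma ewedge1E i f I a :
  ewedge1 i f I a = if i \in I then sgn i (I :\ i) * f (I :\ i) a else 0 :> S.
Proof. by []. Qed.

Lemma contr1_is_linear i : linear (contr1 i).
Proof.
move=> c f g; apply: fockP => I a; rewrite fockD fockZ !contr1E.
by case: ifP => _; rewrite ?mulr0 ?addr0 // fockD fockZ; ring.
Qed.
HB.instance Definition _ i :=
  GRing.isLinear.Build S fock fock _ (contr1 i) (contr1_is_linear i).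

Lemma ewedge1_is_linear i : linear (ewedge1 i).
Proof.
move=> c f g; apply: fockP => I a; rewrite fockD fockZ !ewedge1E.
by case: ifP => _; rewrite ?mulr0 ?addr0 // fockD fockZ; ring.
Qed.
HB.instance Definition _ i :=
  GRing.isLinear.Build S fock fock _ (ewedge1 i) (ewedge1_is_linear i).

Lemma contr1_anti i k f : contr1 i (contr1 k f) = - contr1 k (contr1 i f).
Proof.
apply: fockP => I a; rewrite fockN !contr1E !inE.
have [iI|iI] := boolP (i \in I); have [kI|kI] := boolP (k \in I);
  rewrite ?orbT ?mulr0 ?oppr0 //= ?orbF.
have [<-|ik] := eqVneq k i; first by rewrite !mulr0 oppr0.
by rewrite !mulrA (sgn_swap _ iI kI) 1?eq_sym // finset.setUCA mulNr.
Qed.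

Lemma ewedge1_anti i k f : ewedge1 i (ewedge1 k f) = - ewedge1 k (ewedge1 i f).
Proof.
apply: fockP => I a; rewrite fockN !ewedge1E !inE.
have [iI|iI] := boolP (i \in I); have [kI|kI] := boolP (k \in I);
  rewrite ?andbF ?mulr0 ?oppr0 ?andbT //=.
have [<-|ik] := eqVneq k i; first by rewrite !mulr0 oppr0.
rewrite !mulrA !finset.setDDl [[set k] :|: _]finset.setUC.
set J := I :\: [set i; k].
have iJ : i \notin J by rewrite !inE eqxx.
have kJ : k \notin J by rewrite !inE eqxx orbT.
have -> : I :\ i = k |: J.
  apply/setP => x; rewrite !inE.
  by case: (eqVneq x k) => [->|_]; rewrite ?kI ?ik ?orbF.
have -> : I :\ k = i |: J.
  apply/setP => x; rewrite !inE.
  by case: (eqVneq x i) => [->|_]; rewrite ?iI // eq_sym ik.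
by rewrite [sgn i _ * _]mulrC [sgn k (_ |: _) * _]mulrC sgn_swap // mulNr.
Qed.

Lemma contr1_wedge1 i k f :
  contr1 i (ewedge1 k f) = (i == k)%:R *: f - ewedge1 k (contr1 i f).
Proof.
apply: fockP => I a; rewrite fockD fockN fockZ !(contr1E, ewedge1E) !inE.
have [<-|ik] := eqVneq i k.
  rewrite mul1r /=; case: ifP => iI.
    by rewrite finset.setD1K // mulrA sgn_sqr mul1r subrr.
  by rewrite finset.setU1K ?iI // mulrA sgn_sqr mul1r subr0.
rewrite mul0r add0r /=.
have [iI|iI] := boolP (i \in I); have [kI|kI] := boolP (k \in I);
  rewrite ?mulr0 ?oppr0 //=.
set J := I :\ k.
have iJ : i \notin J by rewrite !inE (negPf iI) andbF.
have kJ : k \notin J by rewrite !inE eqxx.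
have -> : (i |: I) :\ k = i |: J.
  by apply/setP => x; rewrite !inE; case: (eqVneq x i) => [->|_] //;
     rewrite ik.
have -> : I = k |: J by rewrite finset.setD1K.
rewrite !mulrA !sgnU //; case: (ltngtP i k) => [||/val_inj e].
- by move=> _; ring.
- by move=> _; ring.
by rewrite e eqxx in ik.
Qed.

Fact fock_key : unit. Proof. exact: tt. Qed.

(* Locked, so that [linear_sum] does not see through them. *)
Definition contr r : fock -> fock :=
  locked_with fock_key (fun f => \sum_i r i *: contr1 i f).
Definition ewedge e : fock -> fock :=
  locked_with fock_key (fun f => \sum_i e i *: ewedge1 i f).

Lemma contrU r f : contr r f = \sum_i r i *: contr1 i f.
Proof. by rewrite /contr unlock. Qed.

Lemma ewedgeU e f : ewedge e f = \sum_i e i *: ewedge1 i f.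
Proof. by rewrite /ewedge unlock. Qed.

Lemma contr_is_linear r : linear (contr r).
Proof.
move=> c f g; rewrite !contrU scaler_sumr -big_split /=; apply: eq_bigr => i _.
by rewrite linearP scalerDr !scalerA mulrC.
Qed.
HB.instance Definition _ r :=
  GRing.isLinear.Build S fock fock _ (contr r) (contr_is_linear r).

Lemma ewedge_is_linear e : linear (ewedge e).
Proof.
move=> c f g; rewrite !ewedgeU scaler_sumr -big_split /=; apply: eq_bigr => i _.
by rewrite linearP scalerDr !scalerA mulrC.
Qed.
HB.instance Definition _ e :=
  GRing.isLinear.Build S fock fock _ (ewedge e) (ewedge_is_linear e).

Lemma contr_anti r r' f : contr r (contr r' f) = - contr r' (contr r f).
Proof.
rewrite !contrU -sumrN; under eq_bigr => i _ do rewrite linear_sum scaler_sumr.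
rewrite exchange_big /=; apply: eq_bigr => k _.
rewrite linear_sum scaler_sumr -sumrN; apply: eq_bigr => i _.
by rewrite !linearZ /= contr1_anti !scalerN !scalerA mulrC.
Qed.

Lemma ewedge_anti e e' f : ewedge e (ewedge e' f) = - ewedge e' (ewedge e f).
Proof.
rewrite !ewedgeU -sumrN; under eq_bigr => i _ do rewrite linear_sum scaler_sumr.
rewrite exchange_big /=; apply: eq_bigr => k _.
rewrite linear_sum scaler_sumr -sumrN; apply: eq_bigr => i _.
by rewrite !linearZ /= ewedge1_anti !scalerN !scalerA mulrC.
Qed.

(** The Clifford relation: the anticommutator of a contraction and an exterior product is the
    pairing of their coefficient vectors. *)
Lemma contr_wedge r e f :
  contr r (ewedge e f) = (\sum_i r i * e i) *: f - ewedge e (contr r f).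
Proof.
rewrite [LHS]contrU [in LHS]ewedgeU.
have E i : r i *: contr1 i (\sum_k e k *: ewedge1 k f) =
    (r i * e i) *: f - \sum_k e k *: ewedge1 k (r i *: contr1 i f).
  rewrite linear_sum scaler_sumr.
  under eq_bigr => k _ do rewrite linearZ /= contr1_wedge1 !scalerBr.
  rewrite sumrB; congr (_ - _).
    rewrite (bigD1 i) //= eqxx big1 ?addr0 => [|k ki].
      by rewrite !scalerA mulr1.
    by rewrite eq_sym (negPf ki) scale0r !scaler0.
  by apply: eq_bigr => k _; rewrite [in RHS]linearZ /= !scalerA mulrC.
rewrite (eq_bigr _ (fun i _ => E i)) sumrB -scaler_suml; congr (_ - _).
rewrite ewedgeU exchange_big /=; apply: eq_bigr => k _.
by rewrite contrU linear_sum scaler_sumr.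
Qed.

Lemma contrE r f I a :
  contr r f I a = \sum_(i | i \notin I) r i * (sgn i I * f (i |: I) a).
Proof.
rewrite contrU fock_sum [RHS]big_mkcond /=; apply: eq_bigr => i _.
by rewrite fockZ contr1E; case: (i \in I); rewrite ?mulr0.
Qed.

Lemma contr_sum_coef (K : Type) (s : seq K) (P : pred K) (R :
  K -> 'I_p -> S) c f :
  contr (fun i => \sum_(l <- s | P l) c l * R l i) f =
  \sum_(l <- s | P l) c l *: contr (R l) f.
Proof.
rewrite contrU; under eq_bigr => i _ do rewrite scaler_suml.
rewrite exchange_big /=; apply: eq_bigr => l _; rewrite contrU scaler_sumr.
by apply: eq_bigr => i _; rewrite scalerA.
Qed.

(* Divided powers: [shiftd l] is the derivative by the l-th variable on the
   functions [f I a], read as coefficients of the divided power of exponent [a],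
   and [multv l] is the multiplication by that variable. *)
Definition shiftd (l : 'I_n) f : fock := fun I a => f I (a + U_(l))%MM.
Definition multv (l : 'I_n) f : fock := fun I a =>
  (a l)%:R * f I (a - U_(l))%MM.

Lemma shiftdE l f I a : shiftd l f I a = f I (a + U_(l))%MM :> S.
Proof. by []. Qed.

Lemma multvE l f I a : multv l f I a = (a l)%:R * f I (a - U_(l))%MM :> S.
Proof. by []. Qed.

Lemma shiftd_is_linear l : linear (shiftd l).
Proof. by []. Qed.
HB.instance Definition _ l :=
  GRing.isLinear.Build S fock fock _ (shiftd l) (shiftd_is_linear l).

Lemma multv_is_linear l : linear (multv l).
Proof.
move=> c f g; apply: fockP => I a.
by rewrite fockD fockZ !multvE fockD fockZ; ring.
Qed.
HB.instance Definition _ l :=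
  GRing.isLinear.Build S fock fock _ (multv l) (multv_is_linear l).

Lemma shiftdC l m f : shiftd l (shiftd m f) = shiftd m (shiftd l f).
Proof. by apply: fockP => I a;
  rewrite /shiftd -!addmA [(U_(l) + _)%MM]addmC. Qed.

(** The Weyl commutation relation. The truncated subtraction in [multv] does no harm, because its
    factor vanishes where the exponent is zero. *)
Lemma shiftd_multv l m f :
  shiftd l (multv m f) = multv m (shiftd l f) + (l == m)%:R *: f.
Proof.
apply: fockP => I a; rewrite fockD fockZ !(shiftdE, multvE) mnmDE mnm1E natrD.
rewrite mulrDl; have [<-|lm] := eqVneq l m.
  rewrite addmK; congr (_ + _); case: (posnP (a l)) => [->|al].
    by rewrite !mul0r.
  by rewrite submK // lep1mP -lt0n.
rewrite mul0r !mul0r; congr (_ + _); case: (posnP (a m)) => [->|al].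
  by rewrite !mul0r.
congr (_ * f I _); apply/mnmP => x; rewrite !(mnmDE, mnmBE, mnm1E).
by case: (eqVneq m x) al => [<-|_ _]; rewrite ?(negPf lm); lia.
Qed.

Lemma contr_shiftd r l f : contr r (shiftd l f) = shiftd l (contr r f).
Proof. by rewrite !contrU linear_sum; apply: eq_bigr => i _;
  rewrite linearZ. Qed.

Lemma ewedge_shiftd e l f : ewedge e (shiftd l f) = shiftd l (ewedge e f).
Proof. by rewrite !ewedgeU linear_sum; apply: eq_bigr => i _;
  rewrite linearZ. Qed.

Lemma contr_multv r l f : contr r (multv l f) = multv l (contr r f).
Proof.
rewrite !contrU linear_sum; apply: eq_bigr => i _; rewrite linearZ /=.
congr (_ *: _); apply: fockP => I a; rewrite !(contr1E, multvE).
by case: ifP => _; ring.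
Qed.

Lemma ewedge_multv e l f : ewedge e (multv l f) = multv l (ewedge e f).
Proof.
rewrite !ewedgeU linear_sum; apply: eq_bigr => i _; rewrite linearZ /=.
congr (_ *: _); apply: fockP => I a; rewrite !(ewedge1E, multvE).
by case: ifP => _; ring.
Qed.

End Fock.

Section FockOps.
Variables (S : comNzRingType) (p n : nat).
Local Notation fock := (fock S p n).
Implicit Types f g : fock.

Lemma multvC l m f : multv l (multv m f) = multv m (multv l f).
Proof.
apply: fockP => I a; rewrite !multvE !mnmBE !mnm1E.
have [->//|lm] := eqVneq l m.
by rewrite !submDA [(U_(l) + _)%MM]addmC !subn0 !mulrA [_%:R * _]mulrC.
Qed.

Lemma delta_contr (j : 'I_p) f : contr (fun i => (i == j)%:R) f = contr1 j f.
Proof.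
rewrite contrU (bigD1 j) //= eqxx scale1r big1 ?addr0 // => i /negPf ->.
by rewrite scale0r.
Qed.

Lemma delta_wedge (j : 'I_p) f : ewedge (fun i => (i == j)%:R) f = ewedge1 j f.
Proof.
rewrite ewedgeU (bigD1 j) //= eqxx scale1r big1 ?addr0 // => i /negPf ->.
by rewrite scale0r.
Qed.

Lemma ewedge1_contr1 j f I a :
  ewedge1 j (contr1 j f) I a = (j \in I)%:R * f I a :> S.
Proof.
rewrite ewedge1E contr1E !inE eqxx /=; case: ifP => jI; last by rewrite mul0r.
by rewrite finset.setD1K // mulrA sgn_sqr.
Qed.

Lemma multv_shiftd l f I a : multv l (shiftd l f) I a = (a l)%:R * f I a :> S.
Proof.
rewrite multvE shiftdE; case: (posnP (a l)) => [->|al]; first by rewrite !mul0r.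
by rewrite submK // lep1mP -lt0n.
Qed.

Lemma contr_coef0 r f : (forall i, r i = 0) -> contr r f = 0.
Proof. by move=> r0; rewrite contrU big1 // => i _; rewrite r0 scale0r. Qed.

End FockOps.

(** * The homotopies and the degree bound *)

Section Homotopy.
Variables (F : numFieldType) (n p : nat).
Local Notation S := {mpoly F[n]}.
Local Notation fock := (fock S p n).
Implicit Types f g : fock.

Lemma eq_oppr0 (x : S) : x = - x -> x = 0.
Proof.
move=> e; apply/mpolyP => m; have /(congr1 (mcoeff m)) := e.
rewrite mcoeffN mcoeff0 => /eqP; rewrite -addr_eq0 -mulr2n mulrn_eq0 /=.
by move/eqP.
Qed.

Lemma fock_eq_oppr0 f : f = - f -> f = 0.
Proof.
move=> e; apply: fockP => I a; apply: eq_oppr0.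
by rewrite {1}e.
Qed.

Lemma contr_sqr r f : contr r (contr r f) = 0.
Proof. by apply: fock_eq_oppr0; rewrite -contr_anti. Qed.

Lemma fock_scalerI (c : S) f g : c != 0 -> c *: f = c *: g -> f = g.
Proof.
move=> c0 e; apply: fockP => I a; apply: (mulfI c0).
by rewrite -!fockZ e.
Qed.

Variables (u : 'I_p) (R : 'I_n -> 'I_p -> S) (M : nat).
Variable e : 'I_n -> 'I_n -> 'I_p -> S.
Hypothesis R_syz : forall j, \sum_l 'X_l * R l j = 0.
Hypothesis R_u : forall l, R l u = 0.
Hypothesis e_u : forall t i, e t i u = 0.
Hypothesis e_diag : forall t j, e t t j = 0.
Hypothesis R_order : forall l j, order_ge 1 (R l j).
Hypothesis e_order : forall t i j, order_ge M (e t i j).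
(** The right side is the [l]-th coordinate of the Koszul differential of [x_t^M e_t /\ e_i];
    [relation_coeffs] provides such coefficients. *)
Hypothesis e_pair : forall t i l, \sum_j R l j * e t i j =
  'X_t ^+ M * ('X_t * (l == i)%:R - 'X_i * (l == t)%:R).

Definition contrR l : fock -> fock := contr (R l).
HB.instance Definition _ l := GRing.Linear.on (contrR l).
Definition ewedgee t i : fock -> fock := ewedge (e t i).
HB.instance Definition _ t i := GRing.Linear.on (ewedgee t i).
Definition contru : fock -> fock := contr (fun j => (j == u)%:R).
HB.instance Definition _ := GRing.Linear.on contru.
Definition ewedgeu : fock -> fock := ewedge (fun j => (j == u)%:R).
HB.instance Definition _ := GRing.Linear.on ewedgeu.

Definition multw : fock -> fock :=
  locked_with fock_key (fun f => \sum_l 'X_l *: multv l f).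

Lemma multwU f : multw f = \sum_l 'X_l *: multv l f.
Proof. by rewrite /multw unlock. Qed.

Lemma multw_is_linear : linear multw.
Proof.
move=> c f g; rewrite !multwU scaler_sumr -big_split /=; apply: eq_bigr => i _.
by rewrite linearP scalerDr !scalerA mulrC.
Qed.
HB.instance Definition _ :=
  GRing.isLinear.Build S fock fock _ multw multw_is_linear.

(* The generator [u] stands for the linear form [multw] in the divided power
   variables: [Jop] counts it as one more degree in them. *)
Definition diff1 f : fock := \sum_l contrR l (shiftd l f).
Definition diff f : fock := diff1 f + multw (contru f).
Definition htpy1 t f : fock := \sum_i ewedgee t i (multv i f).
Definition htpy t f : fock := htpy1 t f + 'X_t ^+ M *: ewedgeu (shiftd t f).
Definition Pop t i f : fock := contrR i (ewedgee t i f).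
Definition Jop f : fock := \sum_i multv i (shiftd i f) + ewedgeu (contru f).
Definition Theta t f : fock := 'X_t ^+ M.+1 *: Jop f + \sum_i Pop t i f.

Ltac linsum := rewrite /=; move=> c f g;
  rewrite scaler_sumr -big_split /=; apply: eq_bigr => i _; by rewrite !linearP.

Lemma diff1_is_linear : linear diff1.
Proof. rewrite /diff1; linsum. Qed.
HB.instance Definition _ :=
  GRing.isLinear.Build S fock fock _ diff1 diff1_is_linear.
Lemma htpy1_is_linear t : linear (htpy1 t).
Proof. rewrite /htpy1; linsum. Qed.
HB.instance Definition _ t :=
  GRing.isLinear.Build S fock fock _ (htpy1 t) (htpy1_is_linear t).
Lemma diff_is_linear : linear diff.
Proof. by move=> c f g; rewrite /diff !linearP scalerDr addrACA. Qed.
HB.instance Definition _ :=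
  GRing.isLinear.Build S fock fock _ diff diff_is_linear.
Lemma htpy_is_linear t : linear (htpy t).
Proof.
move=> c f g; rewrite /htpy [htpy1 t _]linearP [shiftd t _]linearP.
by rewrite [ewedgeu _]linearP /= !scalerDr addrACA !scalerA [_ * c]mulrC.
Qed.
HB.instance Definition _ t :=
  GRing.isLinear.Build S fock fock _ (htpy t) (htpy_is_linear t).
Lemma Pop_is_linear t i : linear (Pop t i).
Proof. by move=> c f g; rewrite /Pop !linearP. Qed.
HB.instance Definition _ t i :=
  GRing.isLinear.Build S fock fock _ (Pop t i) (Pop_is_linear t i).
Lemma Jop_is_linear : linear Jop.
Proof.
move=> c f g; rewrite /Jop !linearP scalerDr addrACA; congr (_ + _).
rewrite scaler_sumr -big_split /=; apply: eq_bigr => i _; by rewrite !linearP.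
Qed.
HB.instance Definition _ :=
  GRing.isLinear.Build S fock fock _ Jop Jop_is_linear.

Lemma contrR_multw l f : contrR l (multw f) = multw (contrR l f).
Proof.
rewrite !multwU linear_sum; apply: eq_bigr => i _; rewrite linearZ /=.
by rewrite /contrR contr_multv.
Qed.
Lemma contru_multw f : contru (multw f) = multw (contru f).
Proof.
rewrite !multwU linear_sum; apply: eq_bigr => i _; rewrite linearZ /=.
by rewrite /contru contr_multv.
Qed.
Lemma ewedgeu_multw f : ewedgeu (multw f) = multw (ewedgeu f).
Proof.
rewrite !multwU linear_sum; apply: eq_bigr => i _; rewrite linearZ /=.
by rewrite /ewedgeu ewedge_multv.
Qed.
Lemma ewedgee_multw t i f : ewedgee t i (multw f) = multw (ewedgee t i f).
Proof.
rewrite !multwU linear_sum; apply: eq_bigr => l _; rewrite linearZ /=.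
by rewrite /ewedgee ewedge_multv.
Qed.
Lemma multv_multw l f : multv l (multw f) = multw (multv l f).
Proof.
rewrite !multwU linear_sum; apply: eq_bigr => i _; rewrite linearZ /=.
by rewrite multvC.
Qed.
Lemma shiftd_multw l f : shiftd l (multw f) = multw (shiftd l f) + 'X_l *: f.
Proof.
rewrite !multwU linear_sum.
under eq_bigr => i _ do rewrite linearZ /= shiftd_multv scalerDr.
rewrite big_split /=; congr (_ + _).
rewrite (bigD1 l) //= eqxx scale1r big1 ?addr0 // => i il.
by rewrite eq_sym (negPf il) scale0r scaler0.
Qed.

Lemma contrR_anti l m f : contrR l (contrR m f) = - contrR m (contrR l f).
Proof. exact: contr_anti. Qed.
Lemma contrR_contru l f : contrR l (contru f) = - contru (contrR l f).
Proof. exact: contr_anti. Qed.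
Lemma contru_sqr f : contru (contru f) = 0.
Proof. exact: contr_sqr. Qed.
Lemma contru_wedgee t i f : contru (ewedgee t i f) = - ewedgee t i (contru f).
Proof.
rewrite /contru /ewedgee contr_wedge (bigD1 u) //= e_u mulr0 big1 ?addr0.
  by rewrite scale0r add0r.
by move=> j /negPf ->; rewrite mul0r.
Qed.
Lemma contrR_wedgeu l f : contrR l (ewedgeu f) = - ewedgeu (contrR l f).
Proof.
rewrite /contrR /ewedgeu contr_wedge (bigD1 u) //= R_u mul0r big1 ?addr0.
  by rewrite scale0r add0r.
by move=> j /negPf ->; rewrite mulr0.
Qed.
Lemma contru_wedgeu f : contru (ewedgeu f) = f - ewedgeu (contru f).
Proof.
rewrite /contru /ewedgeu contr_wedge (bigD1 u) //= eqxx mul1r big1 ?addr0.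
  by rewrite scale1r.
by move=> j /negPf ->; rewrite mulr0.
Qed.
Lemma ewedgee_wedgeu t i f :
  ewedgee t i (ewedgeu f) = - ewedgeu (ewedgee t i f).
Proof. exact: ewedge_anti. Qed.
Lemma contrR_wedgee l t i f : contrR l (ewedgee t i f) =
  ('X_t ^+ M * ('X_t * (l == i)%:R - 'X_i * (l == t)%:R)) *: f
  - ewedgee t i (contrR l f).
Proof. by rewrite /contrR /ewedgee contr_wedge e_pair. Qed.

Lemma contrR_syz f : \sum_l 'X_l *: contrR l f = 0.
Proof.
by rewrite -contr_sum_coef; apply: contr_coef0 => j; apply: R_syz.
Qed.

Lemma diff1_sqr f : diff1 (diff1 f) = 0.
Proof.
apply: fock_eq_oppr0; rewrite {1}/diff1.
under eq_bigr => l _ do rewrite /diff1 !linear_sum /=.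
rewrite exchange_big /= /diff1 -sumrN; apply: eq_bigr => m _.
rewrite !linear_sum; apply: eq_bigr => l _ /=.
rewrite /contrR -!contr_shiftd contr_anti shiftdC.
by [].
Qed.

Lemma shiftd_contru l f : shiftd l (contru f) = contru (shiftd l f).
Proof. by rewrite /contru contr_shiftd. Qed.
Lemma shiftd_wedgeu l f : shiftd l (ewedgeu f) = ewedgeu (shiftd l f).
Proof. by rewrite /ewedgeu ewedge_shiftd. Qed.
Lemma shiftd_contrR l m f : shiftd l (contrR m f) = contrR m (shiftd l f).
Proof. by rewrite /contrR contr_shiftd. Qed.
Lemma shiftd_wedgee l t i f :
  shiftd l (ewedgee t i f) = ewedgee t i (shiftd l f).
Proof. by rewrite /ewedgee ewedge_shiftd. Qed.
Lemma multv_contru l f : multv l (contru f) = contru (multv l f).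
Proof. by rewrite /contru contr_multv. Qed.
Lemma multv_contrR l m f : multv l (contrR m f) = contrR m (multv l f).
Proof. by rewrite /contrR contr_multv. Qed.
Lemma multv_wedgee l t i f : multv l (ewedgee t i f) = ewedgee t i (multv l f).
Proof. by rewrite /ewedgee ewedge_multv. Qed.

(** Moving the derivatives past [multw] leaves the extra terms ['X_l *: contrR l], whose sum
    vanishes by [R_syz]. The sign comes from anticommuting the contractions. *)
Lemma diff1_multw_contru f :
  diff1 (multw (contru f)) = - multw (contru (diff1 f)).
Proof.
rewrite {1}/diff1.
under eq_bigr => l _.
  rewrite shiftd_multw linearD linearZ /= contrR_multw shiftd_contru.
  rewrite contrR_contru [contrR l (contru _)]contrR_contru.
  over.
rewrite big_split /=.
have -> : \sum_l 'X_l *: - contru (contrR l f) = 0.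
  have : - contru (\sum_l 'X_l *: contrR l f) = 0.
    by rewrite contrR_syz linear0 oppr0.
  rewrite [contru _]linear_sum -sumrN => {2}<-.
  by apply: eq_bigr => l _; rewrite linearZ scalerN.
rewrite addr0.
rewrite /diff1 !linear_sum; apply: eq_bigr => l _.
by rewrite linearN.
Qed.

Lemma diff_diff f : diff (diff f) = 0.
Proof.
rewrite /diff !linearD /= diff1_sqr add0r diff1_multw_contru.
by rewrite addrA addNr add0r contru_multw contru_sqr !linear0.
Qed.

(** The Clifford pairing [e_pair] produces the Euler operator and the term in [multw]; the Weyl
    commutators produce the [Pop t i]. *)
Lemma htpy1_diff1 t f : diff1 (htpy1 t f) + htpy1 t (diff1 f) =
  'X_t ^+ M.+1 *: (\sum_i multv i (shiftd i f))
  - 'X_t ^+ M *: multw (shiftd t f) + \sum_i Pop t i f.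
Proof.
have E1 : diff1 (htpy1 t f) =
    \sum_l \sum_i contrR l (ewedgee t i (multv i (shiftd l f)))
    + \sum_i Pop t i f.
  rewrite /diff1 -big_split /=; apply: eq_bigr => l _.
  rewrite /htpy1 !linear_sum /=.
  under eq_bigr => i _ do rewrite shiftd_wedgee shiftd_multv !linearD !linearZ
    /=.
  rewrite big_split /=; congr (_ + _).
  rewrite (bigD1 l) //= eqxx scale1r big1 ?addr0 // => i il.
  by rewrite eq_sym (negPf il) scale0r.
have E2 : htpy1 t (diff1 f) =
    \sum_l \sum_i ewedgee t i (contrR l (multv i (shiftd l f))).
  rewrite /htpy1 /diff1 exchange_big /=; apply: eq_bigr => i _.
  rewrite !linear_sum /=; apply: eq_bigr => l _.
  by rewrite multv_contrR.
rewrite E1 E2 addrAC -big_split /=; congr (_ + _).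
under eq_bigr => l _.
  rewrite -big_split /=.
  under eq_bigr => i _ do rewrite contrR_wedgee subrK mulrBr scalerBl.
  rewrite sumrB.
  over.
rewrite sumrB; congr (_ - _).
  rewrite scaler_sumr; apply: eq_bigr => l _.
  rewrite (bigD1 l) //= eqxx big1 ?addr0 => [|i il].
    by rewrite mulr1 exprSr.
  by rewrite eq_sym (negPf il) !mulr0 scale0r.
rewrite (bigD1 t) //= eqxx [X in _ + X]big1 ?addr0 => [|l lt].
  rewrite multwU scaler_sumr; apply: eq_bigr => i _.
  by rewrite mulr1 scalerA.
by rewrite (negPf lt) big1 // => i _; rewrite !mulr0 scale0r.
Qed.

(** The part of [htpy] in [u] is chosen so that its anticommutator with [multw] and [contru] cancels
    the term in [multw] of [htpy1_diff1] and completes the Euler operator to [Jop]. *)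
Lemma homotopy t f : diff (htpy t f) + htpy t (diff f) = Theta t f.
Proof.
have E12 : diff1 (ewedgeu (shiftd t f)) = - ewedgeu (shiftd t (diff1 f)).
  rewrite /diff1 !linear_sum; apply: eq_bigr => l _ /=.
  by rewrite shiftd_wedgeu contrR_wedgeu shiftd_contrR shiftdC.
have E21 : multw (contru (htpy1 t f)) = - htpy1 t (multw (contru f)).
  rewrite /htpy1 !linear_sum; apply: eq_bigr => i _ /=.
  by rewrite contru_wedgee multv_multw multv_contru ewedgee_multw linearN.
have E22 : multw (contru (ewedgeu (shiftd t f)))
    + ewedgeu (shiftd t (multw (contru f))) =
    multw (shiftd t f) + 'X_t *: ewedgeu (contru f).
  rewrite contru_wedgeu linearB shiftd_multw linearD linearZ /=.
  by rewrite ewedgeu_multw shiftd_contru addrA subrK.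
rewrite /htpy /diff !linearD /= [diff1 (_ *: _)]linearZ /=.
rewrite [contru (_ *: _)]linearZ [multw (_ *: _)]linearZ /= E12 E21.
rewrite -[fun _ _ => diff1 f _ _]/(shiftd t (diff1 f)).
rewrite -[fun _ _ => multw _ _ _]/(shiftd t (multw (contru f))).
transitivity (diff1 (htpy1 t f) + htpy1 t (diff1 f) + 'X_t ^+ M *:
    (multw (contru (ewedgeu (shiftd t f))) + ewedgeu (shiftd t (multw (contru
      f))))).
  by apply: fockP => I a; rewrite !(fockD, fockN, fockZ); ring.
rewrite htpy1_diff1 E22 /Theta /Jop.
by apply: fockP => I a; rewrite !(fockD, fockN, fockZ) exprS; ring.
Qed.

Lemma diffB f g : diff (f - g) = diff f - diff g.
Proof. by rewrite linearB. Qed.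
Lemma diffZ c f : diff (c *: f) = c *: diff f.
Proof. by rewrite linearZ. Qed.

Lemma diff_Theta t f : diff (Theta t f) = Theta t (diff f).
Proof. by rewrite -!homotopy linearD /= !diff_diff linear0 add0r addr0. Qed.

(** * Eigenvalues of [Theta t] and lifting through the differential, for a fixed variable *)

Section FixT.
Variable t : 'I_n.
Local Notation y := ('X_t ^+ M.+1 : S).

(** Away from the index [t], contractions and exterior products satisfy the canonical
    anticommutation relations scaled by [y]. Hence the [Pop t i] with [i != t] behave like [y] times
    commuting projections. *)
Lemma contrR_wedgee_neq l i f : l != t ->
  contrR l (ewedgee t i f) = (y * (l == i)%:R) *: f - ewedgee t i (contrR l f).
Proof.
by move=> /negPf lt; rewrite contrR_wedgee lt mulr0 subr0 mulrA -exprSr.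
Qed.

Lemma Pop_contrR i l f : i != t -> l != t -> i != l ->
  Pop t i (contrR l f) = contrR l (Pop t i f).
Proof.
move=> it lt /negPf il; rewrite /Pop [RHS]contrR_anti [in
  RHS]contrR_wedgee_neq //.
by rewrite eq_sym il mulr0 scale0r add0r linearN opprK.
Qed.

Lemma Pop_wedgee i l f : i != t -> i != l ->
  Pop t i (ewedgee t l f) = ewedgee t l (Pop t i f).
Proof.
move=> it /negPf il; rewrite /Pop [ewedgee t i (ewedgee t l _)]ewedge_anti.
rewrite -/(ewedgee _ _ _) -/(ewedgee _ _ _) linearN /= contrR_wedgee_neq // il
  mulr0 scale0r add0r opprK.
by [].
Qed.

Lemma PopC i k f : i != t -> k != t -> Pop t i (Pop t k f) =
  Pop t k (Pop t i f).
Proof.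
move=> it kt; have [->//|ik] := eqVneq i k.
by rewrite [Pop t k f]/Pop Pop_contrR // Pop_wedgee.
Qed.

Lemma Pop_sqr i f : i != t -> Pop t i (Pop t i f) = y *: Pop t i f.
Proof.
move=> it; rewrite [Pop t i f]/Pop {1}/Pop.
have -> : ewedgee t i (contrR i (ewedgee t i f)) = y *: ewedgee t i f.
  have := contrR_wedgee_neq i (ewedgee t i f) it; rewrite eqxx mulr1.
  rewrite [ewedgee t i (ewedgee t i f)](_ : _ = 0); last first.
    by apply: fock_eq_oppr0; rewrite -ewedge_anti.
  by rewrite linear0 => /esym/eqP; rewrite subr_eq0 => /eqP.
by rewrite linearZ.
Qed.

Lemma Pop_Jop i f : Pop t i (Jop f) = Jop (Pop t i f).
Proof.
rewrite /Jop linearD linear_sum /=; congr (_ + _).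
  apply: eq_bigr => l _; rewrite /Pop.
  by rewrite -multv_wedgee -shiftd_wedgee -multv_contrR -shiftd_contrR.
rewrite /Pop ewedgee_wedgeu linearN /= contrR_wedgeu opprK; congr ewedgeu.
by rewrite -[RHS]opprK -contrR_contru contru_wedgee linearN opprK.
Qed.

Lemma JopE f I a : Jop f I a = (mdeg a + (u \in I))%:R * f I a :> S.
Proof.
rewrite /Jop fockD fock_sum /ewedgeu /contru delta_wedge delta_contr.
rewrite ewedge1_contr1 natrD mulrDl mdegE natr_sum mulr_suml; congr (_ + _).
by apply: eq_bigr => l _; rewrite multv_shiftd.
Qed.

Definition ThetaS (s : seq 'I_n) f :
  fock := y *: Jop f + \sum_(i <- s) Pop t i f.

Lemma ThetaS_is_linear s : linear (ThetaS s).
Proof.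
move=> c f g; rewrite /ThetaS [Jop _]linearP /=.
have -> : \sum_(i <- s) Pop t i (c *: f + g) =
    c *: (\sum_(i <- s) Pop t i f) + \sum_(i <- s) Pop t i g.
  by rewrite scaler_sumr -big_split; apply: eq_bigr => i _; rewrite linearP.
by rewrite !scalerDr addrACA !scalerA [y * c]mulrC.
Qed.
HB.instance Definition _ s :=
  GRing.isLinear.Build S fock fock _ (ThetaS s) (ThetaS_is_linear s).

Lemma Theta_ThetaS f :
  Theta t f = ThetaS [seq i <- enum 'I_n | i != t] f.
Proof.
rewrite /Theta /ThetaS big_filter big_enum_cond /= (bigD1 t) //=.
rewrite [Pop t t f](_ : _ = 0) ?add0r //.
rewrite /Pop [ewedgee t t f](_ : _ = 0) ?linear0 //.
by rewrite /ewedgee ewedgeU big1 // => j _; rewrite e_diag scale0r.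
Qed.

Lemma ThetaS_Pop s i f : i != t -> t \notin s ->
  ThetaS s (Pop t i f) = Pop t i (ThetaS s f).
Proof.
move=> it ts; rewrite /ThetaS [RHS]linearD [in RHS]linearZ /= Pop_Jop [in
  RHS]linear_sum.
congr (_ + _); rewrite big_seq_cond [RHS]big_seq_cond; apply: eq_bigr => k.
by rewrite andbT => ks; apply: PopC => //; apply: contraNneq ts => <-.
Qed.

Definition shift_prod s (bs : seq nat) f : fock :=
  foldr (fun b g => ThetaS s g - (b%:R * y) *: g) f bs.

Lemma shift_prod_is_linear s bs : linear (shift_prod s bs).
Proof.
move=> c f g; elim: bs => //= b bs ->; rewrite linearP /=.
set A := ThetaS s _; set B := ThetaS s _.
by apply: fockP => I a; rewrite !(fockD, fockN, fockZ); ring.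
Qed.
HB.instance Definition _ s bs :=
  GRing.isLinear.Build S fock fock _ (shift_prod s bs) (shift_prod_is_linear s
    bs).

Lemma shift_prod_cons s b bs f : shift_prod s (b :: bs) f =
  ThetaS s (shift_prod s bs f) - (b%:R * y) *: shift_prod s bs f.
Proof. by []. Qed.

Lemma shift_prod_rcons s bs b f : shift_prod s (bs ++ [:: b]) f =
  shift_prod s bs (ThetaS s f - (b%:R * y) *: f).
Proof. by rewrite /shift_prod foldr_cat. Qed.

(** The level is the eigenvalue of [Jop] found in [JopE]. *)
Definition level_in lo hi f := forall (I : {set 'I_p}) (a : 'X_{1..n}),
  ~~ (lo <= mdeg a + (u \in I) <= hi)%N -> f I a = 0 :> S.

Lemma level_in0 lo hi : level_in lo hi 0. Proof. by []. Qed.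

Lemma level_inD lo hi f g :
  level_in lo hi f -> level_in lo hi g -> level_in lo hi (f + g).
Proof. by move=> fJ gJ I a J; rewrite fockD fJ ?gJ ?addr0. Qed.

Lemma level_inZ lo hi c f : level_in lo hi f -> level_in lo hi (c *: f).
Proof. by move=> fJ I a J; rewrite fockZ fJ ?mulr0. Qed.

Lemma level_inB lo hi f g :
  level_in lo hi f -> level_in lo hi g -> level_in lo hi (f - g).
Proof. by move=> fJ gJ; rewrite -scaleN1r; apply/level_inD/level_inZ. Qed.

Lemma level_in_sum lo hi (K : Type) (r : seq K) (P : pred K) (G : K -> fock) :
  (forall k, P k -> level_in lo hi (G k)) ->
  level_in lo hi (\sum_(k <- r | P k) G k).
Proof.
by move=> H; elim/big_ind: _ => //; apply: level_inD.
Qed.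

Lemma level_in_contr lo hi r f : r u = 0 -> level_in lo hi f ->
  level_in lo hi (contr r f).
Proof.
move=> ru fJ I a J; rewrite contrE big1 // => i iI.
have [->|iu] := eqVneq i u; first by rewrite ru mul0r.
by rewrite fJ ?mulr0 // !inE eq_sym (negPf iu).
Qed.

Lemma level_in_wedge lo hi r f : r u = 0 -> level_in lo hi f ->
  level_in lo hi (ewedge r f).
Proof.
move=> ru fJ; rewrite ewedgeU; apply: level_in_sum => i _ I a J.
rewrite fockZ ewedge1E; case: ifP => iI; rewrite ?mulr0 //.
have [->|iu] := eqVneq i u; first by rewrite ru mul0r.
by rewrite fJ ?mulr0 // !inE eq_sym iu.
Qed.

Lemma level_in_contrR lo hi l f :
  level_in lo hi f -> level_in lo hi (contrR l f).
Proof. exact: level_in_contr. Qed.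

Lemma level_in_wedgee lo hi i f :
  level_in lo hi f -> level_in lo hi (ewedgee t i f).
Proof. exact: level_in_wedge. Qed.

Lemma level_in_ThetaS lo hi s f :
  level_in lo hi f -> level_in lo hi (ThetaS s f).
Proof.
move=> fJ; apply: level_inD.
  by apply: level_inZ => I a J; rewrite JopE fJ ?mulr0.
by apply: level_in_sum => i _; apply/level_in_contrR/level_in_wedgee.
Qed.

Lemma level_in_shift_prod lo hi s bs f :
  level_in lo hi f -> level_in lo hi (shift_prod s bs f).
Proof.
move=> fJ; elim: bs => //= b bs H.
by apply: level_inB; [apply: level_in_ThetaS | apply: level_inZ].
Qed.

Lemma PopB i f g : Pop t i (f - g) = Pop t i f - Pop t i g.
Proof. by rewrite linearB. Qed.
Lemma PopZ i c f : Pop t i (c *: f) = c *: Pop t i f.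
Proof. by rewrite linearZ. Qed.
Lemma ThetaSB s f g : ThetaS s (f - g) = ThetaS s f - ThetaS s g.
Proof. by rewrite linearB. Qed.
Lemma ThetaSZ s c f : ThetaS s (c *: f) = c *: ThetaS s f.
Proof. by rewrite linearZ. Qed.

Lemma ThetaS_cons i s f : ThetaS (i :: s) f = ThetaS s f + Pop t i f.
Proof. by rewrite /ThetaS big_cons -addrA [_ + Pop t i f]addrC. Qed.

(* The eigenvalues of [ThetaS s] on the levels between [lo] and [hi] are the
   multiples [b * y] with [lo <= b <= hi + size s]. *)
Lemma shift_prod_eq0 s lo hi f : uniq s -> t \notin s -> level_in lo hi f ->
  (0 < lo <= hi)%N ->
  shift_prod s (iota lo (hi + size s - lo).+1) f = 0.
Proof.
elim: s lo hi f => [|i s IH] lo hi f us ts fJ /andP[lo0 lohi].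
  rewrite addn0; apply: fockP => I a; rewrite fock0.
  have E bs : shift_prod [::] bs f I a = (\prod_(b <- bs)
      (y * ((mdeg a + (u \in I))%:R - b%:R))) * f I a :> S.
    elim: bs => [|b bs E]; first by rewrite big_nil mul1r.
    rewrite big_cons /= fockD fockN /ThetaS big_nil addr0 !fockZ JopE E.
    by ring.
  have [inJ|/fJ f0] := boolP (lo <= mdeg a + (u \in I) <= hi)%N; last first.
    by rewrite E f0 mulr0.
  have mI : (mdeg a + (u \in I))%N \in iota lo (hi - lo).+1.
    by rewrite mem_iota; lia.
  rewrite E (big_rem _ mI).
  by rewrite subrr mulr0 -mulrA; apply: mul0r.
move Ebs: (iota _ _) => bs.
move: us ts; rewrite /= inE negb_or => /andP[iNs us] /andP[ti ts].
have it : i != t by rewrite eq_sym.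
have y0 : y != 0 by rewrite expf_neq0 // -msupp_eq0 msuppX.
apply: (fock_scalerI y0); rewrite scaler0.
have -> : y *: shift_prod (i :: s) bs f = shift_prod (i :: s) bs (y *: f).
  by rewrite linearZ.
(* Up to the factor [y], this splits [f] into eigenvectors of [Pop t i], which acts as [y] on the
   first summand and as zero on the second. *)
have -> : y *: f = Pop t i f + (y *: f - Pop t i f) by rewrite addrC subrK.
rewrite linearD /= -[RHS](addr0 0).
have PsP cs g : shift_prod (i :: s) [seq b.+1 | b <- cs] (Pop t i g) =
    Pop t i (shift_prod s cs g).
  elim: cs => //= b cs ->; rewrite ThetaS_cons ThetaS_Pop // Pop_sqr //.
  rewrite PopB PopZ.
  set A := Pop t i _; set B := Pop t i _.
  by apply: fockP => I a; rewrite !(fockD, fockN, fockZ) -natr1; ring.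
have PsQ cs g : shift_prod (i :: s) cs (y *: g - Pop t i g) =
    y *: shift_prod s cs g - Pop t i (shift_prod s cs g).
  elim: cs => //= b cs ->; rewrite ThetaS_cons ThetaSB ThetaSZ.
  rewrite ThetaS_Pop // !PopB !PopZ Pop_sqr //.
  set A := Pop t i _; set B := Pop t i _; set C := ThetaS s _.
  by apply: fockP => I a; rewrite !(fockD, fockN, fockZ); ring.
have -> : bs = iota lo (hi + size s - lo).+2.
  by rewrite -Ebs; congr iota => /=; lia.
set k := (hi + size s - lo).+1; congr (_ + _).
  (* On the image of [Pop t i], the factor for [b.+1] acts as the factor for [b] does without [i].
     The range then starts at [lo.-1], and the part of it from [lo] on already gives zero by
     induction. *)
  have -> : iota lo k.+1 = [seq b.+1 | b <- iota lo.-1 k.+1].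
    by rewrite -[in LHS](prednK lo0) -add1n iotaDl.
  rewrite PsP -[iota lo.-1 k.+1]/(lo.-1 :: iota lo.-1.+1 k) (prednK lo0).
  by rewrite shift_prod_cons IH ?lo0 // !linear0 addr0 linear0.
rewrite PsQ -[k.+1]addn1 iotaD shift_prod_rcons IH ?lo0 ?linear0 ?scaler0
  ?subr0 //.
  by rewrite addr0.
by apply: level_inB; [apply: level_in_ThetaS | apply: level_inZ].
Qed.

Definition allf A f := forall (I : {set 'I_p}) (a :
  'X_{1..n}), supported A (f I a).

Lemma allf0 A : allf A 0.
Proof. by move=> I a; apply: supported0. Qed.

Lemma allfD A f g : allf A f -> allf A g -> allf A (f + g).
Proof. by move=> Af Ag I a; apply: supportedD. Qed.

Lemma allfN A f : allf A f -> allf A (- f).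
Proof. by move=> Af I a; apply: supportedN. Qed.

Lemma allfB A f g : allf A f -> allf A g -> allf A (f - g).
Proof. by move=> Af Ag I a; apply: supportedB. Qed.

Lemma allf_sum A (K : Type) (r : seq K) (P : pred K) (G : K -> fock) :
  (forall k, P k -> allf A (G k)) -> allf A (\sum_(k <- r | P k) G k).
Proof.
by move=> H; elim/big_ind: _ => //; [apply: allf0 | apply: allfD].
Qed.

Lemma allf_shiftd A l f : allf A f -> allf A (shiftd l f).
Proof. by move=> Af I a; apply: Af. Qed.

Section Upward.
Variable A : pred 'X_{1..n}.
Hypothesis upA : upward A.

Lemma allfZ c f : allf A f -> allf A (c *: f).
Proof. by move=> Af I a; apply: supportedM. Qed.

Lemma allf_multv l f : allf A f -> allf A (multv l f).
Proof. by move=> Af I a; rewrite multvE; apply: supportedM. Qed.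

Lemma allf_contr r f : allf A f -> allf A (contr r f).
Proof.
move=> Af I a; rewrite contrE; apply: supported_sum => i _.
by do 2!apply: supportedM => //.
Qed.

Lemma allf_wedge r f : allf A f -> allf A (ewedge r f).
Proof.
move=> Af; rewrite ewedgeU; apply: allf_sum => i _; apply: allfZ => I a.
by rewrite ewedge1E; case: ifP => _; [apply: supportedM | apply: supported0].
Qed.

Lemma allf_Jop f : allf A f -> allf A (Jop f).
Proof. by move=> Af I a; rewrite JopE; apply: supportedM. Qed.

Lemma allf_ThetaS s f : allf A f -> allf A (ThetaS s f).
Proof.
move=> Af; apply: allfD; first by apply/allfZ/allf_Jop.
by apply: allf_sum => i _; apply/allf_contr/allf_wedge.
Qed.

Lemma allf_shift_prod s bs f : allf A f -> allf A (shift_prod s bs f).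
Proof.
move=> Af; elim: bs => //= b bs H.
by apply: allfB; [apply: allf_ThetaS | apply: allfZ].
Qed.

Lemma allf_diff f : allf A f -> allf A (diff f).
Proof.
move=> Af; apply: allfD.
  by apply: allf_sum => l _; apply/allf_contr/allf_shiftd.
rewrite multwU; apply: allf_sum => l _; apply/allfZ/allf_multv.
exact: allf_contr.
Qed.

Lemma allf_htpy f : allf A f -> allf A (htpy t f).
Proof.
move=> Af; apply: allfD.
  by apply: allf_sum => l _; apply/allf_wedge/allf_multv.
by apply/allfZ/allf_wedge/allf_shiftd.
Qed.

End Upward.

Definition order_fge k := allf (fun m => k <= mdeg m)%N.

Lemma order_fge_le k k' f : (k' <= k)%N -> order_fge k f -> order_fge k' f.
Proof. by move=> le kf I a; apply: order_ge_le (kf I a). Qed.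

Lemma order_fge0 k : order_fge k 0.
Proof. exact: allf0. Qed.

Lemma order_fgeD k f g : order_fge k f -> order_fge k g -> order_fge k (f + g).
Proof. exact: allfD. Qed.

Lemma order_fgeB k f g : order_fge k f -> order_fge k g -> order_fge k (f - g).
Proof. exact: allfB. Qed.

Lemma order_fge_sum k (K : Type) (r : seq K) (P : pred K) (G : K -> fock) :
  (forall l, P l -> order_fge k (G l)) ->
  order_fge k (\sum_(l <- r | P l) G l).
Proof. exact: allf_sum. Qed.

Lemma order_fgeZ k k' c f :
  order_ge k c -> order_fge k' f -> order_fge (k + k') (c *: f).
Proof. by move=> kc kf I a; apply: (order_geM kc (kf I a)). Qed.

Lemma order_fge_contrR k l f : order_fge k f -> order_fge k.+1 (contrR l f).
Proof.
move=> kf I a; rewrite /contrR contrE; apply: supported_sum => i _.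
rewrite -add1n; apply: order_geM; first exact: R_order.
by apply: (supportedM (@upward_mdeg n k)); apply: kf.
Qed.

Lemma order_fge_wedgee k i f :
  order_fge k f -> order_fge (M + k) (ewedgee t i f).
Proof.
move=> kf; rewrite /ewedgee ewedgeU; apply: order_fge_sum => l _.
apply: order_fgeZ => // I a; rewrite ewedge1E.
by case: ifP => _; [apply: (supportedM (@upward_mdeg n k));
  apply: kf | apply: supported0].
Qed.

Lemma order_fge_ThetaS k s f :
  order_fge k f -> order_fge (M.+1 + k) (ThetaS s f).
Proof.
move=> kf; apply: order_fgeD.
  apply: order_fgeZ; first exact: order_geXn.
  by apply: (allf_Jop (@upward_mdeg n k)); apply: kf.
apply: order_fge_sum => i _; rewrite addSn.
by apply/order_fge_contrR/order_fge_wedgee.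
Qed.

Lemma order_fge_shift_prod k s bs f : order_fge k f ->
  order_fge (M.+1 * size bs + k) (shift_prod s bs f).
Proof.
move=> kf; elim: bs => [|b bs H]; first by rewrite muln0.
rewrite /= mulnS -addnA; apply: order_fgeB; first exact: order_fge_ThetaS.
apply: order_fgeZ => //.
by apply: (supportedM (@upward_mdeg n _)); apply: order_geXn.
Qed.

Lemma order_fge_htpy k f : order_fge k f -> order_fge (M + k) (htpy t f).
Proof.
move=> kf; apply: order_fgeD.
  apply: order_fge_sum => l _; apply: order_fge_wedgee.
  by apply: (allf_multv (@upward_mdeg n k)); apply: kf.
apply: order_fgeZ; first exact: order_geXn.
apply: (allf_wedge (@upward_mdeg n k)); apply: allf_shiftd; apply: kf.
Qed.

Lemma level_in_le lo hi hi' f : (hi <= hi')%N -> level_in lo hi f ->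
  level_in lo hi' f.
Proof. by move=> le fJ I a J; apply: fJ; lia. Qed.

Lemma level_in_multv lo hi l f : level_in lo hi f ->
  level_in lo.+1 hi.+1 (multv l f).
Proof.
move=> fJ I a J; rewrite multvE; case: (posnP (a l)) => [->|al].
  by rewrite mul0r.
rewrite fJ ?mulr0 //; have: (mdeg (a - U_(l)) + 1 = mdeg a)%N.
  by rewrite -[in RHS](@submK _ U_(l) a) ?lep1mP -?lt0n // mdegD mdeg1.
by lia.
Qed.

Lemma level_in_htpy hi f : level_in 1 hi f -> level_in 1 hi.+1 (htpy t f).
Proof.
move=> fJ; apply: level_inD.
  apply: level_in_sum => l _; apply: level_in_wedgee => I a J.
  by have H := level_in_multv l fJ; apply: (H I a); lia.
apply: level_inZ; rewrite /ewedgeu delta_wedge => I a J.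
rewrite ewedge1E shiftdE; case: ifP => // uI; rewrite fJ ?mulr0 //.
by move: J; rewrite uI !inE eqxx mdegD mdeg1; lia.
Qed.

Let s0 := [seq i <- enum 'I_n | i != t].

Lemma diff_shift_prod bs f :
  diff (shift_prod s0 bs f) = shift_prod s0 bs (diff f).
Proof.
elim: bs => //= b bs <-.
by rewrite linearB linearZ /= -!Theta_ThetaS diff_Theta.
Qed.

Lemma htpy_shift_prod A k hi bs f : upward A ->
  allf A (diff f) -> order_fge k f -> level_in 1 hi f ->
  exists g, [/\ allf A (diff g - (shift_prod s0 bs f
      - (\prod_(b <- bs) - b%:R * y ^+ size bs) *: f)),
    order_fge (M.+1 * size bs + k).-1 g & level_in 1 hi.+1 g].
Proof.
move=> upA Af kf fJ; elim: bs => [|b bs [g [gA gk gJ]]].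
  exists 0; split=> //; last exact: order_fge0.
  by rewrite big_nil mul1r scale1r subrr subr0 linear0; apply: allf0.
set U := shift_prod s0 bs f.
exists (htpy t U - (b%:R * y) *: g); split.
- rewrite big_cons /= -/U.
  set cy := \prod_(b <- bs) _ in gA *.
  have -> : diff (htpy t U - (b%:R * y) *: g) - (ThetaS s0 U - (b%:R * y) *: U
      - ((- b%:R * cy) * y ^+ (size bs).+1) *: f)
    = - htpy t (diff U) - (b%:R * y) *: (diff g - (U - (cy * y ^+ size bs) *:
      f)).
    rewrite linearB linearZ /= -Theta_ThetaS -homotopy.
    set d1 := diff _; set d2 := htpy _ _; set d3 := diff _.
    by apply: fockP => I a; rewrite !(fockD, fockN, fockZ) [y ^+ _.+1]exprS;
      ring.
  apply: allfB; last exact: allfZ.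
  by apply/allfN/allf_htpy; rewrite // /U diff_shift_prod;
    apply: allf_shift_prod.
- apply: order_fgeB.
    have kU : order_fge (M.+1 * size bs + k) U by apply: order_fge_shift_prod.
    apply: order_fge_le (order_fge_htpy kU).
    by rewrite /= mulnS; lia.
  have cy : order_ge M.+1 (b%:R * y).
    by apply: (supportedM (@upward_mdeg n _)); apply: order_geXn.
  by apply: order_fge_le (order_fgeZ cy gk); rewrite /=; lia.
apply: level_inB; last exact: level_inZ.
by apply/level_in_htpy/level_in_shift_prod.
Qed.

(** With levels at most [n] and [n.-1] operators [Pop], the numbers from [1] to [2 * n - 1] cover
    all eigenvalues, so the product vanishes on [f]. Only the constant term remains, and it is
    invertible in characteristic zero. *)
Lemma lift_positive A k hi f : upward A -> (hi <= n)%N ->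
  allf A (diff f) -> order_fge k f -> level_in 1 hi f ->
  exists g, [/\ allf A (diff g - 'X_t ^+ (M.+1 * (2 * n).-1) *: f),
    order_fge (M.+1 * (2 * n).-1 + k).-1 g & level_in 1 hi.+1 g].
Proof.
move=> upA hin Af kf fJ.
have [g [gA gk gJ]] := htpy_shift_prod (iota 1 (2 * n).-1) upA Af kf fJ.
have t0 := ltn_ord t.
rewrite [shift_prod _ _ _](_ : _ = 0) ?size_iota in gA gk; last first.
  have ss : size s0 = n.-1.
    have := cardC1 t; rewrite card_ord cardE => <-.
    by rewrite /s0 enumT; congr size; apply: eq_filter.
  have -> : iota 1 (2 * n).-1 = iota 1 (n + size s0 - 1).+1.
    by congr iota; rewrite ss; lia.
  apply: shift_prod_eq0; first by rewrite filter_uniq ?enum_uniq.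
  - by rewrite mem_filter eqxx.
  - exact: level_in_le fJ.
  - by lia.
set c := \prod_(b <- _) _ in gA.
(* The value [-1] rather than [1] offsets the minus sign before the constant term in [gA]. *)
have [d dc] : exists d : S, d * c = -1.
  exists (- (\prod_(b <- iota 1 (2 * n).-1) (- b%:R^-1 : F))%:MP).
  rewrite mulNr rmorph_prod -big_split big_seq big1 //= => b.
  rewrite mem_iota => b0.
  rewrite -mpolyC_nat -!mpolyCN -mpolyCM mulrN mulNr opprK mulVf ?mpolyC1 //.
  by rewrite pnatr_eq0; lia.
exists (d *: g); split.
- have -> : diff (d *: g) - 'X_t ^+ (M.+1 * (2 * n).-1) *: f
      = d *: (diff g - (0 - (c * y ^+ (2 * n).-1) *: f)).
    rewrite linearZ /= exprM; set D := diff g.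
    apply: fockP => I a; rewrite !(fockD, fockN, fockZ) fock0.
    have -> : d * (D I a - (0 - c * y ^+ (2 * n).-1 * f I a)) =
        d * D I a + (d * c) * (y ^+ (2 * n).-1 * f I a) by ring.
    by rewrite dc mulN1r.
  exact: allfZ.
- by rewrite -[(_ + _).-1]add0n; apply: order_fgeZ.
exact: level_inZ.
Qed.

Lemma contrRB l f g : contrR l (f - g) = contrR l f - contrR l g.
Proof. by rewrite linearB. Qed.
Lemma contrRZ l c f : contrR l (c *: f) = c *: contrR l f.
Proof. by rewrite linearZ. Qed.

Definition contrRs s f : fock := foldr (fun l g => contrR l g) f s.

Lemma contrRs_is_linear s : linear (contrRs s).
Proof. by move=> c f g; elim: s => //= l s ->; rewrite linearP. Qed.
HB.instance Definition _ s :=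
  GRing.isLinear.Build S fock fock _ (contrRs s) (contrRs_is_linear s).

Lemma contrRsB s f g : contrRs s (f - g) = contrRs s f - contrRs s g.
Proof. by rewrite linearB. Qed.
Lemma contrRsZ s c f : contrRs s (c *: f) = c *: contrRs s f.
Proof. by rewrite linearZ. Qed.

Lemma contrRs_contrR s l f :
  contrRs s (contrR l f) = (-1) ^+ size s *: contrR l (contrRs s f).
Proof.
elim: s => [|m s IH] /=; first by rewrite scale1r.
by rewrite IH linearZ /= contrR_anti exprS -scalerA scalerN scaleN1r.
Qed.

Lemma contrRs_wedgee s i f : i \notin s -> t \notin s ->
  contrRs s (ewedgee t i f) = (-1) ^+ size s *: ewedgee t i (contrRs s f).
Proof.
elim: s => [|m s IH] /=; first by rewrite scale1r.
rewrite !inE !negb_or eq_sym => /andP[/negPf mi it] /andP[tm ts].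
rewrite IH // linearZ /= contrR_wedgee_neq; last by rewrite eq_sym.
rewrite mi mulr0 scale0r sub0r.
by rewrite exprS -scalerA scalerN scaleN1r.
Qed.

Lemma allf_contrRs A s f : upward A -> allf A f -> allf A (contrRs s f).
Proof. by move=> upA Af; elim: s => //= l s; apply: allf_contr. Qed.

Lemma diff_wedgee_multv i f : level_in 0 0 f ->
  diff (ewedgee t i (multv i f)) = Pop t i f.
Proof.
move=> fJ; have sf l : shiftd l f = 0.
  by apply: fockP => I a; rewrite shiftdE fJ // mdegD mdeg1; lia.
have uf : contru f = 0.
  apply: fockP => I a; rewrite /contru delta_contr contr1E.
  by case: ifP => // _; rewrite fJ ?mulr0 // !inE eqxx; lia.
rewrite /diff contru_wedgee -multv_contru uf !linear0 addr0.
rewrite /diff1 (bigD1 i) //= big1 ?addr0 => [|l li].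
  by rewrite shiftd_wedgee shiftd_multv sf linear0 add0r eqxx scale1r.
rewrite shiftd_wedgee shiftd_multv sf linear0 add0r (negPf li) scale0r.
by rewrite !linear0.
Qed.

(** At level zero, zero is no longer excluded as an eigenvalue of [Theta]. Instead [y *: f] is split
    into [Pop t i f], a boundary by [diff_wedgee_multv], and [ewedgee t i (contrR i f)], to which
    induction applies; after all of [s] the remaining element lies in [A]. *)
Lemma lift_zero A k s f : upward A -> uniq s -> t \notin s ->
  level_in 0 0 f -> allf A (contrRs s f) -> order_fge k f ->
  exists g, [/\ allf A (diff g - y ^+ size s *: f),
    order_fge (M.+1 * size s + k).-1 g & level_in 1 1 g].
Proof.
move=> upA; elim: s k f => [|i s IH] k f.
  move=> _ _ _ Af _; exists 0; split; [|exact: order_fge0|exact: level_in0].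
  by rewrite linear0 scale1r sub0r; apply: allfN.
rewrite cons_uniq inE negb_or -[size (i :: s)]/(size s).+1.
move=> /andP[si us] /andP[ti ts] fJ Af kf.
have it : i != t by rewrite eq_sym.
set f' := ewedgee t i (contrR i f).
have f'J : level_in 0 0 f' by apply/level_in_wedgee/level_in_contrR.
have f'A : allf A (contrRs s f').
  rewrite contrRs_wedgee // contrRs_contrR linearZ /=.
  by do 2!apply: allfZ => //; apply: allf_wedge.
have f'k : order_fge (M + k.+1) f' by apply/order_fge_wedgee/order_fge_contrR.
have [g [gA gk gJ]] := IH _ _ us ts f'J f'A f'k.
exists (y ^+ size s *: ewedgee t i (multv i f) + g); split.
- have -> : diff (y ^+ size s *: ewedgee t i (multv i f) + g) - y ^+ (size
  s).+1 *: f
      = diff g - y ^+ size s *: f'; last by [].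
    have E : f' = y *: f - Pop t i f.
      by rewrite /Pop contrR_wedgee_neq // eqxx mulr1 opprB addrC subrK.
    rewrite linearP /= diff_wedgee_multv // E.
    rewrite [y ^+ _.+1]exprS; set Q := Pop t i f; set D := diff g.
    by apply: fockP => I a; rewrite !(fockD, fockN, fockZ); ring.
- apply: order_fgeD; last by apply: (order_fge_le _ gk); rewrite mulnS; lia.
  have wk : order_fge (M + k) (ewedgee t i (multv i f)).
    apply: order_fge_wedgee.
    by apply: (allf_multv (@upward_mdeg n k)); apply: kf.
  have ys : order_ge (M.+1 * size s) (y ^+ size s).
    by rewrite -exprM; apply: order_geXn.
  by apply: order_fge_le (order_fgeZ ys wk); rewrite mulnS; lia.
apply: level_inD => //; apply/level_inZ/level_in_wedgee => I a J.
by have H := level_in_multv i fJ; apply: (H I a); lia.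
Qed.

Definition ewedgees s f : fock := foldl (fun g i => ewedgee t i g) f s.

(** Each contraction pairs to [y] with the product of its own index and to zero with the others; the
    terms where it reaches [f] lie in [A]. *)
Lemma contrRs_wedgees A s f : upward A -> uniq s -> t \notin s ->
  (forall i, i \in s -> allf A (contrR i f)) ->
  allf A (contrRs s (ewedgees s f) - y ^+ size s *: f).
Proof.
move=> upA; elim: s f => [|i s IH] f.
  by move=> _ _ _; rewrite scale1r subrr; apply: allf0.
rewrite cons_uniq inE negb_or => /andP[si us] /andP[ti ts] fA.
have it : i != t by rewrite eq_sym.
have IH' : allf A (contrRs s (ewedgees s (ewedgee t i f))
    - y ^+ size s *: ewedgee t i f).
  apply: IH => // k ks; have ki : k != i by apply: contraNneq si => <-.
  rewrite contrR_wedgee_neq; last by apply: contraNneq ts => <-.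
  rewrite (negPf ki) mulr0 scale0r sub0r; apply/allfN/allf_wedge => //.
  by apply: fA; rewrite inE ks orbT.
rewrite /=; set g := contrRs s _ in IH' *.
have -> : contrR i g - y ^+ (size s).+1 *: f =
    contrR i (g - y ^+ size s *: ewedgee t i f)
    - y ^+ size s *: ewedgee t i (contrR i f).
  have E : contrR i (ewedgee t i f) = y *: f - ewedgee t i (contrR i f).
    by rewrite contrR_wedgee_neq // eqxx mulr1.
  rewrite contrRB contrRZ E [y ^+ _.+1]exprS.
  by apply: fockP => I a; rewrite !(fockD, fockN, fockZ); ring.
apply: allfB; first exact: allf_contr.
by apply/allfZ/allf_wedge => //; apply: fA; rewrite inE eqxx.
Qed.

Lemma order_fge_wedgees k s f :
  order_fge k f -> order_fge (M * size s + k) (ewedgees s f).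
Proof.
elim: s k f => [|i s IH] k f kf; first by rewrite muln0.
have -> : (M * size (i :: s) + k = M * size s + (M + k))%N.
  by rewrite [size _]/= mulnS; lia.
by apply: IH; apply: order_fge_wedgee.
Qed.

Lemma level_in_wedgees lo hi s f :
  level_in lo hi f -> level_in lo hi (ewedgees s f).
Proof. by elim: s f => //= i s IH f fJ; apply/IH/level_in_wedgee. Qed.

End FixT.

Lemma contrRs_mem0 s l f : l \in s -> contrR l (contrRs s f) = 0.
Proof.
elim: s => //= m s IH; rewrite inE => /orP[/eqP <-|ls]; first exact: contr_sqr.
by rewrite contrR_anti IH // linear0 oppr0.
Qed.

(** * The chain of lifts starting from a syzygy, and the descent along it *)

Section Vanishing.
Hypothesis n_gt2 : (2 < n)%N.
Variable c : 'I_n -> S.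
Hypothesis c_syz : \sum_l 'X_l * c l = 0.
Hypothesis c_order : forall l, order_ge (n - 2) (c l).

Let va : 'I_n := Ordinal (ltnW (ltnW n_gt2)).
Let vb : 'I_n := Ordinal (ltnW n_gt2).
Let vg : 'I_n := Ordinal n_gt2.

(* Each lift in [chain] multiplies by ['X_k ^+ expo k] and raises the order by
   [expo k - 1]; the factor ['X_vb] missing from [expo 1] is the one divided out
   in [contrRs_div]. *)
Definition expo (i : nat) : nat :=
  if i is i'.+1 then if i' is i''.+1 then
    if i'' is _.+1 then M.+1 * (2 * n).-1 else M.+1 * n.-1
  else (M.+1 * n.-1).-1 else M.+1.

Definition pideal k : pred 'X_{1..n} :=
  fun m => [exists i : 'I_n, (i < k)%N && (expo i <= m i)%N].

Lemma pideal_upward k : upward (pideal k).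
Proof. exact: (@power_ideal_upward n (expo \o val) k). Qed.

Lemma pideal_le k k' f : (k <= k')%N -> allf (pideal k) f -> allf (pideal k') f.
Proof.
move=> le fk I a.
exact: (@power_ideal_le _ _ (expo \o val) k k' _ le (fk I a)).
Qed.

Lemma pidealX k (i : 'I_n) f :
  (i < k)%N -> allf (pideal k) ('X_i ^+ expo i *: f).
Proof.
move=> ik I a; rewrite fockZ [_ * _]mulrC; apply: supportedM;
  first exact: pideal_upward.
exact: (@power_idealX _ _ (expo \o val)).
Qed.

Lemma pideal_nzd k (i : 'I_n) r f : (k <= i)%N ->
  allf (pideal k) ('X_i ^+ r *: f) -> allf (pideal k) f.
Proof.
by move=> ki fk I a; apply: (@power_ideal_nzd _ _ (expo \o val) k i r) => //;
  apply: fk.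
Qed.

Lemma fock_choice (P : {set 'I_p} -> 'X_{1..n} -> S -> Prop) :
  (forall I a, exists x, P I a x) -> exists f : fock, forall I a, P I a (f I a).
Proof.
move=> H; have [F' F'P] := choice (fun Ia => H Ia.1 Ia.2).
by exists (fun I a => F' (I, a)) => I a; apply: (F'P (I, a)).
Qed.

Lemma pideal_split (k : 'I_n) f : allf (pideal k.+1) f ->
  exists g, allf (pideal k) (f - 'X_k ^+ expo k *: g).
Proof.
move=> fk; apply: (@fock_choice (fun I a x =>
  supported (pideal k) ((f I a : S) - 'X_k ^+ expo k * x))) => I a.
exact: (@power_ideal_split _ _ (expo \o val) k _ (fk I a)).
Qed.

Definition in_diff k f := exists g, allf (pideal k) (f - diff g).

(** If [f' - diff g] is ['X_k ^+ expo k *: h] modulo the smaller ideal, applying [diff] shows that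
    ['X_k ^+ expo k *: (f - diff h)] lies in that ideal, and the power of ['X_k] can be
    cancelled. *)
Lemma in_diff_descent (k : 'I_n) f f' :
  allf (pideal k) (diff f' - 'X_k ^+ expo k *: f) ->
  in_diff k.+1 f' -> in_diff k f.
Proof.
move=> ff' [g]; move=> /pideal_split[h hP]; exists h.
apply: (@pideal_nzd k k (expo k)) => //.
have -> : 'X_k ^+ expo k *: (f - diff h) =
    diff (f' - diff g - 'X_k ^+ expo k *: h)
    - (diff f' - 'X_k ^+ expo k *: f).
  rewrite !diffB diffZ diff_diff subr0.
  set d := diff f'; set d' := diff h.
  by apply: fockP => I a; rewrite !(fockD, fockN, fockZ); ring.
by apply: allfB => //; apply: allf_diff => //; apply: pideal_upward.
Qed.

Definition vac : fock := fun I a => ((I == finset.set0) && (a == 0%MM))%:R.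

Lemma contr_vac r : contr r vac = 0.
Proof.
apply: fockP => I a; rewrite contrE big1 // => i _.
rewrite /vac (_ : (i |: I == finset.set0) = false) ?mulr0 //.
by apply/negbTE/set0Pn; exists i; rewrite !inE eqxx.
Qed.

Let T1 : fock := ewedge (fun j => \sum_l c l * e va l j) vac.

(** By [e_pair] the contraction is the stated multiple of [vac] plus a multiple of
    [\sum_l 'X_l * c l], which is zero. So [T1] encodes [c], and its contractions vanish modulo
    ['X_va ^+ expo 0]. *)
Lemma contrR_T1 k : contrR k T1 = ('X_va ^+ M.+1 * c k) *: vac.
Proof.
rewrite /contrR /T1 contr_wedge contr_vac linear0 subr0; congr (_ *: _).
under eq_bigr => j _ do rewrite mulr_sumr.
rewrite exchange_big /=.
transitivity (\sum_l c l * ('X_va ^+ M * ('X_va * (k == l)%:R - 'X_l * (k ==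
  va)%:R))).
  apply: eq_bigr => l _; rewrite -e_pair mulr_sumr; apply: eq_bigr => j _.
  by rewrite mulrCA.
transitivity ('X_va ^+ M.+1 * c k - 'X_va ^+ M * (k == va)%:R * \sum_l 'X_l *
  c l).
  have -> : 'X_va ^+ M.+1 * c k = \sum_l 'X_va ^+ M.+1 * c l * (k == l)%:R.
    rewrite (bigD1 k) //= eqxx mulr1 big1 ?addr0 // => l /negPf lk.
    by rewrite eq_sym lk mulr0.
  rewrite mulr_sumr -sumrB; apply: eq_bigr => l _.
  by rewrite exprS; ring.
by rewrite c_syz mulr0 subr0.
Qed.

Lemma T1_level : level_in 0 0 T1.
Proof.
apply: level_in_wedge; first by rewrite big1 // => l _; rewrite e_u mulr0.
move=> I a; rewrite /vac; case: eqVneq => [->|//]; case: eqVneq => [->|//].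
by rewrite mdeg0 inE.
Qed.

Lemma T1_order : order_fge (M + (n - 2)) T1.
Proof.
rewrite /T1 ewedgeU; apply: order_fge_sum => j _; rewrite -[(_ + _)%N]addn0.
apply: order_fgeZ; last by [].
apply: supported_sum => l _; rewrite mulrC.
exact: (order_geM (@e_order va l j) (@c_order l)).
Qed.

Let rest : seq 'I_n := [seq i <- enum 'I_n | (i != vb) && (i != vg)].

Lemma size_rest : (size rest).+1 = n.-1.
Proof.
have vbg : vb != vg by [].
have := cardC (pred2 vb vg); rewrite card2 vbg card_ord cardE => e2.
have <- : size (enum (predC (pred2 vb vg))) = size rest.
  rewrite /rest enumT; congr size; apply: eq_filter => i.
  by rewrite !inE negb_or.
have e2' : (2 + size (enum (predC (pred2 vb vg))) = n)%N := e2; lia.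
Qed.

Lemma rest_uniq l : l \notin rest -> uniq (l :: rest).
Proof. by move=> lr; rewrite cons_uniq lr filter_uniq ?enum_uniq. Qed.

Lemma vb_rest : vb \notin vg :: rest.
Proof. by rewrite inE mem_filter eqxx. Qed.

Lemma vg_rest : vg \notin vb :: rest.
Proof. by rewrite inE mem_filter eqxx andbF. Qed.

Lemma contrRs_swap f :
  'X_vb *: contrRs (vb :: rest) f = - ('X_vg *: contrRs (vg :: rest) f).
Proof.
have := contrR_syz (contrRs rest f); rewrite (bigD1 vb) //= (bigD1 vg) //=.
rewrite big1 ?addr0 => [/eqP|l /andP[lb lg]].
  by rewrite addr_eq0 => /eqP.
by rewrite contrRs_mem0 ?scaler0 // mem_filter lb lg mem_enum.
Qed.

Lemma X_neq0 (i : 'I_n) : 'X_i != 0 :> S.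
Proof. by rewrite -msupp_eq0 msuppX. Qed.

(* The relation [R_syz] exchanges ['X_vb *: contrR vb] for ['X_vg *: contrR vg]
   modulo the other contractions, and ['X_vb] is prime to ['X_vg]. *)
Lemma contrRs_div f : exists g, contrRs (vg :: rest) f = 'X_vb *: g.
Proof.
have H I a : exists x : S, contrRs (vg :: rest) f I a = 'X_vb * x.
  apply: (@dvdX_coprime _ _ vb vg 1 (- (contrRs (vb :: rest) f I a : S))) => //.
  have := congr1 (fun h : fock => - h I a : S) (contrRs_swap f).
  by rewrite fockN !fockZ opprK expr1 mulrN.
by have [g gP] := fock_choice H; exists g; apply: fockP.
Qed.

(** Only [l = vb] is not in the list; after multiplication by ['X_vb], [contrRs_swap] trades it for
    a contraction by [vg], and [vg] occurs twice then. *)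
Lemma contrR_contrRs0 l f : contrR l (contrRs (vg :: rest) f) = 0.
Proof.
have [lr|] := boolP (l \in vg :: rest); first exact: contrRs_mem0.
rewrite inE mem_filter mem_enum andbT negb_or -negb_or => H.
have -> : l = vb.
  by apply/eqP; move: H; case: (l == vb); case: (l == vg).
apply: (fock_scalerI (X_neq0 vb)); rewrite scaler0 /= contrR_anti scalerN.
rewrite -contrRZ -[contrR vb _]/(contrRs (vb :: rest) f) contrRs_swap.
by rewrite -scaleNr contrRZ contrRs_mem0 ?mem_head // scaler0 oppr0.
Qed.

Lemma contrRs_local s f g a : (forall I, f I a = g I a :> S) ->
  forall I, contrRs s f I a = contrRs s g I a :> S.
Proof.
move=> fg; elim: s => //= l s IH I.
by rewrite /contrR !contrE; apply: eq_bigr => i _; rewrite IH.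
Qed.

(** At exponent zero [multw] contributes nothing, and [diff1] is a sum of contractions, each killed
    by [contrR_contrRs0]. *)
Lemma contrRs_diff0 f I : contrRs (vg :: rest) (diff f) I 0%MM = 0 :> S.
Proof.
have E J : diff f J 0%MM = diff1 f J 0%MM :> S.
  rewrite /diff fockD multwU fock_sum big1 ?addr0 // => l _.
  by rewrite fockZ multvE mnm0E mul0r mulr0.
rewrite (contrRs_local _ E) /diff1 linear_sum /= fock_sum big1 // => l _.
have := contrRs_contrR (vg :: rest) l (shiftd l f).
by rewrite contrR_contrRs0 scaler0 /= => ->.
Qed.

(** The products run over all indices other than [vb], so that contracting them away recovers [T1]
    in [contrRs_T2]. *)
Let T2 : fock := ewedgees vb (vg :: rest) T1.

Let y := 'X_vb ^+ M.+1 : S.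

Lemma expo_gt0 i : (0 < expo i)%N.
Proof. by rewrite /expo; case: i => [|[|[|i]]] //; nia. Qed.

Lemma y_expo : y ^+ n.-1 = 'X_vb * 'X_vb ^+ expo 1.
Proof. by rewrite /y -exprM -exprS prednK //; nia. Qed.

Lemma contrRs_T2 : allf (pideal 1) (contrRs (vg :: rest) T2 - y ^+ n.-1 *: T1).
Proof.
rewrite -size_rest; apply: contrRs_wedgees; first exact: pideal_upward.
- by apply: rest_uniq; rewrite mem_filter eqxx andbF.
- exact: vb_rest.
move=> i _; rewrite contrR_T1 -scalerA.
exact: (@pidealX 1 va).
Qed.

Lemma in_diff_T2 : in_diff 2 T2 ->
  exists b : 'I_p -> S, forall k, c k = \sum_j R k j * b j.
Proof.
move=> [g /(@pideal_split vb)[b bP]].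
have [b' Eb] := contrRs_div b.
have b'0 k : contrR k b' = 0.
  apply: (fock_scalerI (X_neq0 vb)); rewrite scaler0 -contrRZ -Eb.
  exact: contrR_contrRs0.
(* Contracting [T2 = diff g + 'X_vb ^+ expo 1 *: b] by [vg :: rest] at exponent zero kills the
   boundary. Both remaining terms contain ['X_vb ^+ (expo 1).+1], one factor of it coming from
   [contrRs_div], and this power is cancelled. *)
have T1b I : supported (pideal 1) (T1 I 0%MM - b' I 0%MM : S).
  apply: (@power_ideal_nzd _ _ (expo \o val) 1 vb (expo 1).+1) => //.
  have := allfB (allf_contrRs (s := vg :: rest) (@pideal_upward 1) bP)
    contrRs_T2.
  rewrite !contrRsB contrRsZ Eb => /(_ I 0%MM).
  rewrite !(fockD, fockN, fockZ) contrRs_diff0 subr0 y_expo.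
  have -> (x x1 x2 z w : S) : x - z * (w * x1) - (x - w * z * x2)
      = (z * w) * (x2 - x1) by ring.
  by rewrite -exprSr.
(* Every contraction kills [b'], so contracting this equation by [R k] expresses
   ['X_va ^+ M.+1 * c k] through the values of [x] on singletons; these are the coefficients
   sought. *)
have H I : exists x : S, T1 I 0%MM = b' I 0%MM + 'X_va ^+ M.+1 * x :> S.
  have [q /power_ideal0 /eqP] := @power_ideal_split _ _ (expo \o val) va _
    (T1b I).
  rewrite subr_eq0 => /eqP qE; exists q.
  by rewrite -[X in _ + X]qE addrC subrK.
have [h hP] := choice H.
exists (fun j => sgn S j finset.set0 * h (j |: finset.set0)%SET) => k.
have va0 : 'X_va ^+ M.+1 != 0 :> S by rewrite expf_neq0 ?X_neq0.
apply: (mulfI va0).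
have /(congr1 (fun f : fock => f finset.set0 0%MM : S)) := contrR_T1 k.
rewrite fockZ /vac !eqxx mulr1 => <-.
have := congr1 (fun f : fock => f finset.set0 0%MM : S) (b'0 k).
rewrite /contrR !contrE fock0 => b'k.
under eq_bigr => i _ do rewrite hP !mulrDr.
rewrite big_split /= b'k add0r mulr_sumr.
under eq_bigl => i do rewrite inE.
by apply: eq_bigr => i _; ring.
Qed.

Lemma T2_level : level_in 0 0 T2.
Proof. exact/level_in_wedgees/T1_level. Qed.

Definition expo_sum k := (\sum_(i < k) expo i)%N.

Lemma expo_sum_ge k : (k <= expo_sum k)%N.
Proof.
rewrite -[X in (X <= _)%N]card_ord -sum1_card; apply: leq_sum => i _.
exact: expo_gt0.
Qed.

(** The bound on the order of [c] enters here: the order of [T2] exceeds the sum of the [expo i - 1]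
    with [i < 2] by one. Each later lift preserves this excess. *)
Lemma T2_order : order_fge ((expo_sum 2).+1 - 2) T2.
Proof.
apply: order_fge_le (order_fge_wedgees (s := vg :: rest) T1_order).
by rewrite /expo_sum !big_ord_recr big_ord0 /= size_rest; nia.
Qed.

Lemma T3_exists : exists T, [/\ allf (pideal 2) (diff T - 'X_vg ^+ expo 2 *:
  T2),
  order_fge ((expo_sum 3).+1 - 3) T & level_in 1 1 T].
Proof.
have [tau Etau] := contrRs_div T2.
(* Dividing [contrRs_T2] by ['X_vb] gives [tau = 'X_vb ^+ expo 1 *: T1] modulo [pideal 1]. This
   supplies the hypothesis of [lift_zero], since the contraction by [vb :: rest] is
   [- 'X_vg *: tau]. *)
have tauP : allf (pideal 2) tau.
  have H : allf (pideal 1) ('X_vb ^+ 1 *: (tau - 'X_vb ^+ expo 1 *: T1)).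
    by rewrite expr1 scalerBr scalerA -y_expo -Etau; apply: contrRs_T2.
  have := pideal_le (isT : (1 <= 2)%N) (@pideal_nzd 1 vb 1 _ isT H).
  move=> /allfD /(_ (@pidealX 2 vb T1 isT)).
  by rewrite subrK.
have ZP : allf (pideal 2) (contrRs (vb :: rest) T2).
  have -> : contrRs (vb :: rest) T2 = - 'X_vg *: tau.
    apply: (fock_scalerI (X_neq0 vb)); rewrite contrRs_swap Etau.
    by rewrite !scaleNr scalerN !scalerA mulrC.
  by apply: allfZ => //; apply: pideal_upward.
have ub : uniq (vb :: rest) by apply: rest_uniq; rewrite mem_filter eqxx.
have [T [TP To TJ]] :=
  lift_zero (@pideal_upward 2) ub vg_rest T2_level ZP T2_order.
exists T; split=> //.
  by move: TP; rewrite -exprM [size _]/= size_rest.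
apply: order_fge_le To; rewrite [size _]/= size_rest.
have := expo_sum_ge 2; rewrite {2 3}/expo_sum !big_ord_recr /= -/(expo_sum _).
by lia.
Qed.

(** The first lift leaves level zero by [T3_exists]; from then on levels are positive and
    [lift_positive] applies. The final implication composes the descents. *)
Lemma chain k : (3 <= k <= n)%N -> exists T, [/\ allf (pideal k) (diff T),
  order_fge ((expo_sum k).+1 - k) T, level_in 1 (k - 2) T &
  in_diff k T -> in_diff 2 T2].
Proof.
elim: k => // k IH; rewrite ltnS leq_eqVlt andb_orl => /orP[/andP[/eqP <- _]|].
  have [T [TP To TJ]] := T3_exists; exists T; split=> //.
    have := allfD (pideal_le (isT : (2 <= 3)%N) TP) (@pidealX 3 vg T2 isT).
    by rewrite subrK.
  exact: (@in_diff_descent vg).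
move=> /andP[k3 kn]; have /IH[T [TP To TJ Td]] :
  (2 < k <= n)%N by rewrite k3 ltnW.
have kn2 : (k - 2 <= n)%N by rewrite (leq_trans _ (ltnW kn)) ?leq_subr.
have [T' [T'P T'o T'J]] := lift_positive (Ordinal kn) (@pideal_upward k) kn2
  TP To TJ.
have ek : expo k = (M.+1 * (2 * n).-1)%N by case: (k) k3 => [|[|[|]]].
rewrite -ek in T'P T'o; exists T'; split.
- have := allfD (pideal_le (leqnSn k) T'P) (@pidealX k.+1 (Ordinal kn) T
  (ltnSn k)).
  by rewrite subrK.
- apply: order_fge_le T'o; have := expo_sum_ge k.
  by rewrite {2}/expo_sum big_ord_recr /= -/(expo_sum k); lia.
- by have -> : (k.+1 - 2 = (k - 2).+1)%N by lia.
by move=> H; apply/Td/(@in_diff_descent (Ordinal kn) T T').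
Qed.

Lemma syzygy_in_span :
  exists b : 'I_p -> S, forall k, c k = \sum_j R k j * b j.
Proof.
have [|T [_ To _ Td]] := @chain n; first by rewrite n_gt2 leqnn.
(* The order of [T] exceeds the sum of all [expo i - 1], so [T] is zero modulo [pideal n] and
   bounded by [0]. *)
apply/in_diff_T2/Td; exists 0; rewrite linear0 subr0 => I a.
apply: (@power_ideal_order _ _ (expo \o val) _ _ (To I a)).
have : (\sum_(i < n) (expo i).-1 + \sum_(i < n) 1 = expo_sum n)%N.
  rewrite -big_split; apply: eq_bigr => i _.
  by rewrite /= addn1 prednK ?expo_gt0.
rewrite sum1_card card_ord /= => E.
by lia.
Qed.

End Vanishing.
End Homotopy.

(** * Supports of graded modules *)

Lemma pencil_step (R : comNzRingType) (U : lmodType R) (x y c : R) (a b : U) :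
  (x - c * y) *: a - y *: (b - c *: a) = x *: a - y *: b.
Proof.
by rewrite scalerBl scalerBr scalerA opprB addrA [y * c]mulrC subrK.
Qed.

Lemma pencil_iter (R : comNzRingType) (U : lmodType R) (p q x e : R)
    (a b c : U) :
  p *: (q *: a - x *: b) + x *: (p *: b - e *: c) = (q * p) *: a - (x * e) *: c.
Proof.
by rewrite !scalerBr !scalerA addrA [p * x]mulrC subrK [p * q]mulrC.
Qed.

Section GradedSubmodules.
Variables (F : fieldType) (n r : nat).
Local Notation S := {mpoly F[n]}.
Local Notation G := {ffun 'I_r -> S^o}.
Implicit Types (p : S) (m : 'X_{1..n}) (z w : G) (Q : G -> Prop).

Lemma pihomog_mul_linear p q d : p \is 1.-homog ->
  pihomog mdeg d.+1 (p * q) = p * pihomog mdeg d q.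
Proof.
move=> p1; rewrite [q](pihomog_partitionE (mf := mdeg) (leqnn _)) mulr_sumr.
rewrite !raddf_sum mulr_sumr; apply: eq_bigr => b _ /=.
have qb := pihomogP mdeg b q; have pqb := dhomogM p1 qb.
rewrite add1n in pqb; have [->|db] := eqVneq (b : nat) d.
  rewrite pihomog_id; apply: pihomog_dE.
    by rewrite -[d.+1]add1n dhomogM // pihomogP.
by rewrite (pihomog_ne0 _ pqb) // (pihomog_ne0 _ qb) // mulr0.
Qed.

Lemma pihomog0_mul_linear p q : p \is 1.-homog -> pihomog mdeg 0 (p * q) = 0.
Proof.
move=> p1; rewrite [q](pihomog_partitionE (mf := mdeg) (leqnn _)) mulr_sumr.
rewrite raddf_sum big1 // => b _ /=; have := dhomogM p1 (pihomogP mdeg b q).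
by move=> pqb; rewrite (pihomog_ne0 _ pqb) // addn_eq0.
Qed.

Definition hpart d z : G := [ffun i => pihomog mdeg d (z i)].

Definition homogv d z := forall i, (z i : S) \is d.-homog.

Definition submod Q := [/\ Q 0, (forall x y, Q x -> Q y -> Q (x + y)) &
  forall p x, Q x -> Q (p *: x)].

Definition graded Q := submod Q /\ forall d x, Q x -> Q (hpart d x).

Definition gen i : G := [ffun j => (i == j)%:R : S].

Definition contains_degree Q d :=
  forall m i, (d <= mdeg m)%N -> Q ('X_[m] *: gen i).

(** For graded [Q], the quotient by [Q] is finite-dimensional over [F]. *)
Definition cofinite Q := exists d, contains_degree Q d.

(** The submodule [Q + p G]. *)
Definition add_mult Q p z := exists w, Q (z - p *: w).

Lemma submod_sum Q (I : Type) (s : seq I) (P : pred I) (f : I -> G) :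
  submod Q -> (forall i, P i -> Q (f i)) -> Q (\sum_(i <- s | P i) f i).
Proof. by move=> [Q0 QD _] Qf; elim/big_ind: _. Qed.

Lemma hpartB d z w : hpart d (z - w) = hpart d z - hpart d w.
Proof. by apply/ffunP => i; rewrite !ffunE raddfB. Qed.

Lemma hpart_id d z : homogv d z -> hpart d z = z.
Proof. by move=> zd; apply/ffunP => i; rewrite ffunE pihomog_dE. Qed.

Lemma homogv_hpart d z : homogv d (hpart d z).
Proof. by move=> i; rewrite ffunE pihomogP. Qed.

Lemma hpartZ d p z : p \is 1.-homog -> hpart d.+1 (p *: z) = p *: hpart d z.
Proof. by move=> p1; apply/ffunP => i; rewrite !ffunE pihomog_mul_linear. Qed.

Lemma hpart0Z p z : p \is 1.-homog -> hpart 0 (p *: z) = 0.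
Proof. by move=> p1; apply/ffunP => i; rewrite !ffunE pihomog0_mul_linear. Qed.

Lemma homogv_gen m i : homogv (mdeg m) ('X_[m] *: gen i).
Proof.
move=> j; rewrite !ffunE; case: eqP => _.
  by rewrite [_ *: _]mulr1 dhomogX.
by rewrite [_ *: _]mulr0 dhomog0.
Qed.

Lemma add_mult_sub Q p z : submod Q -> Q z -> add_mult Q p z.
Proof. by move=> _ Qz; exists 0; rewrite scaler0 subr0. Qed.

Lemma add_mult_mul Q p z : submod Q -> add_mult Q p (p *: z).
Proof. by move=> [Q0 _ _]; exists z; rewrite subrr. Qed.

Lemma add_mult_mono Q Q' p z :
  (forall w, Q w -> Q' w) -> add_mult Q p z -> add_mult Q' p z.
Proof. by move=> QQ' [w /QQ' ?]; exists w. Qed.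

Lemma graded_add_mult Q p : p \is 1.-homog -> graded Q -> graded (add_mult Q p).
Proof.
move=> p1 [QS Qh]; have [Q0 QD QZ] := QS; split; first split.
- by exists 0; rewrite scaler0 subr0.
- move=> x y [w Qw] [w' Qw']; exists (w + w').
  by rewrite scalerDr opprD addrACA; apply: QD.
- by move=> q x [w Qw]; exists (q *: w);
  rewrite scalerA mulrC -scalerA -scalerBr; apply: QZ.
move=> [|d] x [w Qw].
  by exists 0; have := Qh 0%N _ Qw; rewrite hpartB hpart0Z // scaler0.
by exists (hpart d w); have := Qh d.+1 _ Qw; rewrite hpartB hpartZ.
Qed.

Lemma contains_degree_eq Q d : submod Q ->
  (forall m i, mdeg m = d -> Q ('X_[m] *: gen i)) -> contains_degree Q d.
Proof.
move=> [_ _ QZ] H m i; move e: (mdeg m - d)%N => k.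
elim: k m e => [|k IH] m e dm; first by apply: H; lia.
have [l ml] : exists l, m l != 0%N.
  apply: contrapT => nm; move: e; rewrite mdegE big1 => [|l _]; first by lia.
  by apply: contrapT => /eqP ml; apply: nm; exists l.
have lem : (U_(l) <= m)%MM by rewrite lep1mP.
have em : (mdeg (m - U_(l)) + 1 = mdeg m)%N.
  by rewrite -[in RHS](submK lem) mdegD mdeg1.
by rewrite -(submK lem) addmC mpolyXD -scalerA; apply: QZ; apply: IH; lia.
Qed.

Lemma genE z : z = \sum_i (z i : S) *: gen i.
Proof.
apply/ffunP => j; rewrite sum_ffunE (bigD1 j) //= big1 => [|i ij].
  by rewrite !ffunE eqxx [_ *: _]mulr1 addr0.
by rewrite !ffunE (negPf ij) [_ *: _]mulr0.
Qed.

Lemma contains_homogv Q d e z : submod Q -> contains_degree Q d ->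
  (d <= e)%N -> homogv e z -> Q z.
Proof.
move=> QS Qd de ze; rewrite (genE z); apply: submod_sum => // i _.
rewrite {1}[z i]mpolyE scaler_suml big_seq; apply: submod_sum => // m ms.
rewrite -mul_mpolyC -scalerA; case: (QS) => _ _; apply.
by apply: Qd; rewrite (dhomog_mf (ze i) ms).
Qed.

Section Eigenvalue.
Variables (Q : G -> Prop) (i k : 'I_n).
Hypothesis gQ : graded Q.

Definition comb D (g : 'I_D -> G) (u : 'rV[F]_D) : G :=
  \sum_j (u 0 j)%:MP *: g j.

Lemma combD D (g : 'I_D -> G) u v : comb g (u + v) = comb g u + comb g v.
Proof.
rewrite /comb -big_split; apply: eq_bigr => j _ /=.
by rewrite mxE mpolyCD scalerDl.
Qed.

Lemma combZ D (g : 'I_D -> G) a u : comb g (a *: u) = a%:MP *: comb g u.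
Proof.
rewrite /comb scaler_sumr; apply: eq_bigr => j _.
by rewrite mxE mpolyCM scalerA.
Qed.

Lemma comb0 D (g : 'I_D -> G) : comb g 0 = 0.
Proof. by rewrite /comb big1 // => j _; rewrite mxE mpolyC0 scale0r. Qed.

Lemma comb_sum D (g : 'I_D -> G) (I : Type) (s : seq I) (f : I -> 'rV[F]_D) :
  comb g (\sum_(x <- s) f x) = \sum_(x <- s) comb g (f x).
Proof.
elim/big_rec2: _ => [|x u v _ <-]; last by rewrite combD.
exact: comb0.
Qed.

Definition pencil c : S := 'X_k - c *: 'X_i.

Lemma pencil_homog c : pencil c \is 1.-homog.
Proof.
by rewrite rpredB ?rpredZ // dhomogX /= mdeg1.
Qed.

(* Modulo [Q], multiplication by ['X_k] is ['X_i] times [C] on the [g j]: this is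
   Cayley-Hamilton for [C]. *)
Lemma char_poly_annihilates D (g : 'I_D -> G) (C : 'M[F]_D) (cs : seq F) :
  (forall j, Q ('X_k *: g j - 'X_i *: comb g (row j C))) ->
  char_poly C = \prod_(c <- cs) ('X - c%:P) ->
  forall u, Q ((\prod_(c <- cs) pencil c) *: comb g u).
Proof.
have [QS Qh] := gQ; have [Q0 QD QZ] := QS.
case: D g C => [|D] g C gC ccs u; first by rewrite /comb big_ord0 scaler0.
have combM v : comb g (v *m C) = \sum_j (v 0 j)%:MP *: comb g (row j C).
  by rewrite mulmx_sum_row comb_sum; apply: eq_bigr => j _; rewrite combZ.
have step c v : Q (pencil c *: comb g v - 'X_i *: comb g (v *m (C - c%:M))).
  have -> : pencil c *: comb g v - 'X_i *: comb g (v *m (C - c%:M)) =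
      \sum_j (v 0 j)%:MP *: ('X_k *: g j - 'X_i *: comb g (row j C)).
    transitivity ('X_k *: comb g v - 'X_i *: comb g (v *m C)).
      rewrite mulmxBr mul_mx_scalar -[- (c *: v)]scaleNr combD combZ.
      by rewrite mpolyCN scaleNr /pencil -mul_mpolyC pencil_step.
    rewrite combM /comb !scaler_sumr -sumrB; apply: eq_bigr => j _.
    by rewrite scalerBr !scalerA ![_%:MP * _]mulrC.
  by apply: submod_sum => // j _; apply: QZ.
have iter v : Q ((\prod_(c <- cs) pencil c) *: comb g v
    - 'X_i ^+ size cs *: comb g (v *m \prod_(c <- cs) (C - c%:M))).
  elim: (cs) v => [|c cs' IH] v.
    by rewrite !big_nil mulmx1 !scale1r subrr.
  rewrite !big_cons; set p := \prod_(_ <- _) _; set A := \prod_(_ <- _) _.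
  have := QD _ _ (QZ p _ (step c v)) (QZ 'X_i _ (IH (v *m (C - c%:M)))).
  by rewrite pencil_iter -mulmxA -exprS.
have := iter u; rewrite [X in u *m X](_ : _ = 0).
  by rewrite mulmx0 comb0 scaler0 subr0.
have /= := Cayley_Hamilton C; rewrite ccs rmorph_prod => <-.
by apply: eq_bigr => c _; rewrite rmorphB /= horner_mx_X horner_mx_C.
Qed.

Lemma homogv_comb d : exists D (g : 'I_D -> G),
  (forall j, (exists m b, mdeg m = d /\ g j = 'X_[m] *: gen b) \/ g j = 0) /\
  (forall z, homogv d z -> exists u, z = comb g u).
Proof.
pose T : finType := ('X_{1..n < d.+1} * 'I_r)%type.
(* The finite type [T] also contains the monomials of degree below [d]; they are sent to zero. *)
pose g0 (x : T) : G := if mdeg x.1 == d then 'X_[x.1] *: gen x.2 else 0.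
exists #|T|, (fun j => g0 (enum_val j)); split=> [j|z zd].
  rewrite /g0; case: eqP => [dm|_]; [left | by right].
  by exists (enum_val j).1, (enum_val j).2.
pose cf (x : T) : F := (z x.2 : S)@_(x.1 : 'X_{1..n}).
exists (\row_(j < #|T|) cf (enum_val j)).
transitivity (\sum_(x : T) (cf x)%:MP *: g0 x); last first.
  rewrite /comb (reindex (@enum_val T predT)); last exact/onW_bij/enum_val_bij.
  by apply: eq_bigr => j _; rewrite mxE.
rewrite -(pair_bigA _ (fun (m : 'X_{1..n < d.+1}) b =>
  (cf (m, b))%:MP *: g0 (m, b))) /= exchange_big /= {1}(genE z).
apply: eq_bigr => b _; rewrite {1}(@mpolywE _ _ d.+1 (z b)); last first.
  rewrite msizeE big_seq; elim/big_ind: _ => // [a c|m ms].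
    by rewrite geq_max => -> ->.
  by rewrite (dhomog_mf (zd b) ms).
rewrite scaler_suml; apply: eq_bigr => m _; rewrite /g0 /cf /=.
case: eqP => [_|md]; first by rewrite scalerA mul_mpolyC.
rewrite scaler0 memN_msupp_eq0 ?scale0r //.
by apply/negP => /(dhomog_mf (zd b)).
Qed.
End Eigenvalue.
End GradedSubmodules.

(** * Points of the support over an algebraically closed field *)

Section Points.
Variables (F : closedFieldType) (n r : nat).
Local Notation S := {mpoly F[n]}.
Local Notation G := {ffun 'I_r -> S^o}.
Implicit Types (p : S) (m : 'X_{1..n}) (z w : G) (Q : G -> Prop).

(** The linear forms are divided out one at a time. Each division lowers the degree by one, so [e]
    is raised at each step for the last degree to be at least [d]. *)
Lemma pencil_prod_divides Q (i k : 'I_n) (cs : seq F) d : graded Q ->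
  (forall c, cofinite (add_mult Q (pencil i k c))) ->
  exists e, forall b z, (e <= b)%N -> homogv b z -> exists b' w,
    [/\ (d <= b')%N, homogv b' w & Q (z - (\prod_(c <- cs) pencil i k c) *: w)].
Proof.
move=> gQ cof; have [QS Qh] := gQ; have [Q0 QD QZ] := QS.
elim: cs => [|c cs [e IH]].
  by exists d => b z db zb; exists b, z; rewrite big_nil scale1r subrr.
have [ec cofc] := cof c; exists (maxn ec e.+1) => b z.
rewrite geq_max => /andP[ecb eb] zb.
case: b ecb eb zb => // b ecb eb zb.
have gQc := graded_add_mult (pencil_homog i k c) gQ.
have [w0 Qw0] := contains_homogv gQc.1 cofc ecb zb.
have := Qh b.+1 _ Qw0; rewrite hpartB (hpart_id zb) hpartZ ?pencil_homog //.
have hw := homogv_hpart b w0; set w1 := hpart b w0 in hw *.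
move=> Qw1; have [b' [w [db wb Qw]]] := IH b w1 eb hw.
exists b', w; split; [exact: db | exact: wb | rewrite big_cons].
have := QD _ _ Qw1 (QZ (pencil i k c) _ Qw).
by rewrite scalerBr scalerA addrA subrK.
Qed.

(** In degree [d], multiplication by ['X_k] factors through ['X_i] modulo [Q], by a matrix whose
    characteristic polynomial splits. The product of its pencils annihilates degree [d]; if every
    pencil had a cofinite sum with [Q], all large degrees would be multiples of that product, hence
    in [Q]. *)
Lemma eigenvalue_exists Q (i k : 'I_n) : graded Q ->
  cofinite (add_mult Q 'X_i) -> ~ cofinite Q ->
  exists c, ~ cofinite (add_mult Q (pencil i k c)).
Proof.
move=> gQ [d Qd] nQ; apply: contrapT => H; apply: nQ.
have cof c : cofinite (add_mult Q (pencil i k c)).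
  by apply: contrapT => nc; apply: H; exists c.
have [QS Qh] := gQ; have [Q0 QD QZ] := QS.
have Xi1 : ('X_i : S) \is 1.-homog by rewrite dhomogX /= mdeg1.
have Xk1 : ('X_k : S) \is 1.-homog by rewrite dhomogX /= mdeg1.
have [AS _] := graded_add_mult Xi1 gQ; have [A0 AD AZ] := AS.
have [D [g [gE gS]]] := @homogv_comb F n r d.
have exC j : exists u, Q ('X_k *: g j - 'X_i *: comb g u).
  have [[m [b [md gj]]]|->] := gE j; last first.
    by exists 0; rewrite comb0 !scaler0 subrr.
  have gd : homogv d (g j) by rewrite gj -md; apply: homogv_gen.
  have [w Qw] : add_mult Q 'X_i ('X_k *: g j).
    by apply: AZ; rewrite gj; apply: Qd; rewrite md.
  have [u uE] := gS _ (homogv_hpart d w); exists u.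
  have := Qh d.+1 _ Qw.
  by rewrite hpartB !hpartZ // (hpart_id gd) uE.
have [h hP] := choice exC; pose C := \matrix_j h j.
have [cs ccs] := closed_field_poly_normal (char_poly C).
rewrite (monicP (char_poly_monic C)) scale1r in ccs.
have gC j : Q ('X_k *: g j - 'X_i *: comb g (row j C)).
  by rewrite rowK; apply: hP.
have ann := char_poly_annihilates gQ gC ccs.
have [e He] := pencil_prod_divides cs d gQ cof.
exists e => m b em.
have [b' [w [db wb Qw]]] := He _ _ em (homogv_gen F m b).
set q := \prod_(c <- cs) _ in ann Qw.
suff Q1w : Q (q *: w).
  by have := QD _ _ Qw Q1w; rewrite subrK.
(* The colon submodule of [Q] by [q] contains degree [d] by [ann], hence every degree from [d]
   on. *)
pose Q1 w := Q (q *: w).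
have Q1S : submod Q1.
  split; rewrite /Q1; first by rewrite scaler0.
  - by move=> x y; rewrite scalerDr; apply: QD.
  - by move=> p x; rewrite scalerA mulrC -scalerA; apply: QZ.
suff Q1d : contains_degree Q1 d by exact: (contains_homogv Q1S Q1d db wb).
apply: contains_degree_eq => // m' b0 m'd.
have [|u ->] := gS ('X_[m'] *: gen F n b0); last exact: ann.
by rewrite -m'd; apply: homogv_gen.
Qed.

(** The variables are added to [Q] one after another. Once all are added, the submodule contains
    degree one and is cofinite, so some variable is the first to make it so. *)
Lemma isolate_variable Q : graded Q -> ~ cofinite Q ->
  exists i Q1, [/\ graded Q1, (forall z, Q z -> Q1 z), ~ cofinite Q1 &
    cofinite (add_mult Q1 'X_i)].
Proof.
move=> gQ nQ; apply: contrapT => H.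
have Xh (i : 'I_n) : ('X_i : S) \is 1.-homog by rewrite dhomogX /= mdeg1.
suff Hs s : (s <= n)%N -> exists Q1, [/\ graded Q1,
    (forall z, Q z -> Q1 z), ~ cofinite Q1 &
    forall k : 'I_n, (k < s)%N -> forall z, Q1 ('X_k *: z)].
  have [Q1 [[[Q0 QD QZ] _] _ nQ1 Q1X]] := Hs _ (leqnn n).
  apply: nQ1; exists 1 => m i m1.
  have [l ml] : exists l, m l != 0%N.
    apply: contrapT => nm; move: m1; rewrite mdegE big1 => [|l _]; first by lia.
    by apply: contrapT => /eqP ml; apply: nm; exists l.
  have lem : (U_(l) <= m)%MM by rewrite lep1mP.
  by rewrite -(submK lem) addmC mpolyXD -scalerA; apply: Q1X.
elim: s => [_|s IH sn]; first by exists Q; split.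
have [Q1 [gQ1 QQ1 nQ1 Q1X]] := IH (ltnW sn).
pose k := Ordinal sn; exists (add_mult Q1 'X_k).
have g1 := graded_add_mult (Xh k) gQ1; split => //.
- by move=> z /QQ1; apply: add_mult_sub; case: gQ1.
- by move=> cQ; apply: H; exists k, Q1; split.
move=> l; rewrite ltnS leq_eqVlt => /orP[/eqP lk | ls] z.
  rewrite (_ : l = k); last exact/val_inj.
  by apply: add_mult_mul; case: gQ1.
by apply: add_mult_sub; [case: gQ1 | apply: Q1X].
Qed.

(* A graded submodule of infinite codimension lies in one on whose quotient the
   variables act through a point [c] of projective space. *)
Lemma support_point Q : graded Q -> ~ cofinite Q ->
  exists (i : 'I_n) (c : 'I_n -> F) Q', [/\ graded Q', (forall z, Q z -> Q' z),
    ~ cofinite Q', c i = 1 & forall k z, Q' (pencil i k (c k) *: z)].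
Proof.
move=> gQ nQ; have [i [Q1 [gQ1 QQ1 nQ1 cQ1]]] := isolate_variable gQ nQ.
exists i; suff Hs s : (s <= n)%N -> exists c Q2, [/\ [/\ graded Q2,
    (forall z, Q1 z -> Q2 z) & ~ cofinite Q2], c i = 1 &
    forall k : 'I_n, (k < s)%N -> forall z, Q2 (pencil i k (c k) *: z)].
  have [c [Q2 [[gQ2 Q12 nQ2] ci H]]] := Hs _ (leqnn n).
  exists c, Q2; split=> // [z /QQ1/Q12 //|k z].
  exact: H.
elim: s => [_|s IH sn]; first by exists (fun=> 1), Q1; split.
have [c [Q2 [[gQ2 Q12 nQ2] ci H]]] := IH (ltnW sn).
pose k := Ordinal sn; have [ki|ki] := eqVneq k i.
  exists c, Q2; split=> // l; rewrite ltnS leq_eqVlt => /orP[/eqP lk | ls] z.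
    have -> : l = i by rewrite -ki; apply/val_inj.
    rewrite ci /pencil scale1r subrr scale0r.
    by case: gQ2 => -[].
  exact: H.
have c2 : cofinite (add_mult Q2 'X_i).
  by have [d Hd] := cQ1; exists d => m b dm; apply: add_mult_mono (Hd _ _ dm).
(* The [k]-th coordinate of the point is an eigenvalue of [x_k / x_i] on the current quotient. *)
have [a na] := eigenvalue_exists k gQ2 c2 nQ2.
exists (fun l => if l == k then a else c l), (add_mult Q2 (pencil i k a)).
split.
- split; [exact: graded_add_mult (pencil_homog i k a) gQ2| |exact: na].
  by move=> z /Q12 Qz; apply: add_mult_sub Qz; case: gQ2.
- by rewrite eq_sym (negPf ki).
move=> l; rewrite ltnS leq_eqVlt => /orP[/eqP lk | ls] z.
  rewrite (_ : l = k) ?eqxx; last exact/val_inj.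
  by apply: add_mult_mul; case: gQ2.
rewrite ifN; last by apply: contraTneq ls => ->; rewrite ltnn.
by apply: add_mult_sub; [case: gQ2 | apply: H].
Qed.

End Points.

(** * The Koszul complex in coordinates *)

Section TwoForms.
Variables (F : numFieldType) (V : vectType F).
Local Notation n := (\dim {:V}).
Local Notation vbas := (vbasis {:V}).
Local Notation S := (sym V).
Implicit Types (w : ext V 2) (p q : S).

Definition biv (i l : 'I_n) : ext V 2 := wedge (vec2 vbas`_i vbas`_l).

Definition dcoord (i : 'I_n) : dual V := linfun (coord vbas i : V -> F^o).

Definition coef2 (i l : 'I_n) :
  ext V 2 -> F := wedge_form (dcoord i) (dcoord l).

Lemma dcoordE i v : dcoord i v = coord vbas i v.
Proof. by rewrite lfunE. Qed.

Lemma coef2_lin i l a w w' :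
  coef2 i l (a *: w + w') = a * coef2 i l w + coef2 i l w'.
Proof. by rewrite /coef2 linearP. Qed.

Lemma coef2N i l w : coef2 l i w = - coef2 i l w.
Proof.
rewrite /coef2 !lfunE /= /wedge_form_fun -sumrN; apply: eq_bigr => t _.
rewrite -[RHS]mulrN; congr (_ * _); rewrite opprB.
by rewrite [dcoord l _ * dcoord i _]mulrC [X in _ - X]mulrC.
Qed.

Lemma coef2_wedge i l u v : coef2 i l (wedge (vec2 u v)) =
  coord vbas i u * coord vbas l v - coord vbas i v * coord vbas l u.
Proof. by rewrite /coef2 wedge_formE !dcoordE. Qed.

Lemma increasing2_lt (t : increasing V 2) :
  (tnth (val t) ord0 < tnth (val t) ord_max)%N.
Proof. by case: t => [[[|x [|y [|]]] //= sz] /=]; rewrite andbT. Qed.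

Lemma increasing2_inj (s t : increasing V 2) :
  tnth (val s) ord0 = tnth (val t) ord0 ->
  tnth (val s) ord_max = tnth (val t) ord_max -> s = t.
Proof.
move=> e0 e1; apply/val_inj/eq_from_tnth => i.
have [->|->] : i = ord0 \/ i = ord_max by
  case: i => [[|[|//]] ?]; [left|right]; apply: val_inj.
- exact: e0.
- exact: e1.
Qed.

Lemma coef2_coord w (t : increasing V 2) :
  coef2 (tnth (val t) ord0) (tnth (val t) ord_max) w = w t.
Proof.
have lt2 := increasing2_lt; rewrite /coef2 lfunE /= /wedge_form_fun.
rewrite (bigD1 t) //= big1 => [|s st].
  rewrite !dcoordE !coord_vbas !eqxx -!val_eqE /=.
  by have := lt2 t; case: ltngtP => // _ _; rewrite mul0r subr0 !mulr1 addr0.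
rewrite !dcoordE !coord_vbas.
suff -> : (tnth (val s) ord0 == tnth (val t) ord0)%:R *
    (tnth (val s) ord_max == tnth (val t) ord_max)%:R -
    (tnth (val s) ord_max == tnth (val t) ord0)%:R *
    (tnth (val s) ord0 == tnth (val t) ord_max)%:R = 0 :> F by rewrite mulr0.
rewrite -!natrM !mulnb.
case: andP => [[/eqP e0 /eqP e1]|_].
  by move: st; rewrite (increasing2_inj e0 e1) eqxx.
case: andP => [[/eqP e0 /eqP e1]|_]; last by rewrite subrr.
by have := lt2 s; have := lt2 t; rewrite e0 e1 => /ltn_trans h /h; rewrite ltnn.
Qed.

Lemma sum_delta2 (R : pzRingType) m (c : 'I_m -> 'I_m -> R) a b :
  \sum_i \sum_l c i l * ((i == a)%:R * (l == b)%:R) = c a b.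
Proof.
rewrite (bigD1 a) //= [X in _ + X]big1 ?addr0 => [|i /negPf ia].
  rewrite (bigD1 b) //= big1 ?addr0 => [|l /negPf lb].
    by rewrite !eqxx !mulr1.
  by rewrite lb !mulr0.
by rewrite big1 // => l _; rewrite ia mul0r mulr0.
Qed.

(** Summing over all ordered pairs counts each basis bivector twice, hence [w + w]; the factor two
    is removed in characteristic zero. *)
Lemma ext2E w : w + w = \sum_i \sum_l coef2 i l w *: biv i l.
Proof.
apply/ffunP => t; rewrite ffunE sum_ffunE.
under eq_bigr => i _ do rewrite sum_ffunE.
set a := tnth (val t) ord0; set b := tnth (val t) ord_max.
transitivity (\sum_i \sum_l coef2 i l w *
  ((i == a)%:R * (l == b)%:R - (i == b)%:R * (l == a)%:R)); last first.
  apply: eq_bigr => i _; apply: eq_bigr => l _.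
  by rewrite ffunE wedge2E !coord_vbas.
under eq_bigr => i _ do (under eq_bigr => l _ do rewrite mulrBr; rewrite sumrB).
by rewrite sumrB !sum_delta2 (coef2N a b) opprK coef2_coord.
Qed.

End TwoForms.

Section Tensors.
Variables (F : numFieldType) (V A : vectType F).
Local Notation S := (sym V).

Lemma tens0l p : tens (0 : A) p = 0 :> tensS V A.
Proof. by apply/ffunP => i; rewrite !ffunE linear0 mpolyC0 mul0r. Qed.

Lemma tens_suml (I : finType) (c : I -> F) (x : I -> A) (p : S) :
  tens (\sum_i c i *: x i) p = \sum_i (c i)%:MP *: tens (x i) p.
Proof.
elim/big_rec2: _ => [|i y z _ <-]; first exact: tens0l.
exact: tens_linE.
Qed.

Lemma tens_sumr (I : finType) (x : A) (p : I -> S) :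
  tens x (\sum_i p i) = \sum_i tens x (p i).
Proof. by apply/ffunP => j; rewrite sum_ffunE !ffunE mulr_sumr;
  apply: eq_bigr => i _; rewrite ffunE. Qed.

Lemma tensNr (x : A) (p : S) : tens x (- p) = - tens x p.
Proof. by apply/ffunP => i; rewrite !ffunE mulrN. Qed.

Lemma tens_decomp (z : tensS V A) :
  z = \sum_(a < \dim {:A}) tens (vbasis {:A})`_a (z a).
Proof.
apply/ffunP => j; rewrite sum_ffunE (bigD1 j) //= big1 => [|a aj].
  by rewrite ffunE coord_free ?(basis_free (vbasisP _)) // eqxx mul1r addr0.
rewrite ffunE coord_free ?(basis_free (vbasisP _)) //.
by rewrite (negPf aj) mpolyC0 mul0r.
Qed.

Lemma tens_scale (x : A) (p : S) : tens x p = p *: tens x 1.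
Proof. by rewrite -tensZ mul1r. Qed.

End Tensors.

(** * Exactness of the Koszul complex at the second exterior power *)

Section Skew.
Variables (F : numFieldType) (V : vectType F).
Local Notation n := (\dim {:V}).
Local Notation vbas := (vbasis {:V}).
Local Notation S := (sym V).
Implicit Types (w : ext V 2) (p q : S) (z : tensS V (ext V 2)).

Definition skew (i l : 'I_n) : {linear tensS V (ext V 2) -> S^o} :=
  @extend F V (ext V 2) S^o (fun w => (coef2 i l w)%:MP).

(** The [l]-th coordinate of the Koszul differential from the second exterior power to [V (x) S]. *)
Definition contr2 (l : 'I_n) : {linear tensS V (ext V 2) -> S^o} :=
  @extend F V (ext V 2) S^o (fun w => \sum_i (coef2 i l w)%:MP * 'X_i).

Lemma skewE i l z :
  skew i l z = \sum_(a < \dim {: ext V 2}) (z a :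
    S) * (coef2 i l (vbasis {:ext V 2})`_a)%:MP.
Proof. by []. Qed.

Lemma skewN i l z : skew l i z = - skew i l z.
Proof.
rewrite !skewE -sumrN; apply: eq_bigr => a _.
by rewrite coef2N mpolyCN mulrN.
Qed.

Lemma contr2E l z : contr2 l z = \sum_i 'X_i * (skew i l z : S).
Proof.
under [RHS]eq_bigr => i _ do rewrite skewE mulr_sumr.
rewrite exchange_big /=; apply: eq_bigr => a _.
rewrite [LHS]mulr_sumr; apply: eq_bigr => i _.
by rewrite /GRing.scale /= [in RHS]mulrC -mulrA.
Qed.

(** The double sum pairs the symmetric ['X_l * 'X_i] with the skew coordinates, so it equals its own
    opposite. *)
Lemma contr2_syz z : \sum_l 'X_l * (contr2 l z : S) = 0.
Proof.
under eq_bigr => l _ do rewrite contr2E mulr_sumr.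
set T := \sum_l _.
have TN : T = - T.
  rewrite {1}/T exchange_big /= -sumrN; apply: eq_bigr => i _.
  rewrite -sumrN; apply: eq_bigr => l _.
  transitivity ('X_l * ('X_i * - (skew l i z : S))).
    by congr (_ * (_ * _)); exact: skewN.
  by rewrite !mulrN mulrCA.
have T2 : T + T = 0 by rewrite {2}TN subrr.
move/eqP: T2; rewrite -mulr2n -mulr_natr mulf_eq0 => /orP[/eqP //|].
rewrite -(rmorph_nat (@mpolyC n F)) mpolyC_eq0 pnatr_eq0 //.
Qed.

Lemma contr2_tens l u v p : contr2 l (tens (wedge (vec2 u v)) p) =
  p * ((coord vbas l v)%:MP * sym_inj u - (coord vbas l u)%:MP * sym_inj v).
Proof.
rewrite /= extend_tens => [|a x y]; last first.
  rewrite scaler_sumr -big_split; apply: eq_bigr => i _.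
  by rewrite coef2_lin mpolyCD mpolyCM mulrDl /GRing.scale /= mulrA.
rewrite /GRing.scale /=; congr (p * _); rewrite /sym_inj !mulr_sumr -sumrB;
  apply: eq_bigr => i _.
rewrite coef2_wedge mpolyCB !mpolyCM mulrBl -!mul_mpolyC.
by rewrite !mulrA [X in X * _ - _]mulrC [X in _ - X * _]mulrC.
Qed.

Lemma koszul_diff3_sum (y : tensS V (ext V 3)) : koszul_diff V 2 y =
  \sum_(a < \dim {: ext V 3}) (y a : S) *: koszul_wedge (vbasis {: ext V 3})`_a.
Proof. by []. Qed.

Lemma contr2Z l p z : contr2 l (p *: z) = p * (contr2 l z : S).
Proof. exact: linearZ. Qed.

Lemma contr2_sum l (I : finType) (f : I -> tensS V (ext V 2)) :
  contr2 l (\sum_i f i) = \sum_i (contr2 l (f i) : S).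
Proof. exact: linear_sum. Qed.

Lemma contr2_koszul l (y : tensS V (ext V 3)) :
  contr2 l (koszul_diff V 2 y) = 0.
Proof.
rewrite koszul_diff3_sum contr2_sum big1 // => a _.
rewrite contr2Z /koszul_wedge contr2_sum big1 ?mulr0 // => t _.
rewrite contr2Z [X in koszul_pure X]vec3E koszul_pure3E.
rewrite linearD linearB !contr2_tens.
by set a1 := sym_inj _; set a2 := sym_inj _; set a3 := sym_inj _;
  rewrite (_ : _ - _ + _ = 0) ?mulr0 //; ring.
Qed.

Lemma tensDl (A : vectType F) (x y : A) p :
  tens (x + y) p = tens x p + tens y p.
Proof. by apply/ffunP => j; rewrite !ffunE linearD mpolyCD mulrDl. Qed.

Lemma skew_sum z : z + z = \sum_i \sum_l tens (biv i l) (skew i l z : S).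
Proof.
rewrite {1 2}(tens_decomp z) -big_split /=.
transitivity (\sum_(a < \dim {: ext V 2}) \sum_i \sum_l
    (coef2 i l (vbasis {: ext V 2})`_a)%:MP *: tens (biv i l) (z a)).
  apply: eq_bigr => a _; rewrite -tensDl ext2E.
  under eq_bigr => i _.
    rewrite (_ : \sum_l _ = 1 *: \sum_l coef2 i l (vbasis {: ext V 2})`_a *:
      biv i l).
      over.
    by rewrite scale1r.
  rewrite tens_suml; apply: eq_bigr => i _.
  by rewrite mpolyC1 scale1r tens_suml.
rewrite exchange_big; apply: eq_bigr => i _ /=.
rewrite exchange_big; apply: eq_bigr => l _ /=.
rewrite -[extend _ z]/(skew i l z) skewE tens_sumr.
by apply: eq_bigr => a _; rewrite tensZ.
Qed.

Lemma euler_homog d p : p \is d.-homog -> \sum_i 'X_i * mderiv i p = p *+ d.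
Proof.
move=> pd; rewrite {2}[p]mpolyE -sumrMnl.
under eq_bigr => i _ do rewrite {1}[p]mpolyE raddf_sum mulr_sumr.
rewrite exchange_big /=; apply: eq_big_seq => m ms.
under eq_bigr => i _ do rewrite mderivZ mderivX.
have <- : mdeg m = d := dhomog_mf pd ms.
rewrite mdegE -sumrMnr.
apply: eq_bigr => i _; case: (posnP (m i)) => [->|mi].
  by rewrite scale0r scaler0 mulr0 mulr0n.
have le : (U_(i) <= m)%MM by rewrite lep1mP -lt0n.
rewrite -!scalerAr -mpolyXD addmC submK // scaler_nat.
by rewrite -scalerMnr.
Qed.

Lemma skew_homog d z i l : (forall a, (z a : S) \is d.-homog) ->
  (skew i l z : S) \is d.-homog.
Proof.
move=> zd; rewrite skewE; apply: rpred_sum => a _.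
by rewrite mulrC mul_mpolyC rpredZ.
Qed.

Lemma mderiv_var (i l : 'I_n) : mderiv l ('X_i : S) = (i == l)%:R.
Proof.
rewrite mderivX mnm1E; case: eqP => [->|_]; last by rewrite scale0r.
rewrite (_ : (_ - _)%MM = 0%MM) ?mpolyX0 ?scale1r //.
by apply/mnmP => x; rewrite mnmBE subnn mnm0E.
Qed.

Lemma contr2_skew_deriv z l j : contr2 j z = 0 ->
  \sum_i 'X_i * mderiv l (skew i j z : S) = - (skew l j z : S).
Proof.
move=> z0; have := congr1 (mderiv l) (contr2E j z).
rewrite z0 raddf0 raddf_sum /=.
under eq_bigr => i _ do rewrite mderivM mderiv_var.
rewrite big_split (bigD1 l) //= eqxx mul1r big1 ?addr0 => [|i /negPf il].
  by move/eqP; rewrite eq_sym addrC addr_eq0 => /eqP.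
by rewrite il mul0r.
Qed.

Lemma sym_inj_vbas (i : 'I_n) : sym_inj vbas`_i = 'X_i :> S.
Proof.
rewrite /sym_inj (bigD1 i) //= coord_vbas eqxx scale1r big1 ?addr0 // => l li.
by rewrite coord_vbas eq_sym (negPf li) scale0r.
Qed.

Lemma koszul_diff_vec3 (x y t : V) p :
  koszul_diff V 2 (tens (wedge (vec3 x y t)) p) =
  tens (wedge (vec2 y t)) (sym_inj x * p) -
  tens (wedge (vec2 x t)) (sym_inj y * p) +
  tens (wedge (vec2 x y)) (sym_inj t * p).
Proof.
rewrite /= extend_tens; last exact: koszul_wedge_linE.
by rewrite koszul_wedge3E koszul_pure3E scalerDr scalerBr -!tensZ.
Qed.

Lemma koszul_diff_sum (I : finType) (f : I -> tensS V (ext V 3)) :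
  koszul_diff V 2 (\sum_i f i) = \sum_i koszul_diff V 2 (f i).
Proof. exact: linear_sum. Qed.

(** The preimage is a multiple of the exterior derivative of [z]. Euler's identity contributes [d]
    copies of [z + z], and the two other terms one copy each, by differentiating the relations
    [contr2 j z = 0]; hence the denominator [2 (d + 2)]. *)
Lemma koszul_exact d z : (forall a, (z a : S) \is d.-homog) ->
  (forall j, contr2 j z = 0) -> exists y, koszul_diff V 2 y = z.
Proof.
move=> zd z0.
pose Z i l : S := skew i l z.
have zz : z + z = \sum_i \sum_l tens (biv i l) (Z i l) by exact: skew_sum.
pose y := \sum_(l < n) \sum_(i < n) \sum_(j < n)
  tens (wedge (vec3 vbas`_l vbas`_i vbas`_j)) (mderiv l (Z i j)).
pose A l i j := tens (biv i j) ('X_l * mderiv l (Z i j)).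
pose B l i j := tens (biv l j) ('X_i * mderiv l (Z i j)).
pose C l i j := tens (biv l i) ('X_j * mderiv l (Z i j)).
have AE : \sum_l \sum_i \sum_j A l i j = (z + z) *+ d.
  rewrite zz -sumrMnl exchange_big; apply: eq_bigr => i _ /=.
  rewrite -sumrMnl exchange_big; apply: eq_bigr => j _ /=.
  rewrite /A -tens_sumr (euler_homog (d := d)); last exact: skew_homog.
  by apply/ffunP => a; rewrite ffunMnE !ffunE mulrnAr.
have BE : \sum_l \sum_i \sum_j B l i j = - (z + z).
  rewrite zz -sumrN; apply: eq_bigr => l _.
  rewrite exchange_big -sumrN; apply: eq_bigr => j _ /=.
  by rewrite /B -tens_sumr contr2_skew_deriv // tensNr.
have CE : \sum_l \sum_i \sum_j C l i j = z + z.
  rewrite zz; apply: eq_bigr => l _; apply: eq_bigr => i _.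
  rewrite /C -tens_sumr; congr tens.
  transitivity (- \sum_j 'X_j * mderiv l (Z j i)).
    rewrite -sumrN; apply: eq_bigr => j _.
    by rewrite [Z i j](skewN j i) raddfN mulrN.
  by rewrite contr2_skew_deriv // opprK.
have yE : koszul_diff V 2 y = (z + z) *+ d.+2.
  transitivity (\sum_l \sum_i \sum_j (A l i j - B l i j + C l i j)).
    rewrite /y koszul_diff_sum; apply: eq_bigr => l _.
    rewrite koszul_diff_sum; apply: eq_bigr => i _.
    rewrite koszul_diff_sum; apply: eq_bigr => j _.
    by rewrite koszul_diff_vec3 !sym_inj_vbas.
  under eq_bigr => l _ do (under eq_bigr => i _ do rewrite big_split sumrB;
    rewrite big_split sumrB).
  by rewrite big_split /= sumrB AE BE CE opprK -!mulrSr.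
exists ((((d.+2 * 2)%:R)^-1)%:MP *: y).
rewrite linearZ_LR yE -mulr2n -mulrnA -scaler_nat scalerA.
by rewrite -(rmorph_nat (@mpolyC n F)) -mpolyCM mulnC mulVf ?pnatr_eq0 //
  scale1r.
Qed.
End Skew.

(** * Lifting from the quotient by [K], and the kernel of the projection *)

Section QuotientLift.
Variables (F : numFieldType) (V : vectType F) (K : {vspace ext V 2}).
Local Notation n := (\dim {:V}).
Local Notation vbas := (vbasis {:V}).
Local Notation S := (sym V).
Local Notation ebas := (vbasis {: ext V 2}).
Local Notation m2 := (\dim {: ext V 2}).

Lemma vquot_pi_val (v : vquot K) : vquot_pi K (vsval v) = v.
Proof.
rewrite /vquot_pi daddv_pi_id ?vsvalK //; last exact: subvsP.
by rewrite capvC capv_compl.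
Qed.

Definition lift_tens : {linear tensS V (vquot K) -> tensS V (ext V 2)} :=
  @extend F V (vquot K) (tensS V (ext V 2)) (fun v =>
    tens (vsval v : ext V 2) 1).

Lemma lift_tensE (v : vquot K) p : lift_tens (tens v p) = tens (vsval v :
  ext V 2) p.
Proof.
rewrite /= extend_tens => [|a x y]; first by rewrite -tensZ mul1r.
by rewrite linearP tens_linE.
Qed.

Lemma lift_tens_sum (I : finType) (f : I -> tensS V (vquot K)) :
  lift_tens (\sum_i f i) = \sum_i lift_tens (f i).
Proof. exact: linear_sum. Qed.

Lemma proj_tensS_sum (I : finType) (f : I -> tensS V (ext V 2)) :
  proj_tensS K (\sum_i f i) = \sum_i proj_tensS K (f i).
Proof. exact: linear_sum. Qed.

Lemma proj_lift (x : tensS V (vquot K)) : proj_tensS K (lift_tens x) = x.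
Proof.
rewrite [in LHS](tens_decomp x) lift_tens_sum proj_tensS_sum [RHS]tens_decomp.
apply: eq_bigr => a _; by rewrite lift_tensE proj_tensSE vquot_pi_val.
Qed.

Lemma lift_homog d (x : tensS V (vquot K)) a :
  (forall b, (x b : S) \is d.-homog) -> (lift_tens x a : S) \is d.-homog.
Proof.
move=> xd; rewrite /= /extend sum_ffunE; apply: rpred_sum => b _.
by rewrite !ffunE mulr1 /GRing.scale /= mulrC mul_mpolyC rpredZ.
Qed.

(** The component along [K] of a basis vector. This spanning family, indexed by the basis of the
    whole space, lets the coordinates of [z] serve as coefficients in [proj_kernel]. *)
Definition kgen (a : 'I_m2) : ext V 2 := ebas`_a - vsval (vquot_pi K ebas`_a).

Lemma kgen_mem a : kgen a \in K.
Proof.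
rewrite -vquot_pi_eq0 /kgen (linearB (vquot_pi K)) subr_eq0 eq_sym.
by apply/eqP; exact: (vquot_pi_val (vquot_pi K _)).
Qed.

Lemma tensBl (A : vectType F) (x y : A) (p : S) :
  tens (x - y) p = tens x p - tens y p.
Proof. by rewrite tensDl tensN. Qed.

Lemma proj_kgen a : proj_tensS K (tens (kgen a) 1) = 0.
Proof.
rewrite proj_tensSE; have := kgen_mem a.
by rewrite -vquot_pi_eq0 => /eqP ->; apply: tens0l.
Qed.

Lemma proj_kernel (z : tensS V (ext V 2)) : proj_tensS K z = 0 ->
  z = \sum_(a < m2) (z a : S) *: tens (kgen a) 1.
Proof.
move=> z0; transitivity (z - lift_tens (proj_tensS K z)).
  by rewrite z0 linear0 subr0.
rewrite [X in X - _](tens_decomp z) [X in proj_tensS K X](tens_decomp z).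
rewrite proj_tensS_sum lift_tens_sum -sumrB; apply: eq_bigr => a _.
by rewrite proj_tensSE lift_tensE -tensBl tens_scale.
Qed.

End QuotientLift.

(** * The fibres of the Koszul module *)

Section GradedImage.
Variables (F : fieldType) (n r N : nat).
Local Notation S := {mpoly F[n]}.
Local Notation G := {ffun 'I_r -> S^o}.

Lemma graded_span (g : 'I_N -> G) : (forall i, homogv 1 (g i)) ->
  graded (fun x => exists y : 'I_N -> S, \sum_i y i *: g i = x).
Proof.
move=> g1; split; first split.
- by exists (fun=> 0); rewrite big1 // => i _; rewrite scale0r.
- move=> _ _ [y <-] [y' <-]; exists (fun i => y i + y' i).
  by rewrite -big_split; apply: eq_bigr => i _; rewrite scalerDl.
- move=> p _ [y <-]; exists (fun i => p * y i).
  by rewrite scaler_sumr; apply: eq_bigr => i _; rewrite scalerA.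
move=> [|d] _ [y <-].
  exists (fun=> 0); apply/ffunP => j; rewrite ffunE !sum_ffunE raddf_sum.
  apply: eq_bigr => i _; rewrite !ffunE scale0r.
  by rewrite /GRing.scale /= mulrC pihomog0_mul_linear //; apply: g1.
exists (fun i => pihomog mdeg d (y i)).
apply/ffunP => j; rewrite ffunE !sum_ffunE raddf_sum.
apply: eq_bigr => i _; rewrite !ffunE.
rewrite /GRing.scale /= [in RHS]mulrC pihomog_mul_linear 1?mulrC //.
exact: g1.
Qed.

End GradedImage.

Section Fibre.
Variables (F : numClosedFieldType) (V : vectType F) (K : {vspace ext V 2}).
Local Notation n := (\dim {:V}).
Local Notation r := (\dim {: vquot K}).
Local Notation vbas := (vbasis {:V}).
Local Notation S := (sym V).

Definition relations (x : {ffun 'I_r -> {mpoly F[n]}^o}) : Prop :=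
  exists y, koszul_map K y = x.

Lemma koszul_map_sum (y : tensS V (ext V 3)) : koszul_map K y =
  \sum_(a < \dim {: ext V 3}) (y a : S) *:
    proj_tensS K (koszul_wedge (vbasis {: ext V 3})`_a).
Proof.
rewrite -[LHS]/(proj_tensS K (koszul_diff V 2 y)) koszul_diff3_sum
  proj_tensS_sum.
by apply: eq_bigr => a _; rewrite linearZ.
Qed.

Lemma proj_koszul_wedge_homog (w : ext V 3) j :
  (proj_tensS K (koszul_wedge w) j : S) \is 1.-homog.
Proof.
rewrite /= /extend sum_ffunE; apply: rpred_sum => l _.
rewrite !ffunE mulr1.
by rewrite /GRing.scale /= mulrC mul_mpolyC; apply/rpredZ/koszul_wedge_homog.
Qed.

Lemma relations_graded : graded relations.
Proof.
suff -> : relations = (fun x => exists y : 'I_(\dim {: ext V 3}) -> S,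
  \sum_i y i *: proj_tensS K (koszul_wedge (vbasis {: ext V 3})`_i) = x).
  by apply: graded_span => i j; apply: proj_koszul_wedge_homog.
apply/funext => x; apply/propext; split=> [[y <-]|[y <-]].
  by exists y; rewrite koszul_map_sum.
exists [ffun a => y a]; rewrite koszul_map_sum; apply: eq_bigr => a _.
by rewrite ffunE.
Qed.

End Fibre.

(** Applied with [x], [y], [z] the variables of indices [i], [j], [k]: modulo [y - a x] and
    [z - b x], the Koszul relation becomes [x] times a single vector. *)
Lemma fibre_relation (R : comNzRingType) (U : lmodType R) (x y z a b : R)
    (u v w : U) :
  x *: u - y *: v + z *: w + ((y *: v - a *: (x *: v)) +
    (- 1) *: (z *: w - b *: (x *: w))) = x *: (b *: w + (- a *: v + u)).
Proof.
rewrite scaleN1r opprB addrACA subrKA [z *: w + _]addrC subrK.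
rewrite scaleNr [in RHS]addrC [- _ + u]addrC scalerDr scalerBr !scalerA.
by rewrite [a * x]mulrC [b * x]mulrC.
Qed.

Section Fibre.
Variables (F : numClosedFieldType) (V : vectType F) (K : {vspace ext V 2}).
Local Notation n := (\dim {:V}).
Local Notation r := (\dim {: vquot K}).
Local Notation vbas := (vbasis {:V}).
Local Notation S := (sym V).

Lemma koszul_map_vec3 (x y t : V) :
  koszul_map K (tens (wedge (vec3 x y t)) 1) =
  sym_inj x *: tens (vquot_pi K (wedge (vec2 y t))) 1 -
  sym_inj y *: tens (vquot_pi K (wedge (vec2 x t))) 1 +
  sym_inj t *: tens (vquot_pi K (wedge (vec2 x y))) 1.
Proof.
rewrite -[LHS]/(proj_tensS K (koszul_diff V 2 (tens _ _))) koszul_diff_vec3.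
have E u (p : S) : proj_tensS K (tens u p) = p *: tens (vquot_pi K u) 1.
  by rewrite proj_tensSE; apply: tens_scale.
by rewrite !mulr1 (linearD (proj_tensS K)) (linearB (proj_tensS K)) !E.
Qed.

Lemma gen_tens (b : 'I_r) :
  gen F n b = tens (vquot_pi K (vsval (vbasis {: vquot K})`_b)) (1 : S).
Proof.
apply/ffunP => j; rewrite !ffunE mulr1 vquot_pi_val.
rewrite coord_free ?(basis_free (vbasisP _)) //.
by case: (b == j); rewrite ?mpolyC0 ?mpolyC1.
Qed.

Lemma dual_sumE (c : 'I_n -> F) (k : 'I_n) :
  (\sum_j c j *: dcoord j : dual V) vbas`_k = c k.
Proof.
rewrite sum_lfunE (bigD1 k) //= scale_lfunE dcoordE coord_vbas eqxx.
rewrite big1 ?addr0 ?[_ *: _]mulr1 // => j /negPf jk.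
by rewrite scale_lfunE dcoordE coord_vbas eq_sym jk [_ *: _]mulr0.
Qed.

Lemma ext2_lfun_eq (f g : 'Hom(ext V 2, F^o)) :
  (forall j k, f (biv j k) = g (biv j k)) -> f = g.
Proof.
move=> fg; apply/lfunP => w.
have E (h : 'Hom(ext V 2, F^o)) : h w *+ 2 =
    \sum_j \sum_k coef2 j k w * h (biv j k).
  rewrite mulr2n -linearD ext2E linear_sum; apply: eq_bigr => j _.
  by rewrite linear_sum; apply: eq_bigr => k _; rewrite linearZ.
have : f w *+ 2 = g w *+ 2.
  by rewrite !E; apply: eq_bigr => j _; apply: eq_bigr => k _; rewrite fg.
by move/eqP; rewrite -subr_eq0 -mulrnBl -mulr_natr mulf_eq0 pnatr_eq0 orbF
  subr_eq0 => /eqP.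
Qed.

(* A point of the support of the Koszul module gives an element of the resonance
   variety: the fibre of the relations at that point does not span the quotient
   by [K], and a form vanishing on it is divisible by the point. *)
Lemma cofinite_relations : resonance K = [set 0]%classic ->
  cofinite (@relations F V K).
Proof.
move=> resK; apply: contrapT => nc.
have [i [c [Q [gQ QQ nQ ci Qpen]]]] := support_point (relations_graded K) nc.
have [QS _] := gQ; have [Q0 QD QZ] := QS.
have QX k z : Q ('X_k *: z - (c k)%:MP *: ('X_i *: z)).
  by rewrite scalerA -scalerBl mul_mpolyC; apply: Qpen.
(* The Koszul relation on [e_i], [e_j], [e_k] evaluated at the point [c], where [c i = 1]. *)
pose rho j k : ext V 2 := c k *: biv i j + (- c j *: biv i k + biv j k).
pose T (w : ext V 2) : tensS V (vquot K) := tens (vquot_pi K w) 1.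
pose P w := Q ('X_i *: T w).
have TD a w w' : T (a *: w + w') = a%:MP *: T w + T w'.
  by rewrite /T linearP tens_linE.
have PD a w w' : P w -> P w' -> P (a *: w + w').
  move=> Pw Pw'; rewrite /P TD scalerDr scalerA mulrC -scalerA.
  exact: QD (QZ a%:MP _ Pw) Pw'.
have P0 w : w \in K -> P w.
  rewrite -vquot_pi_eq0 => /eqP w0.
  by rewrite /P /T w0 tens0l scaler0.
have Prho j k : P (rho j k).
  have : Q (koszul_map K (tens (wedge (vec3 vbas`_i vbas`_j vbas`_k)) 1)).
    by apply: QQ; exists (tens (wedge (vec3 vbas`_i vbas`_j vbas`_k)) 1).
  rewrite koszul_map_vec3 !sym_inj_vbas -/(T (biv j k)) -/(T (biv i k)).
  rewrite -/(T (biv i j)).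
  have Q1 := QD _ _ (QX j (T (biv i k))) (QZ (- 1) _ (QX k (T (biv i j)))).
  move=> Q2; have := QD _ _ Q2 Q1.
  by rewrite fibre_relation /P !TD mpolyCN.
pose L := (K + \sum_(jk : 'I_n * 'I_n) <[rho jk.1 jk.2]>)%VS.
have LK w : w \in K -> w \in L by move=> wK; apply: subvP wK; apply: addvSl.
have Lrho j k : rho j k \in L.
  apply: subvP (addvSr _ _) _ _; apply: subvP (memv_line _).
  exact: (sumv_sup (j, k)).
have PL w : w \in L -> P w.
  have Padd u v : P u -> P v -> P (u + v).
    by move=> Pu Pv; rewrite -[u]scale1r; apply: PD.
  have Pz : P 0 by apply: P0; rewrite mem0v.
  case/memv_addP => u /P0 Pu [v /memv_sumP[f fP ->] ->]; apply: (Padd _ _ Pu).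
  elim/big_ind: _ => [|//|jk _]; first exact: Pz.
  have /vlineP[a ->] := fP jk isT; rewrite -[_ *: _]addr0.
  exact: PD (Prho _ _) Pz.
(* Otherwise ['X_i *: T w] lies in [Q] for every [w], and so does ['X_k *: T w] by [QX]; then [Q]
   contains degree one and is cofinite. *)
have [w wL] : exists w, w \notin L.
  apply: contrapT => nw; apply: nQ; exists 1; apply: contains_degree_eq => //.
  move=> m b /eqP /mdeg1P[k /eqP ->]; rewrite gen_tens.
  set w := vsval _; have wL : w \in L.
    by apply: contrapT => wL; apply: nw; exists w; apply/negP.
  have := QD _ _ (QX k (T w)) (QZ (c k)%:MP _ (PL w wL)).
  by rewrite subrK.
have [al al0] : exists al, coord (vbasis {: vquot L}) al (vquot_pi L w) != 0.
  apply: contrapT => nal; move/negP: wL; apply; rewrite -vquot_pi_eq0.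
  rewrite (coord_vbasis (memvf (vquot_pi L w))) big1 // => al _.
  suff -> : coord (vbasis {: vquot L}) al (vquot_pi L w) = 0 by rewrite scale0r.
  by apply: contrapT => /eqP h; apply: nal; exists al.
pose om0 (u : ext V 2) : F^o := coord (vbasis {: vquot L}) al (vquot_pi L u).
have om0_lin : linear om0 by move=> a u v; rewrite /om0 !linearP.
pose om0L := GRing.isLinear.Build _ _ _ _ om0 om0_lin.
pose om0' : {linear ext V 2 -> F^o} := HB.pack om0 om0L.
pose om := linfun om0'.
have omE u : om u = om0 u by rewrite lfunE.
have omL u : u \in L -> om u = 0.
  by rewrite omE /om0 -vquot_pi_eq0 => /eqP ->; rewrite linear0.
pose gam : dual V := \sum_j c j *: dcoord j.
(* The contraction of [om] by [e_i]. That [om] vanishes on [rho j k] says exactly that [om] and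
   [wedge_form gam bet] agree on [biv j k]. *)
pose bet : dual V := \sum_j om (biv i j) *: dcoord j.
have omf : wedge_form gam bet = om.
  apply: ext2_lfun_eq => j k; rewrite wedge_formE /= !dual_sumE.
  have E (a b x y z : F) : b * x + (- a * y + z) = 0 -> a * y - b * x = z.
    by move=> e; rewrite -[RHS]add0r -[X in X + z]oppr0 -e; ring.
  by have := omL _ (Lrho j k); rewrite /rho !linearP; apply: E.
have : resonance K gam.
  left; exists bet; rewrite omf; split.
    by move=> u /LK; apply: omL.
  move=> /= om_eq0; move: al0; rewrite -/(om0 w) -omE om_eq0.
  by rewrite lfunE eqxx.
rewrite resK => /= g0; have := dual_sumE c i.
rewrite -/gam g0 ci lfunE /= => /eqP; rewrite eq_sym oner_eq0 //.
Qed.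

End Fibre.

(** * Vanishing in large degree when the dimension is at least three *)

Section Vanishing.
Variables (F : numClosedFieldType) (V : vectType F) (K : {vspace ext V 2}).
Local Notation n := (\dim {:V}).
Local Notation vbas := (vbasis {:V}).
Local Notation S := (sym V).
Local Notation m2 := (\dim {: ext V 2}).
Local Notation r := (\dim {: vquot K}).

Lemma contr2_homog d (z : tensS V (ext V 2)) l :
  (forall a, (z a : S) \is d.-homog) -> (contr2 l z : S) \is d.+1.-homog.
Proof.
move=> zd; rewrite contr2E; apply: rpred_sum => i _; rewrite -(add1n d).
by apply: dhomogM; [rewrite dhomogX /= mdeg1 | apply: skew_homog].
Qed.

(** These are the coefficients [R] of the homotopy argument. *)
Definition krel (l : 'I_n) (a : 'I_m2) : S := contr2 l (tens (kgen K a) 1).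

Lemma krel_homog l a : krel l a \is 1.-homog.
Proof.
apply: contr2_homog => b; rewrite ffunE mulr1.
by rewrite -[_%:MP]mulr1 mul_mpolyC rpredZ ?dhomog1.
Qed.

Lemma contr2_proj_kernel l (z : tensS V (ext V 2)) : proj_tensS K z = 0 ->
  contr2 l z = \sum_a krel l a * (z a : S) :> S.
Proof.
move=> z0; rewrite {1}(proj_kernel z0) contr2_sum; apply: eq_bigr => a _.
by rewrite contr2Z mulrC.
Qed.

Lemma pihomog_krel d l (f : 'I_m2 -> S) :
  pihomog mdeg d.+1 (\sum_a krel l a * f a) =
  \sum_a krel l a * pihomog mdeg d (f a).
Proof.
rewrite raddf_sum; apply: eq_bigr => a _.
by apply: pihomog_mul_linear; apply: krel_homog.
Qed.

(** The class of [x_t^M e_t /\ e_i] is a relation, so up to a Koszul boundary this element is a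
    combination of the [kgen]. Contraction kills the boundary; taking degree [M] parts makes the
    coefficients homogeneous. *)
Lemma relation_coeffs M : contains_degree (@relations F V K) M ->
  forall t i, exists e : 'I_m2 -> S, (forall a, e a \is M.-homog) /\
    forall l, \sum_a krel l a * e a =
      'X_t ^+ M * ('X_t * (l == i)%:R - 'X_i * (l == t)%:R).
Proof.
move=> HM t i.
have XM : ('X_t ^+ M : S) \is M.-homog.
  by rewrite -[M in M.-homog]mul1n dhomogMn // dhomogX /= mdeg1.
have [y yE] : relations (tens (vquot_pi K (biv t i)) ('X_t ^+ M : S)).
  apply: (contains_homogv (relations_graded K).1 HM (leqnn M)) => b.
  by rewrite ffunE mul_mpolyC rpredZ.
pose z := tens (biv t i) ('X_t ^+ M : S) - koszul_diff V 2 y.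
have z0 : proj_tensS K z = 0.
  by rewrite (linearB (proj_tensS K)) proj_tensSE -yE subrr.
exists (fun a => pihomog mdeg M (z a)); split=> [a|l]; first exact: pihomogP.
rewrite -pihomog_krel -contr2_proj_kernel // /z.
rewrite (linearB (contr2 l)) contr2_koszul subr0 contr2_tens !sym_inj_vbas.
rewrite !coord_vbas [i == l]eq_sym [t == l]eq_sym.
have nE (b : bool) : (b%:R : F)%:MP = b%:R :> S.
  by case: b; rewrite ?mpolyC0 ?mpolyC1.
rewrite !nE ![_%:R * _]mulrC; apply: pihomog_dE.
rewrite -[M.+1]addn1; apply: dhomogM => //.
by apply: rpredB; case: eqP => _;
  rewrite ?mulr1 ?mulr0 ?dhomog0 // dhomogX /= mdeg1.
Qed.

Lemma homog_tens_sub d (A : vectType F) (I : finType) (z : tensS V A)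
    (f : I -> S) (w : I -> A) a :
  (forall a, (z a : S) \is d.-homog) -> (forall i, f i \is d.-homog) ->
  ((z - \sum_i f i *: tens (w i) (1 : S)) a : S) \is d.-homog.
Proof.
move=> zd fd; rewrite !ffunE sum_ffunE; apply: rpredB; first exact: zd.
apply: rpred_sum => l _.
by rewrite !ffunE mulr1 /GRing.scale /= mulrC mul_mpolyC rpredZ.
Qed.

Lemma relations_of_large_degree d (x : tensS V (vquot K)) :
  (2 < n)%N -> (n - 3 <= d)%N -> cofinite (@relations F V K) ->
  (forall b, (x b : S) \is d.-homog) -> relations x.
Proof.
move=> n3 nd [M HM] xd.
have E := relation_coeffs HM.
have [e eP] : exists e : 'I_n -> 'I_n -> 'I_m2 -> S, forall t i,
    (forall a, e t i a \is M.-homog) /\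
    forall l, \sum_a krel l a * e t i a =
      'X_t ^+ M * ('X_t * (l == i)%:R - 'X_i * (l == t)%:R).
  have [e eP] := choice (fun ti : 'I_n * 'I_n => E ti.1 ti.2).
  by exists (fun t i => e (t, i)) => t i; apply: (eP (t, i)).
(* The new index [ord0] plays the part of the generator [u], on which [R] and [e] must vanish. *)
pose ext0 (f : 'I_m2 -> S) (j : 'I_m2.+1) : S := oapp f 0 (unlift ord0 j).
have ext0_0 f : ext0 f ord0 = 0 by rewrite /ext0 unlift_none.
have ext0_S f a : ext0 f (lift ord0 a) = f a by rewrite /ext0 liftK.
have ext0P (P : S -> Prop) f :
  P 0 -> (forall a, P (f a)) -> forall j, P (ext0 f j).
  by move=> P0 Pf j; rewrite /ext0; case: unliftP => [a _|_] /=.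
have sum_ext0 f g : \sum_j ext0 f j * g j = \sum_a f a * g (lift ord0 a).
  rewrite big_ord_recl ext0_0 mul0r add0r.
  by apply: eq_bigr => a _; rewrite ext0_S.
have ordP k (p : S) : p \is k.-homog -> order_ge k p.
  by move=> pk m mp; have -> : mdeg m = k := dhomog_mf pk mp.
pose R l j := ext0 (krel l) j.
(* Setting the diagonal to zero is compatible with [e_pair], whose right side vanishes for
   [t = i]. *)
pose e' t i j := if t == i then 0 else ext0 (e t i) j.
have [z zd zx] : exists2 z : tensS V (ext V 2),
    (forall a, (z a : S) \is d.-homog) & proj_tensS K z = x.
  exists (lift_tens K x); last exact: proj_lift.
  by move=> a; apply: lift_homog.
pose c l : S := contr2 l z.
have R_syz j : \sum_l 'X_l * R l j = 0.
  rewrite /R /ext0; case: unliftP => [a _|_] /=; first exact: contr2_syz.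
  by rewrite big1 // => l _; rewrite mulr0.
have R_u l : R l ord0 = 0 by apply: ext0_0.
have e_u t i : e' t i ord0 = 0 by rewrite /e'; case: ifP => // _; apply: ext0_0.
have e_diag t j : e' t t j = 0 by rewrite /e' eqxx.
have R_order l j : order_ge 1 (R l j).
  apply: ext0P; first exact: supported0.
  by move=> a; apply: ordP; apply: krel_homog.
have e_order t i j : order_ge M (e' t i j).
  rewrite /e'; case: ifP => _; first exact: supported0.
  apply: ext0P; first exact: supported0.
  by move=> a; apply: ordP; have [h _] := eP t i; apply: h.
have e_pair t i l : \sum_j R l j * e' t i j =
    'X_t ^+ M * ('X_t * (l == i)%:R - 'X_i * (l == t)%:R).
  rewrite /e'; case: eqP => [->|_].
    by rewrite subrr mulr0 big1 // => j _; rewrite mulr0.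
  rewrite sum_ext0; have [_ <-] := eP t i.
  by apply: eq_bigr => a _; rewrite ext0_S.
have c_syz : \sum_l 'X_l * c l = 0 by apply: contr2_syz.
have c_homog l : c l \is d.+1.-homog by apply: contr2_homog.
(* The contraction raises the degree by one, so [n - 3 <= d] yields the bound [n - 2]. *)
have c_order l : order_ge (n - 2) (c l).
  by apply: order_ge_le (ordP _ _ (c_homog l)); lia.
have [b bP] := syzygy_in_span R_syz R_u e_u e_diag R_order e_order e_pair n3
  c_syz c_order.
pose b' (a : 'I_m2) : S := pihomog mdeg d (b (lift ord0 a)).
have cE l : c l = \sum_a krel l a * b' a.
  by rewrite -pihomog_krel -sum_ext0 -bP pihomog_dE.
(* The correction projects to zero, so [z'] still lifts [x], and it cancels all contractions of [z];
   exactness then makes [z'] a boundary. *)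
pose z' := z - \sum_a b' a *: tens (kgen K a) 1.
have z'd a : (z' a : S) \is d.-homog.
  apply: (homog_tens_sub (kgen K) a zd) => l; exact: pihomogP.
have z'0 l : contr2 l z' = 0.
  rewrite (linearB (contr2 l)) contr2_sum; apply/eqP; rewrite subr_eq0.
  apply/eqP; transitivity (\sum_a krel l a * b' a); first exact: cE.
  by apply: eq_bigr => a _; rewrite contr2Z mulrC.
have [y yE] := koszul_exact z'd z'0; exists y.
rewrite -[LHS]/(proj_tensS K (koszul_diff V 2 y)) yE (linearB (proj_tensS K)).
rewrite zx proj_tensS_sum big1 ?subr0 // => a _.
by rewrite linearZ_LR proj_kgen scaler0.
Qed.

End Vanishing.

(** * Small dimensions and the graded components of the Koszul module *)

Section Component.
Variables (F : numClosedFieldType) (V : vectType F) (K : {vspace ext V 2}).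
Local Notation n := (\dim {:V}).
Local Notation S := (sym V).

Lemma koszul_wedge3_small (w : ext V 3) : (n <= 2)%N -> koszul_wedge w = 0.
Proof.
move=> n2; rewrite /koszul_wedge big1 // => -[t st] _; exfalso.
case: t st => -[|a [|b [|c [|]]]] //= sz /and3P[ab bc _].
by have := ltn_ord c; lia.
Qed.

Lemma relations_small x : (n <= 2)%N -> @relations F V K x -> x = 0.
Proof.
move=> n2 [y <-]; rewrite koszul_map_sum big1 // => a _.
by rewrite koszul_wedge3_small // linear0 scaler0.
Qed.

(** In dimension one or two there are no nonzero relations, while cofiniteness would make a power of
    a variable times any generator a relation; so there are no generators. In dimension zero
    [ext V 2] itself is zero. *)
Lemma tensS_small (x : tensS V (vquot K)) : (n <= 2)%N ->
  cofinite (@relations F V K) -> x = 0.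
Proof.
move=> n2 [M HM]; have [n0|] := posnP n.
  have w0 (w : ext V 2) : w = 0.
    apply/ffunP => -[t st]; exfalso.
    by have := leq_ltn_trans (leq0n _) (ltn_ord (tnth t ord0)); lia.
  rewrite (tens_decomp x) big1 // => a _.
  set v := _`_a; rewrite -(vquot_pi_val v) [vsval v]w0 linear0.
  exact: tens0l.
move=> n1; pose l := Ordinal n1; apply/ffunP => b.
have := relations_small n2 (HM (U_(l) *+ M)%MM b _).
rewrite mdegMn mdeg1 mul1n => /(_ (leqnn M)) /ffunP /(_ b).
rewrite !ffunE eqxx [_ *: _]mulr1 => /eqP.
by rewrite -msupp_eq0 msuppX.
Qed.

Lemma koszul_component_eq0 (q : int) : resonance K = [set 0]%classic ->
  n%:Z - 3%:Z <= q -> koszul_component K q = [set 0]%classic.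
Proof.
move=> resK nq; have cof := cofinite_relations resK.
have deg0 : tensS_deg q (0 : tensS V (vquot K)).
  by move=> i; rewrite ffunE; case: (q) => [d|d] //=; apply: dhomog0.
apply/seteqP; split=> [_ [x xq <-]|_ ->]; last by exists 0 => //;
  apply: linear0.
have [y yx] : relations x.
  (* In negative degree [sym_deg] allows only zero coordinates, so [x] is zero. *)
  case: q nq xq deg0 => [d|d] nq xq _; last first.
    by exists 0; rewrite linear0; apply/ffunP => i; rewrite ffunE; have := xq i.
  have [n2|n3] := leqP n 2; last by apply: relations_of_large_degree xq => //;
    lia.
  by exists 0; rewrite linear0 [x](tensS_small _ n2 cof).
rewrite /= -(linear0 (coker_pi (koszul_map K))).
by apply/coker_pi_eq; exists y; rewrite subr0.
Qed.

End Component.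

Local Open Scope classical_set_scope.

Theorem mainTheorem5 (R : realType) (n : nat) (V : vectType R[i])
    (K : {vspace ext V 2}) :
  \dim {:V} = n ->
  resonance K = [set 0] ->
  forall q : int, n%:Z - 3%:Z <= q -> koszul_component K q = [set 0].
Proof.
by move=> <- resK q nq; apply: koszul_component_eq0.
Qed.
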